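(* Let $\tau\neq 0$ be a real constant and $\alpha\in(0,1)$ a constant. Let $\mathcal{G}_n(\alpha)$ be the Erdős–Rényi random graph on $\{1,\dots,n\}$ in which the edges $A_{ij}$ ($1\le i<j\le n$) are independent Bernoulli with $\mathbb{P}(A_{ij}=1)=p_n=n^{-\alpha}$, and let $\mathcal{I}_n=\sum_{\{i,j\}\in\mathcal{E}}(d_id_j)^{\tau}$ be its general Randić index, where $\mathcal{E}$ is the edge set and $d_i$ the degree of node $i$. Then, as $n\to\infty$, \[\frac{\mathcal{I}_n-\mathbb{E}[\mathcal{I}_n]}{\sigma_n}\Rightarrow\mathcal{N}(0,1),\] where \[\mathbb{E}[\mathcal{I}_n]=\frac{n(np_n)^{2\tau+1}}{2}\Big(1+O\Big(\frac{1}{np_n}\Big)\Big),\] and where, for $\tau=-\frac12$, \[\sigma_n^2=\frac{n(n-1)(n-2)p_n^2(1-p_n)^2}{32(1+(n-2)p_n)^4}=\Theta\Big(\frac{n}{(np_n)^2}\Big),\] while for $\tau\neq-\frac12$, \[\sigma_n^2=\frac{(1+2\tau)^2}{2}n(n-1)p_n(1+(n-2)p_n)^{4\tau}(1+o(1))=\Theta\big(n(np_n)^{4\tau+1}\big).\]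
   Context: Asymptotics are as $n\to\infty$: $a_n=\Theta(b_n)$ means $c_1b_n\le a_n\le c_2b_n$ for positive constants $c_1,c_2$; $O$, $o$ have their usual meanings; $\Rightarrow\mathcal{N}(0,1)$ denotes convergence in distribution to the standard normal distribution. The adjacency matrix is symmetric with zero diagonal and $d_i=\sum_{j\ne i}A_{ij}$. *)

(* Defs.v *)
From HB Require Import structures.
From mathcomp Require Import all_boot all_order all_algebra.
From mathcomp Require Import all_classical all_reals all_analysis.
From mathcomp Require Import measurable_realfun.

Set Implicit Arguments.
Unset Strict Implicit.
Unset Printing Implicit Defensive.

Import Order.TTheory GRing.Theory Num.Theory.
Import numFieldNormedType.Exports.

Local Open Scope classical_set_scope.
Local Open Scope ring_scope.

(* Only the subfamily of [X] indexed by [D] is concerned. *)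
Definition mutually_independent d d' (T : measurableType d)
    (T' : measurableType d') (R : realType) (P : probability T R)
    (I : finType) (D : pred I) (X : I -> {RV P >-> T'}) : Prop :=
  forall (J : {set I}) (B : I -> set T'),
    (forall i, i \in J -> D i) ->
    (forall i, i \in J -> measurable (B i)) ->
    P (\bigcap_(i in [set` J]) X i @^-1` B i) =
    (\prod_(i in J) P (X i @^-1` B i))%E.

(* [A] is the adjacency matrix of a random graph G(n, p) with vertices ['I_n];
   only the entries above the diagonal are independent. [bernoulli_prob p] is
   the Bernoulli law only for 0 <= p <= 1. *)
Record erdos_renyi d (T : measurableType d) (R : realType)
    (P : probability T R) (n : nat) (p : R)
    (A : 'I_n -> 'I_n -> {RV P >-> bool}) : Prop := ErdosRenyi {
  erdos_renyi_sym : forall i j w, A i j w = A j i w ;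
  erdos_renyi_irr : forall i w, A i i w = false ;
  erdos_renyi_bernoulli : forall i j : 'I_n, (i < j)%N ->
    distribution P (A i j) =1 bernoulli_prob p ;
  erdos_renyi_indep : mutually_independent
    (fun e : 'I_n * 'I_n => (e.1 < e.2)%N) (fun e => A e.1 e.2) }.

Arguments erdos_renyi {d T R} P {n} p A.

(* For alpha > 0 this lies in [0, 1] for all n (it is 0 at n = 0). *)
Definition edge_prob (R : realType) (alpha : R) (n : nat) : R :=
  n%:R `^ (- alpha).

Definition degree n (a : 'I_n -> 'I_n -> bool) (i : 'I_n) : nat :=
  (\sum_(j < n | j != i) a i j)%N.

(* Each edge {i, j} is counted once, as the pair i < j; the base of the power
   is positive since both end points have degree at least 1. *)
Definition randic_index (R : realType) (tau : R) n
    (a : 'I_n -> 'I_n -> bool) : R :=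
  \sum_(i < n) \sum_(j < n | (i < j)%N && a i j)
    (degree a i * degree a j)%:R `^ tau.

Definition randic d (T : measurableType d) (R : realType) (tau : R) n
    (A : 'I_n -> 'I_n -> {mfun T >-> bool}) : T -> R :=
  fun w => randic_index tau (fun i j => A i j w).

Section randic_measurable.
Context d (T : measurableType d) (R : realType).
Context (tau : R) (n : nat) (A : 'I_n -> 'I_n -> {mfun T >-> bool}).

Let measurable_degree i :
  measurable_fun setT (fun w => (degree (fun i j => A i j w) i)%:R : R).
Proof.
rewrite /degree; under eq_fun do rewrite natr_sum big_mkcond /=.
apply: measurable_sum => j; case: (j != i) => //=.
rewrite (_ : (fun _ => _) = (fun w => if A i j w then 1 else 0)); last first.
  by apply/funext => w; case: (A i j w).
exact: measurable_fun_ifT.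
Qed.

Let measurable_randic : measurable_fun setT (randic tau A).
Proof.
apply: measurable_sum => i; under eq_fun do rewrite big_mkcond /=.
apply: measurable_sum => j; case: (i < j)%N => //=.
apply: measurable_fun_ifT => //.
apply: (measurableT_comp (measurable_powR tau)).
by under eq_fun do rewrite natrM; apply: measurable_funM.
Qed.

HB.instance Definition _ :=
  isMeasurableFun.Build _ _ _ _ (randic tau A) measurable_randic.

End randic_measurable.

Definition standardize (T : Type) (R : realType) (m s : R) (X : T -> R)
  : T -> R := fun w => (X w - m) / s.

Section standardize_measurable.
Context d (T : measurableType d) (R : realType).
Context (m s : R) (X : {mfun T >-> R}).

Let measurable_standardize : measurable_fun setT (standardize m s X).
Proof.
apply: measurable_funM => //; exact: measurable_funB.
Qed.

HB.instance Definition _ :=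
  isMeasurableFun.Build _ _ _ _ (standardize m s X) measurable_standardize.

End standardize_measurable.

(* The distribution functions of the X n, which may live on different
   probability spaces, converge to that of the law [mu] at every continuity
   point of the latter. *)
Definition cvg_in_distribution (d : nat -> measure_display)
    (T : forall n, measurableType (d n)) (R : realType)
    (P : forall n, probability (T n) R) (X : forall n, {RV P n >-> R})
    (mu : probability (measurableTypeR R) R) : Prop :=
  forall x : R, {for x, continuous (fun y : R => mu `]-oo, y]%classic)} ->
    cdf (X n) x @[n --> \oo] --> mu `]-oo, x]%classic.

Arguments cvg_in_distribution {d T R} P X mu.

(* Main.v *)
Require Import Defs.
From mathcomp Require Import all_boot all_order all_algebra.
From mathcomp Require Import all_classical all_reals all_analysis.
From mathcomp Require Import measurable_realfun.
From mathcomp Require Import ring lra zify.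

Set Implicit Arguments.
Unset Strict Implicit.
Unset Printing Implicit Defensive.

Import Order.TTheory GRing.Theory Num.Theory.
Import numFieldNormedType.Exports.

Local Open Scope classical_set_scope.
Local Open Scope ring_scope.

(* The graph is a family of independent Bernoulli bits, one per pair i < j.
   Switching the edge ij on changes the index by a discrete derivative; writing
   x_ij for the deviation of the degree of i (given ij) relative to its mean
   m = 1 + (n - 2) p, a Taylor expansion of the powers of the degrees gives
     m^(2 tau) ((1 + 2 tau) + (tau + tau^2) (x_ij + x_ji))
   for it, up to an error of order m^(2 tau - 1) in L^2.  By the Efron-Stein
   inequality the centred index is then, up to a negligible L^2 error, a
   multiple of the sum of the centred bits if tau <> - 1/2, whereas for
   tau = - 1/2 the leading term vanishes and a multiple of the sum over pairs of
   adjacent edges of the products of their centred bits remains.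

   Both sums have the form Z = b \sum_e (c_e - p_e) K_e, where neither K_e nor
   Z - (c_e - p_e) K_e depends on the bit e.  This makes t |-> E cos (t Z + th)
   an approximate solution of G' = - t G, so that it is close to
   exp (- t^2 / 2) cos th.  Convergence of these expectations passes to
   distribution functions because indicators of rays are approximated, with
   weight 1 + |y|, by trigonometric polynomials. *)

(** * Functions of independent Bernoulli variables *)

Section bernoulli_product.
Context {R : realType} {E : finType}.
Implicit Types (pr : E -> R) (c : {ffun E -> bool}) (f g h : {ffun E -> bool} -> R).

(** The index is not a polynomial in the bits, and degrees may be tiny, where negative powers are
    far from their expansions. Only discrete derivatives are therefore expanded: the degrees whose
    powers matter there are at least 1, and moments of the normalised deviation absorb the bad
    configurations. The comparison forms are chosen because their own derivatives are exactly 1 and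
    m (x_ij + x_ji).

    The error m^(2 tau - 1) is what the degenerate case requires: at tau = - 1/2 the surviving
    derivative has order m^(-3/2) and the error order m^(-2), so the relative error in variance is
    of order 1/(np). Otherwise the derivative has order m^(2 tau), and the deviation terms
    themselves count as error, again of relative size 1/(np).

    Real cosines with a phase th replace complex characteristic functions, since they are closed
    under products up to sums. The weight 1 + |y| is harmless because first absolute moments stay
    bounded; it allows periodic approximants, which can be accurate on a long window only. *)

Definition weight pr c : R := \prod_e (if c e then pr e else 1 - pr e).

Definition Ex pr f : R := \sum_(c : {ffun E -> bool}) weight pr c * f c.

Definition upd c (e : E) (b : bool) : {ffun E -> bool} :=
  [ffun x => if x == e then b else c x].

(** The conditional expectation of [f] given all bits other than [e]. *)
Definition avg pr e f c : R :=
  pr e * f (upd c e true) + (1 - pr e) * f (upd c e false).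

Definition dif e f c : R := f (upd c e true) - f (upd c e false).

Definition ignores (A : Type) (e : E) (f : {ffun E -> bool} -> A) :=
  forall c b, f (upd c e b) = f c.

Definition cen pr e c : R := (c e)%:R - pr e.

Definition vr pr e : R := pr e * (1 - pr e).

Lemma upd_id c e : upd c e (c e) = c.
Proof. by apply/ffunP => x; rewrite ffunE; case: eqP => // ->. Qed.

Lemma upd_upd c e a b : upd (upd c e a) e b = upd c e b.
Proof. by apply/ffunP => x; rewrite !ffunE; case: eqP. Qed.

Lemma updC c e e' a b : e != e' ->
  upd (upd c e a) e' b = upd (upd c e' b) e a.
Proof.
move=> ee'; apply/ffunP => x; rewrite !ffunE.
by case: (eqVneq x e') => // ->; rewrite eq_sym (negbTE ee').
Qed.

Lemma updE c e b : upd c e b e = b. Proof. by rewrite ffunE eqxx. Qed.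

Lemma updN c e e' b : e' != e -> upd c e b e' = c e'.
Proof. by move=> ee'; rewrite ffunE (negbTE ee'). Qed.

Lemma free_avg pr e f : ignores e f -> avg pr e f = f.
Proof. by move=> fe; apply/funext => c; rewrite /avg !fe; ring. Qed.

Lemma avg_free pr e f : ignores e (avg pr e f).
Proof. by move=> c b; rewrite /avg !upd_upd. Qed.

Lemma avg_keep_free pr e e' f : ignores e' f -> ignores e' (avg pr e f).
Proof.
move=> fe' c b; case: (eqVneq e e') => [->|ee']; first exact: avg_free.
by rewrite /avg -!(@updC _ _ _ _ b ee') !fe'.
Qed.

(** The tower property: configurations are summed in pairs that differ at [e] only, each pair being
    represented by its member with a true bit. *)
Lemma Ex_avg pr e f : Ex pr (avg pr e f) = Ex pr f.
Proof.
pose w (c : {ffun E -> bool}) := \prod_(x | x != e) (if c x then pr x else 1 - pr x).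
have Exf g : Ex pr g = \sum_(c : {ffun E -> bool} | c e) w c * avg pr e g c.
  have wE c : weight pr c = (if c e then pr e else 1 - pr e) * w c.
    by rewrite /weight (bigD1 e).
  have wu c b : w (upd c e b) = w c.
    by apply: eq_bigr => x xe; rewrite updN.
  rewrite /Ex (bigID (fun c : {ffun E -> bool} => c e)) /=.
  rewrite [X in _ + X](_ : _ = \sum_(c : {ffun E -> bool} | c e) w c * (1 - pr e) * g (upd c e
    false)).
    rewrite -big_split /=; apply: eq_bigr => c ce.
    have cE : upd c e true = c by rewrite -[in LHS]ce upd_id.
    by rewrite /avg wE ce cE; ring.
  rewrite (reindex_onto (fun c => upd c e false) (fun c => upd c e true)) /=; last first.
    by move=> c /negbTE ce; rewrite upd_upd -ce upd_id.
  apply: eq_big => [c|c _].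
    rewrite updE upd_upd /=; apply/eqP/idP => [<-|ce]; first by rewrite updE.
    by rewrite -ce upd_id.
  by rewrite wE wu updE; ring.
rewrite !Exf; apply: eq_bigr => c _; congr (_ * _).
by rewrite (free_avg _ (@avg_free _ _ _)).
Qed.

Lemma Ex_ext pr f g : f =1 g -> Ex pr f = Ex pr g.
Proof. by move=> fg; apply: eq_bigr => c _; rewrite fg. Qed.

Lemma ExD pr f g : Ex pr (fun c => f c + g c) = Ex pr f + Ex pr g.
Proof. by rewrite /Ex -big_split; apply: eq_bigr => c _; rewrite mulrDr. Qed.

Lemma ExZ pr k f : Ex pr (fun c => k * f c) = k * Ex pr f.
Proof. by rewrite /Ex mulr_sumr; apply: eq_bigr => c _; ring. Qed.

Lemma ExZr pr k f : Ex pr (fun c => f c * k) = Ex pr f * k.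
Proof. by rewrite mulrC -ExZ; apply: Ex_ext => c; rewrite mulrC. Qed.

Lemma ExN pr f : Ex pr (fun c => - f c) = - Ex pr f.
Proof. by rewrite -mulN1r -ExZ; apply: Ex_ext => c; rewrite mulN1r. Qed.

Lemma ExB pr f g : Ex pr (fun c => f c - g c) = Ex pr f - Ex pr g.
Proof. by rewrite ExD ExN. Qed.

Lemma Ex_sum pr (I : Type) (r : seq I) (P : pred I)
    (F : I -> {ffun E -> bool} -> R) :
  Ex pr (fun c => \sum_(i <- r | P i) F i c) = \sum_(i <- r | P i) Ex pr (F i).
Proof.
rewrite /Ex exchange_big; apply: eq_bigr => c _ /=.
by rewrite mulr_sumr.
Qed.

Definition avgs pr (s : seq E) f := foldr (avg pr) f s.

Lemma Ex_avgs pr s f : Ex pr (avgs pr s f) = Ex pr f.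
Proof. by elim: s => //= e s IH; rewrite Ex_avg. Qed.

Lemma avgs_keep_free pr s e f : ignores e f -> ignores e (avgs pr s f).
Proof. by move=> fe; elim: s => //= e' s; apply: avg_keep_free. Qed.

Lemma avgs_free pr s e f : e \in s -> ignores e (avgs pr s f).
Proof.
elim: s => //= e' s IH; rewrite inE => /predU1P[->|/IH]; first exact: avg_free.
exact: avg_keep_free.
Qed.

(** Interpolates between [c] and [c'] by changing one bit at a time. *)
Lemma free_const f c c' : (forall e, ignores e f) -> f c = f c'.
Proof.
move=> fr; suff H (s : seq E) : f [ffun e => if e \in s then c' e else c e] = f c.
  rewrite -(H (enum E)); congr f; apply/ffunP => e.
  by rewrite ffunE mem_enum.
elim: s => [|e s <-]; first by congr f; apply/ffunP => e; rewrite ffunE.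
rewrite -[RHS](fr e _ (c' e)); congr f; apply/ffunP => x; rewrite !ffunE inE.
by case: eqP => // ->.
Qed.

Lemma sum_weight pr : \sum_(c : {ffun E -> bool}) weight pr c = 1.
Proof.
rewrite /weight -(@bigA_distr_bigA _ _ _ _ _ _ _
  (fun (e : E) (b : bool) => if b then pr e else 1 - pr e)).
rewrite big1// => e _; rewrite big_bool /=; ring.
Qed.

Lemma Ex_cst pr k : Ex pr (fun=> k) = k.
Proof. by rewrite /Ex -mulr_suml sum_weight mul1r. Qed.

Lemma avgs_enum pr f c : avgs pr (enum E) f c = Ex pr f.
Proof.
rewrite -(Ex_avgs pr (enum E)) -[LHS](@Ex_cst pr); apply: Ex_ext => c'.
by apply: free_const => e; apply: avgs_free; rewrite mem_enum.
Qed.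

Lemma avgsM pr s f g : (forall e, e \in s -> ignores e g) ->
  avgs pr s (fun c => f c * g c) = (fun c => avgs pr s f c * g c).
Proof.
elim: s => //= e s IH H; rewrite IH; last first.
  by move=> e' e's; apply: H; rewrite inE e's orbT.
by apply/funext => c; rewrite /avg !H ?inE ?eqxx //; ring.
Qed.

(** Averaging over the bits in [S] commutes with multiplication by [g] and turns [f] into the
    constant [Ex pr f]. *)
Lemma Ex_indep pr (S : pred E) f g :
  (forall e, ~~ S e -> ignores e f) -> (forall e, S e -> ignores e g) ->
  Ex pr (fun c => f c * g c) = Ex pr f * Ex pr g.
Proof.
move=> Hf Hg; pose s := enum S.
rewrite -(Ex_avgs pr s) avgsM; last by move=> e; rewrite mem_enum => /Hg.
have K c : avgs pr s f c = Ex pr f.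
  rewrite -(Ex_avgs pr s) -[LHS](@Ex_cst pr); apply: Ex_ext => c'.
  apply: free_const => e; have [eS|eS] := boolP (S e).
    by apply: avgs_free; rewrite mem_enum.
  exact/avgs_keep_free/Hf.
by rewrite -ExZ; apply: Ex_ext => c; rewrite K.
Qed.

Section positive.
Variable pr : E -> R.
Hypothesis pr01 : forall e, 0 <= pr e <= 1.

Lemma weight_ge0 c : 0 <= weight pr c.
Proof.
apply: prodr_ge0 => e _; case: (c e); have /andP[] := pr01 e => //.
by rewrite subr_ge0.
Qed.

Lemma ler_Ex f g : (forall c, f c <= g c) -> Ex pr f <= Ex pr g.
Proof.
by move=> fg; apply: ler_sum => c _; rewrite ler_wpM2l// weight_ge0.
Qed.

Lemma Ex_ge0 f : (forall c, 0 <= f c) -> 0 <= Ex pr f.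
Proof. by move=> f0; rewrite -(Ex_cst pr 0); exact: ler_Ex. Qed.

Lemma normr_Ex f : `|Ex pr f| <= Ex pr (fun c => `|f c|).
Proof.
rewrite (le_trans (ler_norm_sum _ _ _))//; apply: ler_sum => c _.
by rewrite normrM ger0_norm// weight_ge0.
Qed.

Lemma Ex_jensen f : Ex pr f ^+ 2 <= Ex pr (fun c => f c ^+ 2).
Proof.
have : 0 <= Ex pr (fun c => (f c - Ex pr f) ^+ 2).
  by apply: Ex_ge0 => c; exact: sqr_ge0.
rewrite (_ : Ex pr _ = Ex pr (fun c => f c ^+ 2) - Ex pr f ^+ 2) ?subr_ge0//.
rewrite (@Ex_ext _ _ (fun c => f c ^+ 2 - (2 * Ex pr f) * f c + Ex pr f ^+ 2)).
  by rewrite ExD ExB ExZ Ex_cst; ring.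
by move=> c; ring.
Qed.

Lemma vr_ge0 e : 0 <= vr pr e.
Proof.
by have /andP[? ?] := pr01 e; rewrite mulr_ge0// subr_ge0.
Qed.

(** The variance of a function of one bit. It yields both the L^2 contraction and the telescoping
    behind the Efron-Stein inequality. *)
Lemma avg_sqr e f c :
  avg pr e (fun c => f c ^+ 2) c = avg pr e f c ^+ 2 + vr pr e * dif e f c ^+ 2.
Proof. by rewrite /avg /dif /vr; ring. Qed.

Lemma avg_dif e e' f : dif e (avg pr e' f) =1
  if e == e' then fun=> 0 else avg pr e' (dif e f).
Proof.
move=> c; case: eqVneq => [->|ee']; first by rewrite /dif !avg_free subrr.
by rewrite /dif /avg !(updC _ _ _ ee'); ring.
Qed.

(** Derivatives commute with averages over other bits, and averages contract L^2. *)
Lemma Ex_dif_avgs e s f :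
  Ex pr (fun c => dif e (avgs pr s f) c ^+ 2) <= Ex pr (fun c => dif e f c ^+ 2).
Proof.
elim: s => //= e' s IH; apply: le_trans IH.
rewrite (@Ex_ext _ _ _ (fun c => congr1 (fun x => x ^+ 2) (avg_dif _ _ _ c))).
case: eqP => [_|_].
  rewrite expr0n Ex_cst; apply: Ex_ge0 => c; exact: sqr_ge0.
rewrite -[leRHS](Ex_avg pr e'); apply: ler_Ex => c.
by rewrite avg_sqr lerDl mulr_ge0 ?vr_ge0 ?sqr_ge0.
Qed.

(** The bits are integrated out one at a time. By [avg_sqr] each step lowers the second moment by
    the variance of the bit times the squared derivative of a partial average, which [Ex_dif_avgs]
    compares with that of [f]. *)
Lemma efron_stein f : Ex pr (fun c => (f c - Ex pr f) ^+ 2) <=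
  \sum_e vr pr e * Ex pr (fun c => dif e f c ^+ 2).
Proof.
have -> : Ex pr (fun c => (f c - Ex pr f) ^+ 2) =
    Ex pr (fun c => f c ^+ 2) - Ex pr (fun c => avgs pr (enum E) f c ^+ 2).
  rewrite [X in _ - X](_ : _ = Ex pr f ^+ 2).
    rewrite (@Ex_ext _ _ (fun c => f c ^+ 2 - (2 * Ex pr f) * f c + Ex pr f ^+ 2)).
      by rewrite ExD ExB ExZ Ex_cst; ring.
    by move=> c; ring.
  by rewrite -[RHS](Ex_cst pr); apply: Ex_ext => c; rewrite avgs_enum.
rewrite -[leRHS]big_enum /=; elim: (enum E) => /= [|e s IH].
  by rewrite big_nil subrr.
rewrite big_cons.
have -> : Ex pr (fun c => avg pr e (avgs pr s f) c ^+ 2) =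
    Ex pr (fun c => avgs pr s f c ^+ 2) -
    vr pr e * Ex pr (fun c => dif e (avgs pr s f) c ^+ 2).
  rewrite -[Ex pr (fun c => avgs pr s f c ^+ 2)](Ex_avg pr e) -ExZ -ExB.
  by apply: Ex_ext => c; rewrite avg_sqr; ring.
rewrite opprB addrCA lerD// ler_wpM2l ?vr_ge0//; exact: Ex_dif_avgs.
Qed.

End positive.

Lemma cenM pr e f : ignores e f -> Ex pr (fun c => cen pr e c * f c) = 0.
Proof.
move=> fe; rewrite -(Ex_avg pr e) (@Ex_ext _ _ (fun=> 0)) ?Ex_cst// => c.
by rewrite /avg !fe /cen !updE /=; ring.
Qed.

Lemma cenM2 pr e f : ignores e f ->
  Ex pr (fun c => cen pr e c ^+ 2 * f c) = vr pr e * Ex pr f.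
Proof.
move=> fe; rewrite -(Ex_avg pr e) -ExZ; apply: Ex_ext => c.
by rewrite /avg !fe /cen /vr !updE /=; ring.
Qed.

Lemma cen_ignores pr e e' : e != e' -> ignores e (cen pr e').
Proof. by move=> ee' c b; rewrite /cen updN// eq_sym. Qed.

End bernoulli_product.

(** * Taylor expansion of real powers *)

Section powR_taylor.
Context {R : realType}.
Implicit Types s t m u y : R.

Lemma MVT_gt0 (f df : R -> R) (a b : R) :
  (forall x : R, 0 < x -> is_derive x 1 f (df x)) -> 0 < a -> 0 < b ->
  exists z, [/\ (a <= z <= b) || (b <= z <= a), 0 < z
    & f b - f a = df z * (b - a)].
Proof.
move=> fd; wlog ab : a b / a <= b.
  move=> H a0 b0; have [ab|ba] := leP a b; first exact: H.
  have [z [z1 z2 z3]] := H _ _ (ltW ba) b0 a0.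
  exists z; split; [by rewrite orbC|by []|].
  by rewrite -[LHS]opprB z3; ring.
move=> a0 b0; move: ab; rewrite le_eqVlt => /predU1P[<-|ab].
  by exists a; split => //; [rewrite lexx|rewrite !subrr mulr0].
have fd' (x : R) : x \in `]a, b[ -> is_derive x 1 f (df x).
  by rewrite in_itv /= => /andP[ax _]; apply: fd; exact: lt_trans ax.
have [|z] := MVT ab fd'.
  apply: derivable_within_continuous => x; rewrite in_itv /= => /andP[ax _].
  have dx := fd x (lt_le_trans a0 ax); exact: ex_derive.
rewrite in_itv /= => /andP[az zb] zE; exists z; split => //.
  by rewrite (ltW az) (ltW zb).
exact: lt_trans az.
Qed.

Lemma powR_between s a b z : 0 < a -> 0 < b ->
  (a <= z <= b) || (b <= z <= a) -> z `^ s <= a `^ s + b `^ s.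
Proof.
move=> a0 b0; wlog : a b a0 b0 / a <= b.
  move=> H ab; have [le_ab|/ltW le_ba] := leP a b; first exact: H.
  by rewrite addrC; apply: H; rewrite // orbC.
move=> ab H.
have /andP[az zb] : a <= z <= b by case/orP: H => // /andP[bz za]; lra.
have z0 : 0 < z by exact: lt_le_trans az.
have [s0|/ltW s0] := leP 0 s.
  rewrite ler_wpDl ?powR_ge0//; apply: ge0_ler_powR => //;
    by rewrite nnegrE ltW.
rewrite ler_wpDr ?powR_ge0// -[s]opprK !(powRN _ (- s)) lef_pV2 ?posrE ?powR_gt0//.
by apply: ge0_ler_powR => //; rewrite ?nnegrE ?oppr_ge0 // ltW.
Qed.

(** A bound on the whole half-line: the factor 1 + y^t makes up for the growth of the power near 0
    or at infinity. *)
Lemma powR_taylor2 t : exists2 C : R, 0 <= C & forall y, 0 < y ->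
  `|y `^ t - 1 - t * (y - 1)| <= C * (y - 1) ^+ 2 * (1 + y `^ t).
Proof.
(* The first summand serves y >= 1/2; the second serves y < 1/2, where (y - 1)^2 >= 1/4 makes the
   triangle inequality enough. *)
exists (4 * `|t * (t - 1)| + 4 * (1 + `|t|)) => [|y y0].
  by have := normr_ge0 (t * (t - 1)); have := normr_ge0 t; lra.
have yt0 := powR_ge0 y t.
have [y2|y2] := ltP y 2^-1.
  apply: (@le_trans _ _ ((1 + `|t|) * (1 + y `^ t))); last first.
    apply: ler_wpM2r; first by rewrite addr_ge0.
    have : 2^-1 ^+ 2 <= (y - 1) ^+ 2.
      by rewrite -(sqrrN (y - 1)); apply: lerXn2r; rewrite ?nnegrE; lra.
    have := normr_ge0 (t * (t - 1)); have := normr_ge0 t.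
    set p := `|t|; set q := `|_|; set z := (y - 1) ^+ 2 => p0 q0 z1.
    have : 0 <= q * z by rewrite mulr_ge0//; lra.
    nra.
  rewrite (le_trans (ler_normB _ _))// (le_trans (lerD (ler_normB _ _) (lexx _)))//.
  rewrite normr1 (ger0_norm yt0) normrM.
  have : `|y - 1| <= 1 by rewrite ler_norml; apply/andP; split; lra.
  have := normr_ge0 t; nra.
have fd (x : R) : 0 < x -> is_derive x 1 (fun x => x `^ t - t * x) (t * x `^ (t - 1) - t).
  move=> x0; have := is_derive1_powR t x0 => H.
  have := is_deriveB H (is_deriveZ t (is_derive_id x (1 : R))).
  by rewrite [t *: _]mulr1.
have [z [zy z0 zE]] := MVT_gt0 fd ltr01 y0.
have gd (x : R) : 0 < x -> is_derive x 1 (fun x => x `^ (t - 1)) ((t - 1) * x `^ (t - 1 - 1)).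
  exact: is_derive1_powR.
have [w [wz w0 wE]] := MVT_gt0 gd ltr01 z0.
have -> : y `^ t - 1 - t * (y - 1) = t * (t - 1) * w `^ (t - 1 - 1) * (z - 1) * (y - 1).
  transitivity ((t * z `^ (t - 1) - t) * (y - 1)).
    by rewrite -zE powR1; ring.
  by move: wE; rewrite powR1 => wE; rewrite -(subrK 1 (z `^ (t - 1))) wE; ring.
have wb : (1 <= w <= y) || (y <= w <= 1).
  clear -zy wz; case/orP: zy wz => /andP[? ?] /orP[] /andP[? ?]; apply/orP;
  by [left; apply/andP; split; lra | right; apply/andP; split; lra
     | have ? : w = 1 by lra; have [?|?] := leP 1 y; [left|right]; apply/andP; split; lra].
have w2 : 2^-1 <= w by case/orP: wb => /andP[]; lra.
(* The second derivative is taken at [w] >= 1/2, so w^(t - 2) is at most 4 w^t. *)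
have wt : w `^ (t - 1 - 1) <= 4 * (1 + y `^ t).
  have -> : w `^ (t - 1 - 1) = w `^ t * (w ^+ 2)^-1.
    rewrite -(powR_mulrn 2 (ltW w0)) -powRN -powRD; last by rewrite (gt_eqF w0) implybT.
    by congr (_ `^ _); ring.
  rewrite mulrC; apply: ler_pM.
  - by rewrite invr_ge0 sqr_ge0.
  - exact: powR_ge0.
  - rewrite -[leLHS]mul1r ler_pdivrMr ?exprn_gt0//.
    by move: w2; clear; nra.
  - by have := powR_between t ltr01 y0 wb; rewrite powR1.
have zy1 : `|z - 1| <= `|y - 1|.
  case/orP: zy => /andP[? ?].
    by rewrite !ger0_norm; lra.
  by rewrite !ler0_norm; lra.
rewrite !normrM (ger0_norm (powR_ge0 w _)).
apply: (@le_trans _ _ (`|t| * `|t - 1| * (4 * (1 + y `^ t)) * (y - 1) ^+ 2)).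
  rewrite -(real_normK (num_real (y - 1))) expr2 -mulrA.
  apply: ler_pM.
  - by rewrite !mulr_ge0 ?powR_ge0.
  - by rewrite mulr_ge0.
  - by rewrite ler_wpM2l// mulr_ge0.
  - by rewrite ler_wpM2r.
rewrite -normrM; have := sqr_ge0 (y - 1); set a := _ ^+ 2 => a0.
have : 0 <= (4 * (1 + `|t|)) * a * (1 + y `^ t).
  by rewrite mulr_ge0 ?addr_ge0// mulr_ge0// mulr_ge0// addr_ge0.
clear; nra.
Qed.

(* Bounds the errors of Taylor expansions at m: both u / m and m / u are at most
   4 * hgt m u, and all moments of hgt m u are bounded when u is a degree of mean m. *)
Definition hgt m u : R := 1 + (u - m) ^+ 2 / m.

Lemma hgt_ge1 m u : 0 < m -> 1 <= hgt m u.
Proof. by move=> m0; rewrite lerDl divr_ge0 ?sqr_ge0 ?ltW. Qed.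

Lemma hgt_ge0 m u : 0 < m -> 0 <= hgt m u.
Proof. by move=> m0; rewrite (le_trans ler01) ?hgt_ge1. Qed.

Lemma hgtX m u (j k : nat) : 0 < m -> (j <= k)%N -> hgt m u ^+ j <= hgt m u ^+ k.
Proof. by move=> m0 jk; apply: ler_weXn2l => //; exact: hgt_ge1. Qed.

Lemma ratio_le_hgt m u : 1 <= m -> 1 <= u -> u / m <= 4 * hgt m u.
Proof.
move=> m1 u1; have m0 : 0 < m by lra.
rewrite /hgt ler_pdivrMr //.
have -> : 4 * (1 + (u - m) ^+ 2 / m) * m = 4 * (m + (u - m) ^+ 2).
  by field; rewrite gt_eqF.
have := sqr_ge0 (2 * (u - m) - 4^-1); nra.
Qed.

Lemma ratio_le_hgtV m u : 1 <= m -> 1 <= u -> m / u <= 4 * hgt m u.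
Proof.
move=> m1 u1; have m0 : 0 < m by lra.
have u0 : 0 < u by lra.
rewrite /hgt ler_pdivrMr //.
have [mu|mu] := leP m (2 * u).
  have : 0 <= (u - m) ^+ 2 / m by rewrite divr_ge0 ?sqr_ge0 ?ltW.
  by nra.
apply: (@le_trans _ _ (4 * (1 + (u - m) ^+ 2 / m))).
  have -> : 4 * (1 + (u - m) ^+ 2 / m) = 4 * (m + (u - m) ^+ 2) / m.
    by field; rewrite gt_eqF.
  by rewrite ler_pdivlMr //; nra.
by rewrite ler_peMr// mulr_ge0// addr_ge0// divr_ge0 ?sqr_ge0 ?ltW.
Qed.

(** Rounding |s| up to an integer reduces real powers of either sign to integer moments of [hgt]. *)
Lemma powR_ratio_le s : exists k : nat, forall m u, 1 <= m -> 1 <= u ->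
  (u / m) `^ s <= (4 * hgt m u) ^+ k.
Proof.
have [k hk] : exists k : nat, `|s| <= k%:R.
  by exists (Num.truncn `|s|).+1; exact/ltW/truncnS_gt.
exists k => m u m1 u1; have m0 : 0 < m by lra.
have u0 : 0 < u by lra.
have h1 := hgt_ge1 u m0; have h0 : 0 <= 4 * hgt m u by lra.
suff H y : 0 < y -> y <= 4 * hgt m u -> y `^ `|s| <= (4 * hgt m u) ^+ k.
  have [s0|s0] := leP 0 s.
    by rewrite -{1}(ger0_norm s0); apply: H; [rewrite divr_gt0|exact: ratio_le_hgt].
  have -> : (u / m) `^ s = (m / u) `^ `|s|.
    rewrite ltr0_norm// -[u / m]invf_div -(powR_inv1 (a := m / u)) ?divr_ge0 ?ltW//.
    by rewrite -powRrM mulN1r.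
  by apply: H; [rewrite divr_gt0|exact: ratio_le_hgtV].
move=> y0 yh; rewrite (@le_trans _ _ ((4 * hgt m u) `^ `|s|))//.
  by apply: ge0_ler_powR => //; rewrite ?nnegrE // ltW.
by rewrite -powR_mulrn//; apply: ler_powR => //; lra.
Qed.

Lemma powR_div s m u : 0 < m -> 0 < u -> u `^ s = m `^ s * (u / m) `^ s.
Proof.
move=> m0 u0; rewrite -powRM ?(ltW m0) ?divr_ge0 ?ltW//.
by congr (_ `^ _); field; rewrite gt_eqF.
Qed.

Lemma powR_le_hgt s : exists C : R, exists2 k : nat, 0 <= C &
  forall m u, 1 <= m -> 1 <= u -> u `^ s <= C * m `^ s * hgt m u ^+ k.
Proof.
have [k hk] := powR_ratio_le s; exists (4 ^+ k), k => [|m u m1 u1].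
  exact: exprn_ge0.
rewrite (@powR_div s m u); [|lra|lra].
rewrite mulrAC -exprMn mulrC ler_wpM2r ?powR_ge0//; exact: hk.
Qed.

Lemma powRB1_div s m : 0 < m -> m `^ (s - 1) = m `^ s / m.
Proof.
by move=> m0; rewrite powRB ?(gt_eqF m0) ?implybT// powRr1// ltW.
Qed.

Lemma powR_taylor_hgt t : exists C : R, exists2 k : nat, 0 <= C &
  forall m u, 1 <= m -> 1 <= u ->
  `|u `^ t - m `^ t * (1 + t * ((u - m) / m))| <= C * m `^ (t - 1) * hgt m u ^+ k.
Proof.
have [C C0 HC] := powR_taylor2 t; have [k hk] := powR_ratio_le t.
exists (C * 4 ^+ k * 2), k.+1 => [|m u m1 u1].
  by rewrite !mulr_ge0// exprn_ge0.
have m0 : 0 < m by lra.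
have u0 : 0 < u by lra.
rewrite (powR_div t m0 u0) (powRB1_div t m0).
have -> : m `^ t * (u / m) `^ t - m `^ t * (1 + t * ((u - m) / m)) =
    m `^ t * ((u / m) `^ t - 1 - t * (u / m - 1)) by field; rewrite gt_eqF.
rewrite normrM ger0_norm ?powR_ge0//.
have -> : C * 4 ^+ k * 2 * (m `^ t / m) * hgt m u ^+ k.+1 =
    m `^ t * (C * (hgt m u / m) * (2 * (4 * hgt m u) ^+ k)).
  by rewrite exprMn exprS; field; rewrite gt_eqF.
rewrite ler_wpM2l ?powR_ge0// (le_trans (HC _ (divr_gt0 u0 m0)))//.
have h1 := hgt_ge1 u m0.
apply: ler_pM.
- by rewrite mulr_ge0 ?sqr_ge0.
- by rewrite addr_ge0 ?powR_ge0.
- rewrite ler_wpM2l// ler_pdivlMr// /hgt.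
  have -> : (u / m - 1) ^+ 2 * m = (u - m) ^+ 2 / m by field; rewrite gt_eqF.
  by rewrite lerDr.
- have := hk _ _ m1 u1; suff : 1 <= (4 * hgt m u) ^+ k by lra.
  by rewrite exprn_ege1//; lra.
Qed.

(** The factor d is the number of neighbours whose terms change when a vertex of degree d gains an
    edge; it turns the difference of powers, of order t - 1, back into order t. *)
Lemma powR_difference t : exists2 C : R, 0 <= C & forall d : nat,
  `|d%:R * (d.+1%:R `^ t - d%:R `^ t) - t * d.+1%:R `^ t| <= C * d.+1%:R `^ (t - 1).
Proof.
have [C C0 HC] := powR_taylor2 t.
(* For d >= 1 the ratio d / (d + 1) lies in [1/2, 1], which bounds the factor 1 + y^t of
   [powR_taylor2]. *)
exists (`|t| + C * (2 + 2^-1 `^ t)) => [|d].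
  by rewrite addr_ge0// mulr_ge0// addr_ge0// powR_ge0.
set u : R := d.+1%:R; have u0 : 0 < u by rewrite ltr0n.
have uE : d%:R = u - 1 by rewrite /u -natr1 addrK.
rewrite (powRB1_div t u0).
(* At d = 0 the factor d removes the conventional value of the power of 0. *)
case: d => [|d] in u u0 uE *.
  rewrite mul0r add0r normrN normrM (ger0_norm (powR_ge0 _ _)).
  by rewrite /u divr1 powR1 !mulr1 lerDl mulr_ge0// addr_ge0// powR_ge0.
have u2 : 2 <= u by rewrite ler_nat.
set y : R := d.+1%:R / u; have y0 : 0 < y by rewrite divr_gt0// ltr0n.
have y1 : y <= 1 by rewrite ler_pdivrMr// mul1r uE; lra.
have y2 : 2^-1 <= y by rewrite ler_pdivlMr// uE; lra.
have -> : d.+1%:R `^ t = u `^ t * y `^ t by rewrite -powR_div// ltr0n.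
have yE : y - 1 = - u^-1 by rewrite /y uE; field; rewrite gt_eqF.
have := HC y y0; rewrite yE; set w := y `^ t => Hw.
have wb : w <= 1 + 2^-1 `^ t.
  have := @powR_between t 2^-1 1 y; rewrite powR1 y2 y1 addrC; apply=> //; lra.
rewrite uE (_ : _ - _ = u `^ t / u * (- t - u * (u - 1) * (w - 1 - t * - u^-1))); last first.
  by field; rewrite gt_eqF.
have ut0 : 0 <= u `^ t / u by rewrite divr_ge0 ?powR_ge0 ?ltW.
rewrite normrM (ger0_norm ut0) mulrC ler_wpM2r//.
rewrite (le_trans (ler_normB _ _))// normrN lerD2l normrM.
rewrite (ger0_norm (_ : 0 <= u * (u - 1))); last by rewrite mulr_ge0; lra.
apply: (@le_trans _ _ (u * (u - 1) * (C * (- u^-1) ^+ 2 * (1 + w)))).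
  by rewrite ler_wpM2l// mulr_ge0; lra.
have -> : u * (u - 1) * (C * (- u^-1) ^+ 2 * (1 + w)) = C * ((u - 1) / u * (1 + w)).
  by field; rewrite gt_eqF.
rewrite ler_wpM2l//.
have w0 : 0 <= w by exact: powR_ge0.
have q1 : (u - 1) / u <= 1 by rewrite ler_pdivrMr//; lra.
have q0 : 0 <= (u - 1) / u by rewrite divr_ge0; lra.
rewrite (@le_trans _ _ (1 * (1 + w)))//; last by lra.
by rewrite ler_wpM2r// addr_ge0.
Qed.

(** [powR_difference] followed by the expansion of t (d + 1)^t at m; hence the coefficient t^2 of
    the deviation. *)
Lemma powR_difference_hgt t : exists C : R, exists2 k : nat, 0 <= C &
  forall m (d : nat), 1 <= m ->
  `|d%:R * (d.+1%:R `^ t - d%:R `^ t) - m `^ t * (t + t ^+ 2 * ((d.+1%:R - m) / m))|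
    <= C * m `^ (t - 1) * hgt m d.+1%:R ^+ k.
Proof.
have [C1 C10 H1] := powR_difference t.
have [C2 [k2 C20 H2]] := powR_le_hgt (t - 1).
have [C3 [k3 C30 H3]] := powR_taylor_hgt t.
exists (C1 * C2 + `|t| * C3), (maxn k2 k3) => [|m d m1].
  by rewrite addr_ge0// mulr_ge0.
have m0 : 0 < m by lra.
set u : R := d.+1%:R; have u1 : 1 <= u by rewrite ler1n.
rewrite (_ : _ - _ = (d%:R * (u `^ t - d%:R `^ t) - t * u `^ t) +
  t * (u `^ t - m `^ t * (1 + t * ((u - m) / m)))); last by field; rewrite gt_eqF.
apply: (le_trans (ler_normD _ _)); rewrite -[leRHS]mulrA [leRHS]mulrDl; apply: lerD.
  rewrite (le_trans (H1 d))// -mulrA ler_wpM2l// (le_trans (H2 _ _ m1 u1))//.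
  by rewrite mulrA ler_wpM2l ?mulr_ge0 ?powR_ge0 ?hgtX// leq_maxl.
rewrite normrM -mulrA ler_wpM2l// (le_trans (H3 _ _ m1 u1))//.
by rewrite mulrA ler_wpM2l ?mulr_ge0 ?powR_ge0 ?hgtX// leq_maxr.
Qed.

End powR_taylor.

(** * Moments of normalised sums of centred bits, uniformly in their mean *)

Section moments.
Context {R : realType}.
Implicit Types x y z m : R.

Lemma expR_le_quadratic x : `|x| <= 2^-1 -> expR x <= 1 + x + 2 * x ^+ 2.
Proof.
rewrite ler_norml => /andP[x1 x2].
have := expR_ge1Dx (- x); rewrite expRN => H.
have x0 : 0 < 1 - x by lra.
have : expR x <= (1 - x)^-1 by rewrite -[expR x]invrK lef_pV2 ?posrE ?invr_gt0 ?expR_gt0.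
move=> /le_trans; apply; rewrite -[leLHS]mul1r ler_pdivrMr//.
have : 0 <= x ^+ 2 * (1 - 2 * x) by rewrite mulr_ge0 ?sqr_ge0//; lra.
by lra.
Qed.

(** The constant that [hgt_le_expR] gives once both exponential moments are at most [expR 2^-1]; it
    is independent of m. *)
Definition hgt_moment (k : nat) : R := 2 * expR 1 * (2 * (2 * k + 1)%:R) ^+ (2 * k + 1).

Lemma hgt_moment_ge0 k : 0 <= hgt_moment k.
Proof. by rewrite mulr_ge0 ?exprn_ge0 ?mulr_ge0 ?expR_ge0. Qed.

(** With j = 2k + 1, the inequality 1 + x <= exp x at x = (1 + |z|) / (2j), raised to the power j.
    The odd exponent keeps the divisor nonzero at k = 0. *)
Lemma hgt_le_expR (k : nat) z : (1 + z ^+ 2) ^+ k <=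
  (2 * (2 * k + 1)%:R) ^+ (2 * k + 1) * expR 2^-1 * (expR (z / 2) + expR (- (z / 2))).
Proof.
set j := (2 * k + 1)%N.
have z0 := normr_ge0 z.
apply: (@le_trans _ _ ((1 + `|z|) ^+ j)).
  apply: (@le_trans _ _ ((1 + `|z|) ^+ (2 * k))).
    rewrite exprM; apply: lerXn2r; rewrite ?nnegrE ?exprn_ge0 ?addr_ge0 ?sqr_ge0//.
    by rewrite -(real_normK (num_real z)); nra.
  by apply: ler_weXn2l; [lra|rewrite leq_addr].
have j0 : 0 < (2 * j%:R : R) by rewrite mulr_gt0// ltr0n /j addn1.
have -> : 1 + `|z| = 2 * j%:R * ((1 + `|z|) / (2 * j%:R)) by field; rewrite pnatr_eq0 /j addn1.
rewrite exprMn -mulrA ler_wpM2l ?exprn_ge0 ?(ltW j0)//.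
apply: (@le_trans _ _ (expR ((1 + `|z|) / (2 * j%:R)) ^+ j)).
  have z1 : 0 <= (1 + `|z|) / (2 * j%:R) by rewrite divr_ge0 ?(ltW j0)//; lra.
  apply: lerXn2r; rewrite ?nnegrE ?expR_ge0//.
  by have := expR_ge1Dx ((1 + `|z|) / (2 * j%:R)); lra.
rewrite -expRM_natl.
have -> : j%:R * ((1 + `|z|) / (2 * j%:R)) = 2^-1 + `|z| / 2.
  by field; rewrite pnatr_eq0 /j addn1.
rewrite expRD ler_wpM2l ?expR_ge0//.
have e0 := expR_ge0 (z / 2); have e1 := expR_ge0 (- (z / 2)).
by case: (ger0P z) => _; rewrite ?mulNr; lra.
Qed.

Context {E : finType} (pr : E -> R).
Hypothesis pr01 : forall e, 0 <= pr e <= 1.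

(** Independence splits the exponential moment bit by bit. In the quadratic bound for each factor
    the linear terms cancel because the bit is centred, leaving twice its variance times x^2. *)
Lemma Ex_expR_sum_cen (x : R) (s : seq E) : `|x| <= 2^-1 -> uniq s ->
  Ex pr (fun c => expR (x * \sum_(e <- s) cen pr e c)) <=
  expR (2 * x ^+ 2 * \sum_(e <- s) vr pr e).
Proof.
move=> x2; elim: s => [_|e s IH /= /andP[es us]].
  by rewrite (@Ex_ext _ _ _ _ (fun=> 1)) ?Ex_cst ?big_nil ?mulr0 ?expR0// => c;
     rewrite big_nil mulr0 expR0.
rewrite big_cons mulrDr expRD.
pose h c := expR (x * \sum_(e' <- s) cen pr e' c).
have hfree : ignores e h.
  move=> c b; rewrite /h; congr (expR (x * _)); apply: eq_big_seq => e' e's.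
  by rewrite cen_ignores//; apply: contraNneq es => ->.
rewrite -(Ex_avg pr e).
rewrite (@Ex_ext _ _ _ _ (fun c => (pr e * expR (x * (1 - pr e)) +
   (1 - pr e) * expR (x * (0 - pr e))) * h c)); last first.
  move=> c; rewrite /avg !big_cons !mulrDr !expRD -!/(h _) !hfree /cen !updE /=.
  by ring.
rewrite ExZ; apply: ler_pM => //; last exact: IH.
  have /andP[p0 p1] := pr01 e.
  by rewrite addr_ge0// mulr_ge0 ?expR_ge0//; lra.
  by apply: Ex_ge0 => // c; exact: expR_ge0.
have /andP[p0 p1] := pr01 e.
have b1 : `|x * (1 - pr e)| <= 2^-1.
  by rewrite normrM -[leRHS]mulr1 ler_pM// ger0_norm; lra.
have b2 : `|x * (0 - pr e)| <= 2^-1.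
  by rewrite normrM -[leRHS]mulr1 ler_pM// sub0r normrN ger0_norm; lra.
apply: (@le_trans _ _ (1 + 2 * x ^+ 2 * vr pr e)); last exact: expR_ge1Dx.
have := ler_wpM2l p0 (expR_le_quadratic b1).
have q0 : 0 <= 1 - pr e by lra.
have := ler_wpM2l q0 (expR_le_quadratic b2).
rewrite /vr; lra.
Qed.

Lemma Ex_hgt (k : nat) (s : seq E) m : 1 <= m -> uniq s ->
  \sum_(e <- s) vr pr e <= m ->
  Ex pr (fun c => hgt m (m + \sum_(e <- s) cen pr e c) ^+ k) <= hgt_moment k.
Proof.
move=> m1 us sm; have m0 : 0 < m by lra.
have r0 : 0 < Num.sqrt m by rewrite sqrtr_gt0.
have r2 : Num.sqrt m ^+ 2 = m by rewrite sqr_sqrtr// ltW.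
have r1 : 1 <= Num.sqrt m by rewrite -sqrtr1 ler_wsqrtr.
set C := (2 * (2 * k + 1)%:R) ^+ (2 * k + 1) : R.
have C0 : 0 <= C by rewrite exprn_ge0// mulr_ge0.
(* The scale at which the exponent 2 x^2 times the variance is at most 1/2, the variance being at
   most m; m >= 1 ensures |x| <= 1/2. *)
pose x := (2 * Num.sqrt m)^-1.
apply: (@le_trans _ _ (Ex pr (fun c => C * expR 2^-1 *
   (expR (x * \sum_(e <- s) cen pr e c) + expR (- x * \sum_(e <- s) cen pr e c))))).
  apply: ler_Ex => // c.
  have -> : hgt m (m + \sum_(e <- s) cen pr e c) =
      1 + ((\sum_(e <- s) cen pr e c) / Num.sqrt m) ^+ 2.
    by rewrite /hgt expr_div_n r2; congr (1 + _ ^+ 2 / _); ring.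
  apply: (le_trans (hgt_le_expR _ _)); rewrite le_eqVlt; apply/orP; left; apply/eqP.
  have -> : (\sum_(e <- s) cen pr e c) / Num.sqrt m / 2 = x * \sum_(e <- s) cen pr e c.
    by rewrite /x; field; rewrite gt_eqF.
  by rewrite mulNr.
rewrite ExZ ExD.
have x2 : `|x| <= 2^-1.
  rewrite ger0_norm ?invr_ge0 ?mulr_ge0 ?(ltW r0)//.
  by rewrite lef_pV2 ?posrE// ?mulr_gt0//; lra.
have B : 2 * x ^+ 2 * (\sum_(e <- s) vr pr e) <= 2^-1.
  rewrite /x exprVn exprMn r2; set S := \sum_(e <- s) _ in sm *.
  rewrite (_ : _ * S = S / m / 2); last by field; rewrite gt_eqF.
  rewrite ler_pdivrMr// (_ : 2^-1 * 2 = 1); last by field.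
  by rewrite ler_pdivrMr// mul1r.
have e1 := Ex_expR_sum_cen x2 us.
have e2 : Ex pr (fun c => expR (- x * \sum_(e <- s) cen pr e c)) <= expR 2^-1.
  have nx2 : `|- x| <= 2^-1 by rewrite normrN.
  by apply: (le_trans (Ex_expR_sum_cen nx2 us)); rewrite sqrrN ler_expR.
have {}e1 : Ex pr (fun c => expR (x * \sum_(e <- s) cen pr e c)) <= expR 2^-1.
  by apply: (le_trans e1); rewrite ler_expR.
have EE : expR 2^-1 * expR 2^-1 = expR 1 :> R.
  by rewrite -expRD; congr expR; field.
rewrite /hgt_moment -EE -/C.
have h0 := expR_ge0 (2^-1 : R).
rewrite (_ : 2 * _ * C = C * expR 2^-1 * (expR 2^-1 + expR 2^-1)); last by ring.
by rewrite ler_wpM2l ?mulr_ge0// lerD.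
Qed.

End moments.

(** Meant for the change of the edge terms upon switching ij, which is supported on pairs that meet
    {i, j}. *)
Lemma sum_sym_local {R : realType} n (D : 'I_n -> 'I_n -> R) (i j : 'I_n) :
  i != j -> (forall k l, D k l = D l k) -> (forall k, D k k = 0) ->
  (forall k l, k != i -> k != j -> l != i -> l != j -> D k l = 0) ->
  \sum_k \sum_l D k l = 2 * (D i j + \sum_(l | (l != i) && (l != j)) D i l
    + \sum_(l | (l != i) && (l != j)) D j l).
Proof.
move=> ij Dsym Ddiag Dloc.
have ji : j != i by rewrite eq_sym.
have split2 (f : 'I_n -> R) :
    \sum_l f l = f i + f j + \sum_(l | (l != i) && (l != j)) f l.
  by rewrite (bigD1 i)//= (bigD1 j)//= addrA.
rewrite split2 (split2 (D i)) (split2 (D j)) !Ddiag (Dsym j i).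
rewrite (_ : \sum_(k | _) \sum_l D k l =
    \sum_(l | (l != i) && (l != j)) D i l + \sum_(l | (l != i) && (l != j)) D j l).
  by ring.
rewrite -big_split; apply: eq_bigr => k /andP[ki kj].
rewrite split2 big1 ?addr0; first by rewrite (Dsym k i) (Dsym k j).
by move=> l /andP[li lj]; exact: Dloc.
Qed.

(** * The discrete derivative of the index *)

Section graph.
Context {R : realType} (n : nat).
Local Notation V := 'I_n.
Local Notation config := {ffun V * V -> bool}.
Implicit Types (c : config) (i j k l : V) (p tau : R).

Definition edge i j : V * V := if (i < j)%N then (i, j) else (j, i).

(* The bits on and below the diagonal are almost surely 0. *)
Definition upper_prob p (e : V * V) : R := if (e.1 < e.2)%N then p else 0.

Definition adj c i j : bool := (i != j) && c (edge i j).

(* The degree of i not counting the edge ij. *)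
Definition rdeg c i j : nat := \sum_(k | (k != i) && (k != j)) adj c i k.

Lemma edgeC i j : edge i j = edge j i.
Proof.
by rewrite /edge; case: ltngtP => // /ord_inj ->.
Qed.

Lemma edge_upper i j : i != j -> ((edge i j).1 < (edge i j).2)%N.
Proof.
by move=> ij; rewrite /edge; case: (ltngtP i j) => //= /ord_inj ji; rewrite ji eqxx in ij.
Qed.

Lemma upper_edge (e : V * V) : (e.1 < e.2)%N -> e = edge e.1 e.2.
Proof. by case: e => i j /= ij; rewrite /edge ij. Qed.

Lemma upper_prob_edge p i j : i != j -> upper_prob p (edge i j) = p.
Proof. by move=> ij; rewrite /upper_prob edge_upper. Qed.

Lemma edge_eq i j k l :
  (edge k l == edge i j) = ((k == i) && (l == j)) || ((k == j) && (l == i)).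
Proof.
rewrite /edge; case: ltnP => kl; case: ltnP => ij; rewrite xpair_eqE.
- case: (boolP ((k == j) && (l == i))) => [/andP[/eqP ? /eqP ?]|]; last by rewrite orbF.
  by subst; move: (ltn_trans kl ij); rewrite ltnn.
- rewrite orbC; case: (boolP ((k == i) && (l == j))) => [/andP[/eqP ? /eqP ?]|]; last by rewrite
  orbF.
  by subst; move: (leq_trans kl ij); rewrite ltnn.
- rewrite andbC orbC [l == i]eq_sym [k == j]eq_sym.
  rewrite [i == l]eq_sym [j == k]eq_sym.
  case: (boolP ((k == i) && (l == j))) => [/andP[/eqP ? /eqP ?]|]; last by rewrite orbF andbC.
  by subst; move: (leq_trans ij kl); rewrite ltnn.
- rewrite andbC; case: (boolP ((k == j) && (l == i))) => [/andP[/eqP ? /eqP ?]|]; last by rewrite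
  orbF.
  subst; have /ord_inj -> : i = j :> nat by apply/eqP; rewrite eqn_leq ij kl.
  by rewrite !eqxx.
Qed.

Lemma adjC c i j : adj c i j = adj c j i.
Proof. by rewrite /adj eq_sym edgeC. Qed.

Lemma adjxx c i : adj c i i = false. Proof. by rewrite /adj eqxx. Qed.

Lemma adj_upd c i j b k l : i != j -> adj (upd c (edge i j) b) k l =
  if ((k == i) && (l == j)) || ((k == j) && (l == i)) then b else adj c k l.
Proof.
move=> ij; rewrite /adj ffunE edge_eq.
case: ifP => // /orP[] /andP[/eqP -> /eqP ->]; first by rewrite ij.
by rewrite eq_sym ij.
Qed.

Lemma adj_ignores i j e : e != edge i j -> ignores e (fun c => adj c i j).
Proof. by move=> eij c b; rewrite /adj updN// eq_sym. Qed.

Lemma rdeg_ignores i j e : (forall k, k != i -> k != j -> e != edge i k) ->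
  ignores e (fun c => rdeg c i j).
Proof.
move=> H c b; apply: eq_bigr => k /andP[ki kj].
by rewrite adj_ignores// H.
Qed.

Lemma rdeg_ignores_edge i j : ignores (edge i j) (fun c => rdeg c i j).
Proof.
apply: rdeg_ignores => k ki kj; rewrite edge_eq eqxx/= [j == k]eq_sym (negbTE kj)/=.
by rewrite [i == k]eq_sym (negbTE ki).
Qed.

Lemma degree_adj c i j : i != j -> degree (adj c) i = (adj c i j + rdeg c i j)%N.
Proof.
move=> ij; rewrite /degree (bigD1 j) /=; last by rewrite eq_sym.
by [].
Qed.

Definition pw tau (d : nat) : R := d%:R `^ tau.

Definition edge_term tau c k l : R :=
  (adj c k l)%:R * (pw tau (degree (adj c) k) * pw tau (degree (adj c) l)).

Lemma edge_termC tau c k l : edge_term tau c k l = edge_term tau c l k.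
Proof. by rewrite /edge_term adjC [pw _ _ * _]mulrC. Qed.

Lemma edge_termxx tau c k : edge_term tau c k k = 0.
Proof. by rewrite /edge_term adjxx mul0r. Qed.

(** Ordered pairs make the sum symmetric, as [sum_sym_local] requires. *)
Lemma randic_index_adj tau c : randic_index tau (adj c) =
  2^-1 * \sum_k \sum_l edge_term tau c k l.
Proof.
have sym k l : edge_term tau c k l = edge_term tau c l k.
  by rewrite /edge_term adjC [pw _ _ * _]mulrC.
have -> : randic_index tau (adj c) = \sum_(k < n) \sum_(l < n | (k < l)%N) edge_term tau c k l.
  apply: eq_bigr => k _; rewrite big_mkcondr; apply: eq_bigr => l _.
  rewrite /edge_term /pw natrM powRM//; case: (adj c k l); first by rewrite mul1r.
  by rewrite mul0r.
have -> : \sum_k \sum_l edge_term tau c k l =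
    \sum_(k < n) \sum_(l < n | (k < l)%N) edge_term tau c k l +
    \sum_(k < n) \sum_(l < n | (l < k)%N) edge_term tau c k l.
  rewrite -big_split; apply: eq_bigr => k _ /=.
  rewrite (bigID (fun l : V => (k < l)%N)) /=; congr (_ + _).
  rewrite (bigD1 k) ?ltnn//= /edge_term adjxx mul0r add0r.
  apply: eq_bigl => l; rewrite -leqNgt ltn_neqAle andbC; congr (_ && _).
rewrite [X in _ = _ * (_ + X)](_ : _ = \sum_(k < n) \sum_(l < n | (k < l)%N) edge_term tau c k l).
  by set S := \sum_(k < n) _; lra.
rewrite (exchange_big_dep predT)//=; apply: eq_bigr => k _.
by apply: eq_bigr => l _; rewrite edge_termC.
Qed.

(* The change of the terms of the edges at i other than ij, when ij is added. *)
Definition nbr_sum tau i j c : R :=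
  \sum_(l | (l != i) && (l != j)) (adj c i l)%:R *
    ((pw tau (rdeg c i j).+1 - pw tau (rdeg c i j)) * pw tau (rdeg c l i).+1).

(** The degree of a neighbour l of i is written as [(rdeg c l i).+1] because [rdeg c l i] depends on
    no edge at i: the edges at i can later be separated from the degrees of its neighbours by
    independence. *)
Lemma dif_randic tau i j c : i != j ->
  dif (edge i j) (fun c => randic_index tau (adj c)) c =
  pw tau (rdeg c i j).+1 * pw tau (rdeg c j i).+1 + nbr_sum tau i j c + nbr_sum tau j i c.
Proof.
move=> ij; have ji : j != i by rewrite eq_sym.
pose c1 := upd c (edge i j) true; pose c0 := upd c (edge i j) false.
pose D k l := edge_term tau c1 k l - edge_term tau c0 k l.
have rdij b : rdeg (upd c (edge i j) b) i j = rdeg c i j by exact: rdeg_ignores_edge.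
have rdji b : rdeg (upd c (edge i j) b) j i = rdeg c j i.
  by rewrite edgeC; exact: rdeg_ignores_edge.
have degi b : degree (adj (upd c (edge i j) b)) i = (b + rdeg c i j)%N.
  by rewrite (degree_adj _ ij) rdij adj_upd// !eqxx.
have degj b : degree (adj (upd c (edge i j) b)) j = (b + rdeg c j i)%N.
  by rewrite (degree_adj _ ji) rdji adj_upd// !eqxx orbT.
have deg b l : l != i -> l != j ->
    degree (adj (upd c (edge i j) b)) l = degree (adj c) l.
  move=> li lj; apply: eq_bigr => k kl; rewrite adj_upd// (negbTE li) (negbTE lj).
  by [].
have difE : dif (edge i j) (fun c => randic_index tau (adj c)) c =
    2^-1 * \sum_k \sum_l D k l.
  rewrite /dif !randic_index_adj -mulrBr; congr (_ * _).
  by rewrite -sumrB; apply: eq_bigr => k _; rewrite -sumrB.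
rewrite difE (sum_sym_local ij).
- rewrite mulrA mulVf ?pnatr_eq0// mul1r; congr (_ + _ + _).
  + by rewrite /D /edge_term !adj_upd// !eqxx /= !degi !degj mul0r mul1r subr0.
  + apply: eq_bigr => l /andP[li lj].
    rewrite /D /edge_term !adj_upd// eqxx (negbTE lj) (negbTE ij) /= !degi !deg//.
    have [ail|_] := boolP (adj c i l); last by rewrite !mul0r subr0.
    by rewrite (degree_adj _ li) adjC ail /= !mul1r -mulrBl.
  + apply: eq_big => [l|l /andP[li lj]]; first by rewrite andbC.
    rewrite /D /edge_term !adj_upd// eqxx (negbTE li) (negbTE ji) /= !degj !deg//.
    have [ajl|_] := boolP (adj c j l); last by rewrite !mul0r subr0.
    by rewrite (degree_adj _ lj) adjC ajl /= !mul1r -mulrBl.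
- by move=> k l; rewrite /D !(edge_termC _ _ k l).
- by move=> k; rewrite /D !edge_termxx subrr.
- move=> k l ki kj li lj; rewrite /D /edge_term !adj_upd// !deg//.
  by rewrite (negbTE ki) (negbTE kj) /= subrr.
Qed.

End graph.

(** Weighted Cauchy-Schwarz, from Lagrange's identity for the double sum of a_i a_j (r_i -
    r_j)^2. *)
Lemma sqr_sum_le (R : realType) (I : finType) (P : pred I) (a r : I -> R) :
  (forall i, 0 <= a i) ->
  (\sum_(i | P i) a i * r i) ^+ 2 <=
  (\sum_(i | P i) a i) * \sum_(i | P i) a i * r i ^+ 2.
Proof.
move=> a0; rewrite expr2 !big_distrlr /=.
have : 0 <= \sum_(i | P i) \sum_(j | P j) a i * a j * (r i - r j) ^+ 2.
  by apply: sumr_ge0 => i _; apply: sumr_ge0 => j _; rewrite mulr_ge0 ?sqr_ge0// mulr_ge0.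
have -> : \sum_(i | P i) \sum_(j | P j) a i * a j * (r i - r j) ^+ 2 =
  \sum_(i | P i) \sum_(j | P j) a i * (a j * r j ^+ 2) +
  \sum_(i | P i) \sum_(j | P j) a j * (a i * r i ^+ 2) -
  2 * \sum_(i | P i) \sum_(j | P j) a i * r i * (a j * r j).
  rewrite mulr_sumr -big_split -sumrB; apply: eq_bigr => i _ /=.
  rewrite mulr_sumr -big_split -sumrB; apply: eq_bigr => j _ /=.
  by ring.
rewrite [X in _ + X - _]exchange_big /=; set x := \sum_(i | P i) _; set y := \sum_(i | P i) _.
by move=> ?; lra.
Qed.

Section mean_degree.
Context {R : realType}.
Implicit Types (p tau : R) (n : nat).

Definition mean n p : R := 1 + (n%:R - 2) * p.

(* The edge ij counts as present: mean n p is the mean of (rdeg c i j).+1. *)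
Definition sdev n p (c : {ffun 'I_n * 'I_n -> bool}) i j : R :=
  ((rdeg c i j).+1%:R - mean n p) / mean n p.

Definition rhgt n p (c : {ffun 'I_n * 'I_n -> bool}) i j : R :=
  hgt (mean n p) (rdeg c i j).+1%:R.

End mean_degree.

(** * Moments and covariances of the degrees *)

Section degree_moments.
Context {R : realType} (n : nat) (p : R).
Hypothesis p01 : 0 <= p <= 1.
Hypothesis n2 : (2 <= n)%N.
Local Notation V := 'I_n.
Local Notation config := {ffun V * V -> bool}.
Local Notation pr := (@upper_prob R n p).
Local Notation m := (mean n p).
Implicit Types (c : config) (i j k l : V).

Lemma upper_prob01 e : 0 <= pr e <= 1.
Proof. by rewrite /upper_prob; case: ifP => // _; rewrite lexx ler01. Qed.

Lemma mean_ge1 : 1 <= m.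
Proof.
have /andP[p0 _] := p01.
by rewrite /mean lerDl mulr_ge0// subr_ge0 ler_nat.
Qed.

Let m1 := mean_ge1.
Let m0 : 0 < m. Proof. by have := mean_ge1; lra. Qed.

Lemma rhgt_ge1 c i j : 1 <= rhgt p c i j.
Proof. exact: hgt_ge1. Qed.

Lemma rhgt_ge0 c i j : 0 <= rhgt p c i j.
Proof. exact: hgt_ge0. Qed.

Lemma sdev_sqr_le c i j : sdev p c i j ^+ 2 <= rhgt p c i j / m.
Proof.
rewrite /rhgt /hgt /sdev; set y := _ - m.
have -> : (y / m) ^+ 2 = y ^+ 2 / m / m by field; rewrite gt_eqF.
by rewrite ler_pM2r ?invr_gt0// lerDr.
Qed.

Lemma sdev_le c i j : `|sdev p c i j| <= rhgt p c i j.
Proof.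
have := sdev_sqr_le c i j; rewrite ler_pdivlMr// => H.
have h1 := rhgt_ge1 c i j.
have : sdev p c i j ^+ 2 <= rhgt p c i j.
  by apply: le_trans H; rewrite ler_peMr ?sqr_ge0.
rewrite -real_normK ?num_real//.
have := normr_ge0 (sdev p c i j); nra.
Qed.

Lemma sum_others i j : i != j ->
  \sum_(k : V | (k != i) && (k != j)) (1 : R) = n%:R - 2.
Proof.
move=> ij; have : \sum_(k : V) (1 : R) = n%:R.
  by rewrite sumr_const card_ord.
rewrite (bigD1 i)//= (bigD1 j) 1?eq_sym//= => <-; ring.
Qed.

Lemma rdeg_cen c i j : i != j ->
  (rdeg c i j).+1%:R - m = \sum_(k | (k != i) && (k != j)) cen pr (edge i k) c.
Proof.
move=> ij; rewrite -addn1 natrD /rdeg natr_sum.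
have -> : \sum_(k | (k != i) && (k != j)) cen pr (edge i k) c =
    \sum_(k | (k != i) && (k != j)) ((adj c i k)%:R - 1 * p).
  apply: eq_bigr => k /andP[ki _]; rewrite /cen upper_prob_edge 1?eq_sym// mul1r.
  by rewrite /adj eq_sym ki.
by rewrite sumrB /mean -(sum_others ij) mulr_suml; ring.
Qed.

Definition row_edges i j : seq (V * V) :=
  [seq edge i k | k <- index_enum V & (k != i) && (k != j)].

Lemma row_edges_uniq i j : uniq (row_edges i j).
Proof.
rewrite map_inj_in_uniq ?filter_uniq ?index_enum_uniq// => k l.
rewrite !mem_filter => /andP[/andP[ki _] _] _ /eqP; rewrite edge_eq eqxx /=.
by rewrite (negbTE ki) andbF orbF => /eqP.
Qed.

Lemma big_row_edges i j (F : V * V -> R) :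
  \sum_(e <- row_edges i j) F e = \sum_(k | (k != i) && (k != j)) F (edge i k).
Proof. by rewrite big_map big_filter. Qed.

Lemma Ex_rhgt i j (k : nat) : i != j ->
  Ex pr (fun c => rhgt p c i j ^+ k) <= hgt_moment k.
Proof.
move=> ij; have /andP[p0 p1] := p01.
have := @Ex_hgt R _ pr upper_prob01 k (row_edges i j) m m1 (row_edges_uniq i j).
rewrite (@Ex_ext _ _ _ _ (fun c => rhgt p c i j ^+ k)) => [|c]; last first.
  by rewrite big_row_edges -rdeg_cen// subrKC.
apply; rewrite big_row_edges (eq_bigr (fun=> 1 * (p * (1 - p)))); last first.
  by move=> l /andP[li _]; rewrite /vr upper_prob_edge 1?eq_sym// mul1r.
rewrite -mulr_suml sum_others// /mean.
have : 0 <= (n%:R - 2) * p * p by rewrite !mulr_ge0// subr_ge0 ler_nat.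
by lra.
Qed.

Lemma Ex_sqr_le i j (f : config -> R) (B : R) (k : nat) : i != j -> 0 <= B ->
  (forall c, `|f c| <= B * rhgt p c i j ^+ k) ->
  Ex pr (fun c => f c ^+ 2) <= B ^+ 2 * hgt_moment (2 * k).
Proof.
move=> ij B0 H; apply: (@le_trans _ _ (Ex pr (fun c => B ^+ 2 * rhgt p c i j ^+ (2 * k)))).
  apply: ler_Ex => [|c]; first exact: upper_prob01.
  rewrite -real_normK ?num_real// mulnC exprM -exprMn.
  by apply: lerXn2r; rewrite ?nnegrE// ?mulr_ge0// exprn_ge0// rhgt_ge0.
by rewrite ExZ ler_wpM2l ?sqr_ge0 ?Ex_rhgt.
Qed.

(** The two degrees are decoupled by 2ab <= a^2 + b^2, which doubles the order of the moment. *)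
Lemma Ex_sqr_le2 i j (f : config -> R) (B : R) (k : nat) : i != j -> 0 <= B ->
  (forall c, `|f c| <= B * (rhgt p c i j * rhgt p c j i) ^+ k) ->
  Ex pr (fun c => f c ^+ 2) <= B ^+ 2 * hgt_moment (4 * k).
Proof.
move=> ij B0 H; have ji : j != i by rewrite eq_sym.
apply: (@le_trans _ _ (Ex pr (fun c => B ^+ 2 *
    (2^-1 * (rhgt p c i j ^+ (4 * k) + rhgt p c j i ^+ (4 * k)))))).
  apply: ler_Ex => [|c]; first exact: upper_prob01.
  have h1 := rhgt_ge0 c i j; have h2 := rhgt_ge0 c j i.
  apply: (@le_trans _ _ (B ^+ 2 * (rhgt p c i j ^+ (2 * k) * rhgt p c j i ^+ (2 * k)))).
    rewrite -real_normK ?num_real// -exprMn (mulnC 2) exprM -exprMn.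
    by apply: lerXn2r; rewrite ?nnegrE// ?mulr_ge0// exprn_ge0// mulr_ge0.
  rewrite ler_wpM2l ?sqr_ge0//.
  have -> : (4 * k = (2 * k) * 2)%N by lia.
  rewrite !(exprM _ _ 2).
  set a := _ ^+ (2 * k); set b := _ ^+ (2 * k).
  by have := sqr_ge0 (a - b); nra.
rewrite !ExZ ExD ler_wpM2l ?sqr_ge0//.
have := Ex_rhgt (4 * k) ij; have := Ex_rhgt (4 * k) ji; lra.
Qed.

Lemma Ex_cen2 e e' : Ex pr (fun c => cen pr e c * cen pr e' c) = (e == e')%:R * vr pr e.
Proof.
have [<-|ee'] := eqVneq e e'; last first.
  by rewrite cenM ?mul0r//; exact: cen_ignores.
rewrite mul1r (@Ex_ext _ _ _ _ (fun c => cen pr e c ^+ 2 * 1)).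
  by rewrite cenM2// Ex_cst mulr1.
by move=> c; rewrite mulr1.
Qed.

Lemma Ex_sdev i j : i != j -> Ex pr (fun c => sdev p c i j) = 0.
Proof.
move=> ij; rewrite ExZr (@Ex_ext _ _ _ _ _ (fun c => rdeg_cen c ij)).
rewrite Ex_sum big1 ?mul0r// => k _.
rewrite (@Ex_ext _ _ _ _ (fun c => cen pr (edge i k) c * 1)) ?cenM// => c.
by rewrite mulr1.
Qed.

(** For distinct l and l' the two degrees share only the edge ll', so their deviations are nearly
    orthogonal; a single deviation has second moment of order 1/m. *)
Lemma Ex_sdev2 i l l' : l != i -> l' != i ->
  Ex pr (fun c => sdev p c l i * sdev p c l' i) <= (l == l')%:R / m + (m ^+ 2)^-1.
Proof.
move=> li l'i; have /andP[p0 p1] := p01.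
have -> : Ex pr (fun c => sdev p c l i * sdev p c l' i) =
  (\sum_(k | (k != l) && (k != i)) \sum_(k' | (k' != l') && (k' != i))
     (edge l k == edge l' k')%:R * vr pr (edge l k)) * (m ^+ 2)^-1.
  under [in RHS]eq_bigr do under eq_bigr do rewrite -Ex_cen2.
  under [in RHS]eq_bigr do rewrite -Ex_sum.
  rewrite -Ex_sum -ExZr; apply: Ex_ext => c.
  rewrite -big_distrlr /= -!rdeg_cen// /sdev.
  by field; rewrite gt_eqF.
have le1 (P : pred V) (a : V) : \sum_(k | P k) (k == a)%:R <= 1 :> R.
  apply: (@le_trans _ _ (\sum_(k : V) (k == a)%:R)).
    by rewrite [leRHS](bigID P) /= lerDl sumr_ge0.
  by rewrite (bigD1 a)//= eqxx big1 ?addr0// => k /negbTE ->.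
have v1 : p * (1 - p) <= p by nra.
have v0 : 0 <= p * (1 - p) by rewrite mulr_ge0//; lra.
apply: (@le_trans _ _ (((l == l')%:R * m + 1) * (m ^+ 2)^-1)); last first.
  rewrite mulrDl mul1r (_ : _ * m * _ = (l == l')%:R / m)//.
  by field; rewrite gt_eqF.
rewrite ler_wpM2r ?invr_ge0 ?sqr_ge0//.
(* The edges lk and l'k' coincide in two ways: l = l' and k = k', or k = l' and k' = l. *)
apply: (@le_trans _ _ (\sum_(k | (k != l) && (k != i)) \sum_(k' | (k' != l') && (k' != i))
    (((l == l')%:R * p) * (k' == k)%:R + (k == l')%:R * (k' == l)%:R))).
  apply: ler_sum => k /andP[kl ki]; apply: ler_sum => k' /andP[k'l' k'i].
  rewrite /vr upper_prob_edge 1?eq_sym// edge_eq [k' == k]eq_sym [k' == l]eq_sym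
    ?[l' == l]eq_sym ?[l' == k]eq_sym.
  case: (l == l'); case: (k == k'); case: (k == l'); case: (l == k');
    rewrite ?mul1r ?mulr1 ?mul0r ?mulr0 ?addr0 ?add0r//=; lra.
under eq_bigr do rewrite big_split -!mulr_sumr /=.
rewrite big_split; apply: lerD.
  apply: (@le_trans _ _ (\sum_(k | (k != l) && (k != i)) ((l == l')%:R * p) * 1)).
    by apply: ler_sum => k _; rewrite ler_wpM2l// mulr_ge0.
  rewrite -mulr_sumr sum_others// -mulrA ler_wpM2l// mulrC /mean.
  by lra.
rewrite -mulr_suml -[leRHS]mulr1; apply: ler_pM => //; exact: sumr_ge0.
Qed.

End degree_moments.

(** * The term of the switched edge itself *)

Section difference_estimates.
Context {R : realType}.
Implicit Types (tau p : R).

Lemma ord2_gt1 n (i j : 'I_n) : i != j -> (1 < n)%N.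
Proof.
case: n i j => [|[|n]] i j //; first by case: i.
by rewrite (ord1 i) (ord1 j) eqxx.
Qed.

Lemma pw_taylor tau : exists C : R, exists2 k : nat, 0 <= C &
  forall n p (i j : 'I_n) c, 0 <= p <= 1 -> (1 < n)%N ->
  `|pw tau (rdeg c i j).+1 - mean n p `^ tau * (1 + tau * sdev p c i j)| <=
  C * (mean n p `^ tau / mean n p) * rhgt p c i j ^+ k.
Proof.
have [C [k C0 H]] := @powR_taylor_hgt R tau; exists C, k => // n p i j c p01 n1.
have m1 := mean_ge1 p01 n1.
rewrite -powRB1_div ?(lt_le_trans ltr01)//; apply: H => //.
by rewrite ler1n.
Qed.

Lemma pair_term_estimate tau : exists2 C : R, 0 <= C &
  forall n p (i j : 'I_n), 0 <= p <= 1 -> i != j ->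
  Ex (upper_prob p) (fun c => (pw tau (rdeg c i j).+1 * pw tau (rdeg c j i).+1 -
      (mean n p `^ tau) ^+ 2 * (1 + tau * sdev p c i j + tau * sdev p c j i)) ^+ 2) <=
  C * ((mean n p `^ tau) ^+ 2 / mean n p) ^+ 2.
Proof.
have [C [k C0 H]] := pw_taylor tau.
(* The summands bound, in turn, the product of the deviations, the two products of a remainder with
   a main term, and the product of the remainders. *)
pose B := tau ^+ 2 + 2 * C * (1 + `|tau|) + C ^+ 2.
have t0 := normr_ge0 tau.
have B0 : 0 <= B by rewrite !addr_ge0 ?sqr_ge0// !mulr_ge0// addr_ge0.
exists (B ^+ 2 * hgt_moment (4 * k.+1)) => [|n p i j p01 ij].
  by rewrite mulr_ge0 ?sqr_ge0 ?hgt_moment_ge0.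
set m := mean n p; have n1 := ord2_gt1 ij; have m1 : 1 <= m by exact: mean_ge1.
have m0 : 0 < m by lra.
set M := m `^ tau; have M0 : 0 <= M by exact: powR_ge0.
rewrite [leRHS]mulrAC -[in leRHS]exprMn.
apply: (Ex_sqr_le2 p01 n1 ij).
  by rewrite mulr_ge0// divr_ge0 ?sqr_ge0// ltW.
move=> c; have := H n p i j c p01 n1; have := H n p j i c p01 n1.
rewrite -/m -/M; set x := sdev p c i j; set y := sdev p c j i.
set h := rhgt p c i j; set h' := rhgt p c j i.
have h1 : 1 <= h by exact: rhgt_ge1.
have h'1 : 1 <= h' by exact: rhgt_ge1.
set g := pw tau (rdeg c i j).+1; set g' := pw tau (rdeg c j i).+1.
set r' := g' - _; set r := g - _ => Hr' Hr.
(* The product x * y is itself of order 1/m, so it belongs to the error. *)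
have -> : g * g' - M ^+ 2 * (1 + tau * x + tau * y) =
    M ^+ 2 * tau ^+ 2 * (x * y) + r * (M * (1 + tau * y)) +
    r' * (M * (1 + tau * x)) + r * r' by rewrite /r /r'; ring.
have hk : 1 <= h ^+ k by rewrite exprn_ege1.
have h'k : 1 <= h' ^+ k by rewrite exprn_ege1.
have xx : `|x| <= h by exact: sdev_le.
have yy : `|y| <= h' by exact: sdev_le.
have xy : `|x * y| <= (h * h') / m.
  have x2 : x ^+ 2 <= h / m by exact: sdev_sqr_le.
  have y2 : y ^+ 2 <= h' / m by exact: sdev_sqr_le.
  apply: (@le_trans _ _ (2^-1 * (x ^+ 2 + y ^+ 2))).
    rewrite normrM -(real_normK (num_real x)) -(real_normK (num_real y)).
    by have := sqr_ge0 (`|x| - `|y|); nra.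
  apply: (@le_trans _ _ (2^-1 * (h + h') / m)).
    by rewrite -[leRHS]mulrA ler_wpM2l// mulrDl; lra.
  by rewrite ler_pM2r ?invr_gt0//; nra.
set P := (h * h') ^+ k.+1.
have q0 : 0 <= M ^+ 2 / m by rewrite divr_ge0 ?sqr_ge0 ?ltW.
have PE : P = h * h' * (h ^+ k * h' ^+ k) by rewrite /P exprS exprMn.
have P1 : h * h' <= P by rewrite PE ler_peMr; nra.
have one (a : R) (b : R) : 1 <= a -> `|b| <= a -> `|1 + tau * b| <= (1 + `|tau|) * a.
  move=> a1 ba; rewrite (le_trans (ler_normD _ _))// normr1 normrM.
  by nra.
have Q (u v v' : R) w s : 0 <= u -> 1 <= v -> 1 <= v' -> `|w| <= v' ->
    `|s| <= C * (M / m) * v ^+ k ->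
    `|s * (M * (1 + tau * w))| <= M ^+ 2 / m * (C * (1 + `|tau|)) * (v ^+ k * v').
  move=> _ v1 v'1 wv sv; rewrite 2!normrM (ger0_norm M0).
  rewrite (_ : _ * _ * _ * _ = (C * (M / m) * v ^+ k) * (M * ((1 + `|tau|) * v'))); last by
    field; rewrite gt_eqF.
  apply: ler_pM => //; first by rewrite mulr_ge0.
  by rewrite ler_wpM2l// one.
have {}Q1 := Q 0 _ _ _ _ (lexx 0) h1 h'1 yy Hr.
have {}Q2 := Q 0 _ _ _ _ (lexx 0) h'1 h1 xx Hr'.
have Q3 : `|r * r'| <= M ^+ 2 / m * C ^+ 2 * P.
  rewrite normrM; apply: (@le_trans _ _ ((C * (M / m) * h ^+ k) * (C * (M / m) * h' ^+ k))).
    by apply: ler_pM.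
  rewrite PE (_ : _ * _ * (_ * _ * _) = M ^+ 2 / m * C ^+ 2 * ((h ^+ k * h' ^+ k) / m)); last by
    field; rewrite gt_eqF.
  apply: ler_wpM2l; first by rewrite mulr_ge0 ?sqr_ge0.
  have hh : 0 <= h ^+ k * h' ^+ k by nra.
  by apply: (@le_trans _ _ (h ^+ k * h' ^+ k)); rewrite ?ler_pdivrMr// ?ler_peMr// ler_peMl//; nra.
have Q4 : `|M ^+ 2 * tau ^+ 2 * (x * y)| <= M ^+ 2 / m * tau ^+ 2 * P.
  rewrite normrM (ger0_norm (mulr_ge0 (sqr_ge0 _) (sqr_ge0 _))).
  rewrite (_ : _ / m * _ * P = M ^+ 2 * tau ^+ 2 * (P / m)); last by field; rewrite gt_eqF.
  apply: ler_wpM2l; first by rewrite mulr_ge0 ?sqr_ge0.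
  by rewrite (le_trans xy)// ler_pM2r ?invr_gt0.
have [h0 h'0] : 0 <= h /\ 0 <= h' by split; lra.
have [hk0 h'k0] : 0 <= h ^+ k /\ 0 <= h' ^+ k by split; lra.
have W1 : h ^+ k * h' <= P.
  rewrite PE (_ : h * h' * _ = (h ^+ k * h') * (h * h' ^+ k)); last by ring.
  by rewrite ler_peMr ?mulr_ege1 ?mulr_ge0.
have W2 : h' ^+ k * h <= P.
  rewrite PE (_ : h * h' * _ = (h' ^+ k * h) * (h' * h ^+ k)); last by ring.
  by rewrite ler_peMr ?mulr_ege1 ?mulr_ge0.
have z0 : 0 <= M ^+ 2 / m * (C * (1 + `|tau|)).
  by rewrite mulr_ge0// mulr_ge0// addr_ge0.
have Z1 := ler_wpM2l z0 W1; have Z2 := ler_wpM2l z0 W2.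
apply: (le_trans (ler_normD _ _)); rewrite -[leRHS]mulrA /B.
have -> : (tau ^+ 2 + 2 * C * (1 + `|tau|) + C ^+ 2) * (M ^+ 2 / m * P) =
   M ^+ 2 / m * tau ^+ 2 * P + M ^+ 2 / m * (C * (1 + `|tau|)) * P +
   M ^+ 2 / m * (C * (1 + `|tau|)) * P + M ^+ 2 / m * C ^+ 2 * P by ring.
apply: lerD => //; apply: (le_trans (ler_normD _ _)); apply: lerD.
  apply: (le_trans (ler_normD _ _)); apply: lerD => //; exact: le_trans Z1.
exact: le_trans Z2.
Qed.

End difference_estimates.

Lemma sqrrD3_le (R : realDomainType) (x y z : R) :
  (x + y + z) ^+ 2 <= 3 * (x ^+ 2 + y ^+ 2 + z ^+ 2).
Proof.
have := sqr_ge0 (x - y); have := sqr_ge0 (y - z); have := sqr_ge0 (x - z).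
by lra.
Qed.

(** * The terms of the edges adjacent to the switched edge *)

Section neighbour_estimates.
Context {R : realType}.
Implicit Types (tau p : R).

Definition pw_diff tau n (c : {ffun 'I_n * 'I_n -> bool}) i j : R :=
  pw tau (rdeg c i j).+1 - pw tau (rdeg c i j).

Lemma scaled_diff_taylor tau : exists C : R, exists2 k : nat, 0 <= C &
  forall n p (i j : 'I_n) c, 0 <= p <= 1 -> (1 < n)%N ->
  `|(rdeg c i j)%:R * pw_diff tau c i j -
    mean n p `^ tau * (tau + tau ^+ 2 * sdev p c i j)| <=
  C * (mean n p `^ tau / mean n p) * rhgt p c i j ^+ k.
Proof.
have [C [k C0 H]] := @powR_difference_hgt R tau; exists C, k => // n p i j c p01 n1.
have m1 := mean_ge1 p01 n1.
by rewrite -powRB1_div ?(lt_le_trans ltr01)//; apply: H.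
Qed.

Lemma scaled_diff_le tau : exists C : R, exists2 k : nat, 0 <= C &
  forall n p (i j : 'I_n) c, 0 <= p <= 1 -> (1 < n)%N ->
  `|(rdeg c i j)%:R * pw_diff tau c i j| <= C * mean n p `^ tau * rhgt p c i j ^+ k.
Proof.
have [C [k C0 H]] := scaled_diff_taylor tau.
exists (`|tau| + tau ^+ 2 + C), k.+1 => [|n p i j c p01 n1].
  by rewrite !addr_ge0 ?sqr_ge0.
have m1 := mean_ge1 p01 n1; have := H n p i j c p01 n1.
have h1 := rhgt_ge1 p01 n1 c i j; have xh := sdev_le p01 n1 c i j.
set m := mean n p in m1 xh *; set M := m `^ tau; set h := rhgt p c i j in h1 xh *.
set f := _ * _; set x := sdev p c i j in xh * => Hf.
have M0 : 0 <= M by exact: powR_ge0.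
have hk : 1 <= h ^+ k by rewrite exprn_ege1.
have hh : h <= h ^+ k.+1 by rewrite exprS ler_peMr//; lra.
have hk1 : h ^+ k <= h ^+ k.+1 by apply: ler_weXn2l.
rewrite -[f](subrK (M * (tau + tau ^+ 2 * x))) (le_trans (ler_normD _ _))//.
rewrite addrC (_ : _ * M * _ = M * ((`|tau| + tau ^+ 2) * h ^+ k.+1) + C * M * h ^+ k.+1); last
  by ring.
apply: lerD.
  rewrite normrM (ger0_norm M0) ler_wpM2l// (le_trans (ler_normD _ _))// mulrDl.
  apply: lerD; first by rewrite ler_peMr// exprn_ege1.
  rewrite normrM ger0_norm ?sqr_ge0// ler_wpM2l ?sqr_ge0//; exact: le_trans hh.
apply: (le_trans Hf); apply: ler_pM => //; first by rewrite mulr_ge0// divr_ge0//; lra.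
  by lra.
by rewrite ler_wpM2l// ler_pdivrMr ?ler_peMr//; lra.
Qed.

(** The power of each neighbour's degree is replaced by its expansion. Its constant part produces
    the degree of i times a difference of powers; the other two sums are negligible, the first
    because deviations at different l are nearly orthogonal, the second because the Taylor remainder
    is small. *)
Lemma nbr_sum_split tau n p (i j : 'I_n) c :
  let M := mean n p `^ tau in
  nbr_sum tau i j c = M * ((rdeg c i j)%:R * pw_diff tau c i j)
  + tau * M * \sum_(l | (l != i) && (l != j))
      (adj c i l)%:R * pw_diff tau c i j * sdev p c l i
  + \sum_(l | (l != i) && (l != j)) (adj c i l)%:R *
      (pw_diff tau c i j * (pw tau (rdeg c l i).+1 - M * (1 + tau * sdev p c l i))).
Proof.
move=> M; rewrite /rdeg natr_sum mulr_suml !mulr_sumr -!big_split /=.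
by apply: eq_bigr => l _; rewrite /pw_diff; ring.
Qed.

Definition touches n (i : 'I_n) (e : 'I_n * 'I_n) := (e.1 == i) || (e.2 == i).

Lemma touches_edge n (i k l : 'I_n) : touches i (edge k l) = (k == i) || (l == i).
Proof. by rewrite /edge /touches; case: ltnP => _ //=; rewrite orbC. Qed.

Lemma rdeg_touches n (i j : 'I_n) e : ~~ touches i e ->
  ignores e (fun c => rdeg c i j).
Proof.
move=> ie; apply: rdeg_ignores => k _ _; apply: contraNneq ie => ->.
by rewrite touches_edge eqxx.
Qed.

Lemma rdeg_untouched n (i l : 'I_n) e : l != i -> touches i e ->
  ignores e (fun c => rdeg c l i).
Proof.
move=> li ie; apply: rdeg_ignores => k _ ki; apply: contraTneq ie => ->.
by rewrite touches_edge negb_or li.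
Qed.

Lemma adj_touches n (i l : 'I_n) e : ~~ touches i e ->
  ignores e (fun c => adj c i l).
Proof.
move=> ie; apply: adj_ignores; apply: contraNneq ie => ->.
by rewrite touches_edge eqxx.
Qed.

Section fixed.
Variables (n : nat) (p : R) (i j : 'I_n).
Hypotheses (p01 : 0 <= p <= 1) (ij : i != j).
Local Notation m := (mean n p).
Local Notation pr := (@upper_prob R n p).
Let n1 : (1 < n)%N. Proof. exact: ord2_gt1 ij. Qed.
Let m1 : 1 <= m. Proof. exact: mean_ge1. Qed.
Let m0 : 0 < m. Proof. exact: lt_le_trans m1. Qed.
Let pr01 := @upper_prob01 R n p p01.

(** Edges at i are independent of the deviations of the neighbours, so the square expands into
    products of expectations. The two parts of the bound in [Ex_sdev2] give the two summands. Plain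
    Cauchy-Schwarz would miss a factor of order 1/m. *)
Lemma Ex_nbr_sdev tau :
  Ex pr (fun c => (\sum_(l | (l != i) && (l != j))
      (adj c i l)%:R * pw_diff tau c i j * sdev p c l i) ^+ 2) <=
  Ex pr (fun c => (rdeg c i j)%:R * pw_diff tau c i j ^+ 2) / m +
  Ex pr (fun c => ((rdeg c i j)%:R * pw_diff tau c i j) ^+ 2) / m ^+ 2.
Proof.
pose f l l' c := (adj c i l)%:R * (adj c i l')%:R * pw_diff tau c i j ^+ 2 : R.
have f0 l l' : 0 <= Ex pr (f l l').
  by apply: Ex_ge0 => // c; rewrite mulr_ge0 ?sqr_ge0// mulr_ge0.
have -> : Ex pr (fun c => (\sum_(l | (l != i) && (l != j))
      (adj c i l)%:R * pw_diff tau c i j * sdev p c l i) ^+ 2) =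
   \sum_(l | (l != i) && (l != j)) \sum_(l' | (l' != i) && (l' != j))
     Ex pr (f l l') * Ex pr (fun c => sdev p c l i * sdev p c l' i).
  transitivity (Ex pr (fun c => \sum_(l | (l != i) && (l != j))
      \sum_(l' | (l' != i) && (l' != j)) f l l' c * (sdev p c l i * sdev p c l' i))).
    apply: Ex_ext => c; rewrite expr2 big_distrlr /=; apply: eq_bigr => l _.
    by apply: eq_bigr => l' _; rewrite /f; ring.
  rewrite Ex_sum; apply: eq_bigr => l /andP[li _]; rewrite Ex_sum.
  apply: eq_bigr => l' /andP[l'i _]; apply: (@Ex_indep _ _ _ (touches i)).
    move=> e ie c b; rewrite /f /pw_diff rdeg_touches// !(adj_touches _ ie).
    by [].
  by move=> e ie c b; rewrite /sdev !(rdeg_untouched _ ie).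
apply: (@le_trans _ _ (\sum_(l | (l != i) && (l != j)) \sum_(l' | (l' != i) && (l' != j))
     Ex pr (f l l') * ((l == l')%:R / m + (m ^+ 2)^-1))).
  apply: ler_sum => l /andP[li _]; apply: ler_sum => l' /andP[l'i _].
  by rewrite ler_wpM2l// Ex_sdev2.
under eq_bigr do under eq_bigr do rewrite mulrDr.
under eq_bigr do rewrite big_split /= -mulr_suml.
rewrite big_split /= -mulr_suml; apply: lerD.
  rewrite -[leRHS]ExZr.
  rewrite (@Ex_ext _ _ _ _ (fun c => \sum_(l | (l != i) && (l != j)) f l l c / m)).
    rewrite Ex_sum; apply: ler_sum => l lij.
    rewrite (bigD1 l)//= eqxx mul1r big1 ?addr0 ?ExZr// => l' /andP[_ /negbTE].
    by rewrite eq_sym => ->; rewrite mul0r mulr0.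
  move=> c; rewrite /rdeg natr_sum !mulr_suml; apply: eq_bigr => l _.
  by rewrite /f; case: (adj c i l); rewrite ?mul1r ?mul0r.
rewrite ler_wpM2r ?invr_ge0 ?sqr_ge0//.
rewrite [leRHS](@Ex_ext _ _ _ _ (fun c => \sum_(l | (l != i) && (l != j))
   \sum_(l' | (l' != i) && (l' != j)) f l l' c)).
  by rewrite Ex_sum; apply: ler_sum => l _; rewrite Ex_sum.
move=> c; rewrite exprMn /rdeg natr_sum expr2 big_distrlr /= mulr_suml.
by apply: eq_bigr => l _; rewrite mulr_suml.
Qed.

(** Cauchy-Schwarz over the neighbours is enough here, as [r] already has the order of the error;
    then independence separates the edges at i from [r]. *)
Lemma Ex_nbr_error tau (r : 'I_n -> {ffun 'I_n * 'I_n -> bool} -> R) (B : R) :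
  (forall l, l != i -> forall e, touches i e -> ignores e (r l)) ->
  (forall l, l != i -> Ex pr (fun c => r l c ^+ 2) <= B) ->
  Ex pr (fun c => (\sum_(l | (l != i) && (l != j))
      (adj c i l)%:R * (pw_diff tau c i j * r l c)) ^+ 2) <=
  Ex pr (fun c => ((rdeg c i j)%:R * pw_diff tau c i j) ^+ 2) * B.
Proof.
move=> ri rB.
pose f l c := (rdeg c i j)%:R * pw_diff tau c i j ^+ 2 * (adj c i l)%:R : R.
apply: (@le_trans _ _ (Ex pr (fun c => \sum_(l | (l != i) && (l != j)) f l c * r l c ^+ 2))).
  apply: ler_Ex => // c; apply: (le_trans (sqr_sum_le _ _ _)) => //.
  rewrite -natr_sum mulr_sumr; apply: ler_sum => l _.
  by rewrite /f le_eqVlt; apply/orP; left; apply/eqP; rewrite /rdeg; ring.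
rewrite Ex_sum [in leRHS](@Ex_ext _ _ _ _ (fun c => \sum_(l | (l != i) && (l != j)) f l c)).
  rewrite Ex_sum mulr_suml; apply: ler_sum => l /andP[li lj].
  rewrite (@Ex_indep _ _ _ (touches i)).
  - apply: ler_wpM2l; last exact: rB.
    by apply: Ex_ge0 => // c; rewrite /f mulr_ge0// mulr_ge0// sqr_ge0.
  - move=> e ie c b; rewrite /f /pw_diff rdeg_touches// (adj_touches _ ie).
    by [].
  - by move=> e ie c b; rewrite ri.
move=> c; rewrite -mulr_sumr -natr_sum -/(rdeg c i j); ring.
Qed.

End fixed.

Lemma nbr_sum_estimate tau : exists2 C : R, 0 <= C &
  forall n p (i j : 'I_n), 0 <= p <= 1 -> i != j ->
  Ex (upper_prob p) (fun c => (nbr_sum tau i j c -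
      (mean n p `^ tau) ^+ 2 * (tau + tau ^+ 2 * sdev p c i j)) ^+ 2) <=
  C * ((mean n p `^ tau) ^+ 2 / mean n p) ^+ 2.
Proof.
have [C1 [k1 C10 H1]] := scaled_diff_taylor tau.
have [C2 [k2 C20 H2]] := scaled_diff_le tau.
have [C3 [k3 C30 H3]] := pw_taylor tau.
pose K1 := C1 ^+ 2 * hgt_moment (2 * k1) : R.
pose K2 := C2 ^+ 2 * hgt_moment (2 * k2) : R.
pose K2' := 8 * C2 ^+ 2 * hgt_moment (2 * k2 + 1) : R.
pose K3 := C3 ^+ 2 * hgt_moment (2 * k3) : R.
have K10 : 0 <= K1 by rewrite mulr_ge0 ?sqr_ge0 ?hgt_moment_ge0.
have K20 : 0 <= K2 by rewrite mulr_ge0 ?sqr_ge0 ?hgt_moment_ge0.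
have K30 : 0 <= K3 by rewrite mulr_ge0 ?sqr_ge0 ?hgt_moment_ge0.
have K2'0 : 0 <= K2' by rewrite mulr_ge0 ?hgt_moment_ge0// mulr_ge0 ?sqr_ge0.
exists (3 * (K1 + tau ^+ 2 * (K2' + K2) + K2 * K3)) => [|n p i j p01 ij].
  apply: mulr_ge0 => //; apply: addr_ge0; last exact: mulr_ge0.
  by apply: addr_ge0 => //; apply: (mulr_ge0 (sqr_ge0 _)); exact: addr_ge0.
have n1 := ord2_gt1 ij; have m1 := @mean_ge1 R n p p01 n1.
have pr01 := @upper_prob01 R n p p01.
set m := mean n p in m1 *; have m0 : 0 < m by lra.
set M := m `^ tau; have M0 : 0 <= M by exact: powR_ge0.
pose a c := M * ((rdeg c i j)%:R * pw_diff tau c i j -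
  M * (tau + tau ^+ 2 * sdev p c i j)).
pose b c := tau * M * \sum_(l | (l != i) && (l != j))
      (adj c i l)%:R * pw_diff tau c i j * sdev p c l i.
pose d c := \sum_(l | (l != i) && (l != j)) (adj c i l)%:R *
      (pw_diff tau c i j * (pw tau (rdeg c l i).+1 - M * (1 + tau * sdev p c l i))).
apply: (@le_trans _ _ (Ex (upper_prob p) (fun c => 3 * (a c ^+ 2 + b c ^+ 2 + d c ^+ 2)))).
  apply: ler_Ex => // c; rewrite (nbr_sum_split tau p) -/m -/M.
  rewrite (_ : _ - _ = a c + b c + d c); last by rewrite /a /b /d; ring.
  exact: sqrrD3_le.
rewrite ExZ !ExD -mulrA ler_wpM2l//.
have Mm0 : 0 <= M ^+ 2 / m by rewrite divr_ge0 ?sqr_ge0 ?ltW.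
have C80 : 0 <= 8 * C2 ^+ 2 by apply: mulr_ge0 => //; exact: sqr_ge0.
have phi2 : Ex (upper_prob p) (fun c => ((rdeg c i j)%:R * pw_diff tau c i j) ^+ 2) <=
    K2 * M ^+ 2.
  rewrite /K2 mulrAC -exprMn; apply: (Ex_sqr_le p01 n1 ij) => [|c].
    by rewrite mulr_ge0.
  exact: H2.
(* Compared with [phi2] one factor of the degree is missing, which gains 1/m: the ratio of m to the
   degree is at most a multiple of [h]. *)
have phi2' : Ex (upper_prob p) (fun c => (rdeg c i j)%:R * pw_diff tau c i j ^+ 2) <=
    K2' * (M ^+ 2 / m).
  apply: (@le_trans _ _ (Ex (upper_prob p) (fun c =>
     (8 * C2 ^+ 2 * (M ^+ 2 / m)) * rhgt p c i j ^+ (2 * k2 + 1)))); last first.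
    rewrite ExZ mulrAC /K2' ler_wpM2r ?divr_ge0 ?sqr_ge0 ?(ltW m0)//.
    by rewrite ler_wpM2l ?mulr_ge0 ?sqr_ge0// Ex_rhgt.
  apply: ler_Ex => // c; have := H2 n p i j c p01 n1; rewrite -/m -/M.
  have h1 := rhgt_ge1 p01 n1 c i j.
  set h := rhgt p c i j in h1 *; set q := pw_diff tau c i j.
  have hk := exprn_ege1 (2 * k2 + 1) h1.
  have rhs0 : 0 <= 8 * C2 ^+ 2 * (M ^+ 2 / m) * h ^+ (2 * k2 + 1).
    by apply: mulr_ge0; [exact: mulr_ge0|lra].
  have u1 : (1 : R) <= (rdeg c i j).+1%:R by rewrite ler1n.
  have : m / (rdeg c i j).+1%:R <= 4 * h by exact: ratio_le_hgtV.
  move: u1 rhs0; case: (rdeg c i j) => [|D] u1 rhs0 muh.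
    by move=> _; rewrite mul0r.
  set u := D.+1%:R => Hq.
  have u0 : 1 <= u by rewrite ler1n.
  (* The bound 4 h holds for the degree plus 1; since u + 1 <= 2u, the constant doubles, whence the
     8 in [K2']. *)
  have mu : m <= 8 * h * u.
    have uE : D.+2%:R = u + 1 :> R by rewrite /u natr1.
    move: muh; rewrite ler_pdivrMr ?ltr0n// uE.
    have : 0 <= h * (u - 1) by apply: mulr_ge0; lra.
    lra.
  have uq2 : (u * q) ^+ 2 <= (C2 * M) ^+ 2 * h ^+ (2 * k2).
    rewrite (mulnC 2%N) exprM -exprMn -[X in X <= _]real_normK ?num_real//.
    by apply: lerXn2r; rewrite ?nnegrE// !mulr_ge0// exprn_ge0//; lra.
  rewrite -[leLHS](@mulfK _ m) ?gt_eqF// -[leRHS](@mulfK _ m) ?gt_eqF//.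
  rewrite ler_pM2r ?invr_gt0//.
  apply: (@le_trans _ _ (u * q ^+ 2 * (8 * h * u))).
    by rewrite ler_wpM2l// mulr_ge0 ?sqr_ge0//; lra.
  rewrite (_ : u * _ * _ = 8 * h * (u * q) ^+ 2); last by ring.
  rewrite (_ : 8 * C2 ^+ 2 * _ * _ * m = 8 * h * ((C2 * M) ^+ 2 * h ^+ (2 * k2))); last first.
    by rewrite exprD expr1; set w := h ^+ (2 * k2); field; rewrite gt_eqF.
  by rewrite ler_wpM2l// mulr_ge0//; lra.
have A : Ex (upper_prob p) (fun c => a c ^+ 2) <= K1 * (M ^+ 2 / m) ^+ 2.
  rewrite /K1 [leRHS]mulrAC -exprMn; apply: (Ex_sqr_le p01 n1 ij) => [|c].
    by rewrite mulr_ge0// divr_ge0 ?sqr_ge0// ltW.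
  rewrite /a normrM (ger0_norm M0).
  rewrite (_ : _ * _ * _ ^+ k1 = M * (C1 * (M / m) * rhgt p c i j ^+ k1)); last by field; rewrite
    gt_eqF.
  by rewrite ler_wpM2l//; exact: H1.
have B : Ex (upper_prob p) (fun c => b c ^+ 2) <= tau ^+ 2 * (K2' + K2) * (M ^+ 2 / m) ^+ 2.
  rewrite (@Ex_ext _ _ _ _ (fun c => (tau * M) ^+ 2 * (\sum_(l | (l != i) && (l != j))
      (adj c i l)%:R * pw_diff tau c i j * sdev p c l i) ^+ 2)) => [|c]; last first.
    by rewrite /b [LHS]exprMn.
  rewrite ExZ (_ : tau ^+ 2 * _ * _ = (tau * M) ^+ 2 * ((K2' + K2) * (M / m) ^+ 2)); last first.
    by field; rewrite gt_eqF.
  rewrite ler_wpM2l ?sqr_ge0// (le_trans (Ex_nbr_sdev p01 ij tau))//.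
  rewrite mulrDl; apply: lerD.
    rewrite ler_pdivrMr// (le_trans phi2')// le_eqVlt; apply/orP; left; apply/eqP.
    by rewrite -/m; field; rewrite gt_eqF.
  rewrite ler_pdivrMr ?exprn_gt0// (le_trans phi2)// le_eqVlt; apply/orP; left; apply/eqP.
  by rewrite -/m; field; rewrite gt_eqF.
have D : Ex (upper_prob p) (fun c => d c ^+ 2) <= K2 * K3 * (M ^+ 2 / m) ^+ 2.
  apply: (@le_trans _ _ (K2 * M ^+ 2 * (K3 * (M / m) ^+ 2))); last first.
    by rewrite le_eqVlt; apply/orP; left; apply/eqP; field; rewrite gt_eqF.
  apply: (@le_trans _ _ (Ex (upper_prob p)
      (fun c => ((rdeg c i j)%:R * pw_diff tau c i j) ^+ 2) * (K3 * (M / m) ^+ 2))).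
    apply: Ex_nbr_error => // l li.
      by move=> e ie c b'; rewrite /sdev !(rdeg_untouched _ ie).
    rewrite /K3 [leRHS]mulrAC -exprMn; apply: (Ex_sqr_le p01 n1 li) => [|c].
      by rewrite mulr_ge0// divr_ge0// ltW.
    exact: H3.
  by rewrite ler_wpM2r// mulr_ge0 ?sqr_ge0.
by rewrite !mulrDl; apply: lerD => //; apply: lerD.
Qed.

(** The main terms add up: 1 + tau x + tau y from the edge ij, and tau + tau^2 x, tau + tau^2 y from
    the neighbours of i and of j. *)
Lemma dif_randic_estimate tau : exists2 C : R, 0 <= C &
  forall n p (i j : 'I_n), 0 <= p <= 1 -> i != j ->
  Ex (upper_prob p) (fun c => (dif (edge i j) (fun c => randic_index tau (adj c)) c -
      (mean n p `^ tau) ^+ 2 * ((1 + 2 * tau) +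
        (tau + tau ^+ 2) * (sdev p c i j + sdev p c j i))) ^+ 2) <=
  C * ((mean n p `^ tau) ^+ 2 / mean n p) ^+ 2.
Proof.
have [C1 C10 H1] := pair_term_estimate tau.
have [C2 C20 H2] := nbr_sum_estimate tau.
exists (3 * (C1 + C2 + C2)) => [|n p i j p01 ij]; first by rewrite mulr_ge0// !addr_ge0.
have ji : j != i by rewrite eq_sym.
have := H1 n p i j p01 ij; have := H2 n p i j p01 ij; have := H2 n p j i p01 ji.
set M := mean n p `^ tau; set Q := (_ / _) ^+ 2.
set a := Ex _ (fun c => (nbr_sum tau j i c - _) ^+ 2).
set b := Ex _ (fun c => (nbr_sum tau i j c - _) ^+ 2).
set d := Ex _ (fun c => (_ * _ - _) ^+ 2) => Ha Hb Hd.
apply: (@le_trans _ _ (3 * (d + b + a))); last by lra.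
rewrite /a /b /d -!ExD -ExZ; apply: ler_Ex => [|c]; first exact: upper_prob01.
rewrite dif_randic//.
set x := _ * _ - _; set y := nbr_sum tau i j c - _; set z := nbr_sum tau j i c - _.
rewrite (_ : _ - _ = x + y + z); last by rewrite /x /y /z; ring.
exact: sqrrD3_le.
Qed.

End neighbour_estimates.

(** * Stein's method for characteristic functions *)

Section trigonometric_bounds.
Context {R : realType}.
Implicit Types x y t : R.

Lemma normr_between0 x y : (0 <= x <= y) || (y <= x <= 0) -> `|x| <= `|y|.
Proof.
case/orP => /andP[H1 H2].
  by rewrite !ger0_norm// (le_trans H1).
by rewrite !ler0_norm ?lerN2// (le_trans H1).
Qed.

Lemma MVT_line (f df : R -> R) (a b : R) : (forall x : R, is_derive x 1 f (df x)) ->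
  exists2 z, (a <= z <= b) || (b <= z <= a) & f b - f a = df z * (b - a).
Proof.
move=> fd; wlog ab : a b / a <= b.
  move=> H; have [ab|/ltW ba] := leP a b; first exact: H.
  have [z z1 z2] := H _ _ ba; exists z; first by rewrite orbC.
  by rewrite -[LHS]opprB z2; ring.
move: ab; rewrite le_eqVlt => /predU1P[<-|ab].
  by exists a; rewrite ?lexx// !subrr mulr0.
have [|z] := MVT ab (fun x _ => fd x).
  by apply: derivable_within_continuous => x _; have dx := fd x; exact: ex_derive.
rewrite in_itv /= => /andP[az zb] zE; exists z => //.
by rewrite (ltW az) (ltW zb).
Qed.

Lemma lipschitz_bound (f df : R -> R) (C : R) (a b : R) :
  (forall x : R, is_derive x 1 f (df x)) ->
  (forall x, (a <= x <= b) || (b <= x <= a) -> `|df x| <= C) ->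
  `|f b - f a| <= C * `|b - a|.
Proof.
move=> fd dfC; have [z zab ->] := MVT_line a b fd.
by rewrite normrM ler_wpM2r// dfC.
Qed.

Lemma cos_lipschitz x y : `|cos y - cos x| <= `|y - x|.
Proof.
rewrite -[leRHS]mul1r; apply: (@lipschitz_bound _ (fun x => - sin x)) => // z _.
by rewrite normrN; exact: sin_max.
Qed.

Lemma sin_taylor1 x t : `|sin (x + t) - sin x - t * cos x| <= t ^+ 2.
Proof.
have fd (s : R) : is_derive s 1 (fun s => sin (x + s) - s * cos x) (cos (x + s) - cos x).
  have H1 : is_derive s 1 (fun s : R => x + s) 1.
    have := is_deriveD (is_derive_cst x s (1 : R)) (is_derive_id s (1 : R)).
    by rewrite add0r.
  have H2 : is_derive s 1 (fun s : R => sin (x + s)) (cos (x + s) * 1).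
    exact: (is_derive1_comp (is_derive_sin (x + s)) H1).
  rewrite mulr1 in H2.
  have H3 : is_derive s 1 (fun s : R => s * cos x) (cos x).
    have := is_deriveZ (cos x) (is_derive_id s (1 : R)).
    rewrite [_ *: 1]mulr1; congr is_derive; apply/funext => u /=.
    by rewrite [LHS]mulrC.
  exact: is_deriveB H2 H3.
have [z z0 zE] := MVT_line 0 t fd.
have -> : sin (x + t) - sin x - t * cos x = (cos (x + z) - cos x) * t.
  move: zE; rewrite addr0 mul0r !subr0 => <-; ring.
rewrite normrM -(real_normK (num_real t)) expr2 ler_wpM2r//.
apply: (le_trans (cos_lipschitz _ _)).
rewrite (_ : x + z - x = z); last by ring.
exact: normr_between0.
Qed.

(** The integrating factor exp(t^2 / 2) is largest at the end point x of the range considered, so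
    dividing by its value there leaves the error eta |x|. *)
Lemma gauss_ode (G S : R -> R) (x eta : R) :
  (forall t : R, is_derive t 1 G (- S t)) ->
  (forall t, `|t| <= `|x| -> `|S t - t * G t| <= eta) ->
  `|G x - expR (- (x ^+ 2 / 2)) * G 0| <= eta * `|x|.
Proof.
move=> Gd SG.
have hd (t : R) : is_derive t 1 (fun t => expR (t ^+ 2 / 2) * G t)
    (expR (t ^+ 2 / 2) * (t * G t - S t)).
  have H1 : is_derive t 1 (fun t : R => t ^+ 2 / 2) t.
    have := is_deriveZ (2^-1 : R) (is_deriveX 2 (is_derive_id t (1 : R))).
    rewrite (_ : 2^-1 *: _ = t); last by rewrite /GRing.scale /= expr1; field.
    by congr is_derive; apply/funext => u /=; rewrite [RHS]mulrC.
  have H2 := @is_derive1_comp _ expR (fun t : R => t ^+ 2 / 2) t _ _ (is_derive_expR _) H1.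
  have H3 := is_deriveM H2 (Gd t).
  move: H3; rewrite (_ : _ *: _ + _ = expR (t ^+ 2 / 2) * (t * G t - S t))//.
  by rewrite /GRing.scale /=; ring.
have e0 : 0 < expR (x ^+ 2 / 2) by exact: expR_gt0.
have := @lipschitz_bound _ _ (expR (x ^+ 2 / 2) * eta) 0 x hd.
have E t : `|t| <= `|x| -> `|expR (t ^+ 2 / 2) * (t * G t - S t)| <= expR (x ^+ 2 / 2) * eta.
  move=> tx; rewrite normrM (ger0_norm (expR_ge0 _)); apply: ler_pM => //.
  - rewrite ler_expR ler_pM2r ?invr_gt0//.
    rewrite -(real_normK (num_real t)) -(real_normK (num_real x)).
    by apply: lerXn2r; rewrite ?nnegrE.
  - by rewrite distrC SG.
move=> H.
have {}H : `|expR (x ^+ 2 / 2) * G x - expR (0 ^+ 2 / 2) * G 0| <=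
    expR (x ^+ 2 / 2) * eta * `|x - 0|.
  by apply: H => t t0; apply: E; exact: normr_between0.
move: H; rewrite expr0n /= mul0r expR0 mul1r subr0.
have -> : expR (x ^+ 2 / 2) * G x - G 0 =
   expR (x ^+ 2 / 2) * (G x - expR (- (x ^+ 2 / 2)) * G 0).
  by rewrite mulrBr mulrA -expRD subrr expR0 mul1r.
by rewrite normrM (ger0_norm (ltW e0)) -mulrA ler_pM2l.
Qed.

End trigonometric_bounds.

Section stein.
Context {R : realType} {E : finType} (pr : E -> R).
Hypothesis pr01 : forall e, 0 <= pr e <= 1.
Implicit Types (c : {ffun E -> bool}).

Lemma cen_le1 e c : `|cen pr e c| <= 1.
Proof.
have /andP[p0 p1] := pr01 e.
by rewrite /cen ler_norml; case: (c e) => /=; apply/andP; split; lra.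
Qed.

Lemma is_derive_Ex (f df : {ffun E -> bool} -> R -> R) (t : R) :
  (forall c, is_derive t 1 (f c) (df c t)) ->
  is_derive t 1 (fun t => Ex pr (fun c => f c t)) (Ex pr (fun c => df c t)).
Proof.
move=> fd.
have H (i : 'I_#|{: {ffun E -> bool}}|) :
    is_derive t 1 (fun t => weight pr (enum_val i) * f (enum_val i) t)
     (weight pr (enum_val i) * df (enum_val i) t).
  exact: is_deriveZ.
have := is_derive_sum H.
congr is_derive; last by rewrite /Ex [RHS]big_enum_val.
by apply/funext => u; rewrite /Ex [RHS]big_enum_val /= fct_sumE.
Qed.

Lemma is_derive_Ex_cos (Z : {ffun E -> bool} -> R) (th t : R) :
  is_derive t 1 (fun t => Ex pr (fun c => cos (t * Z c + th)))
    (- Ex pr (fun c => Z c * sin (t * Z c + th))).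
Proof.
rewrite -ExN.
apply: (@is_derive_Ex (fun c t => cos (t * Z c + th))
   (fun c t => - (Z c * sin (t * Z c + th)))) => c.
have H1 : is_derive t 1 (fun s : R => s * Z c + th) (Z c).
  have H := is_deriveD (is_deriveZ (Z c) (is_derive_id t (1 : R))) (is_derive_cst th t (1 : R)).
  move: H; rewrite addr0 [_ *: 1]mulr1; congr is_derive; apply/funext => u /=.
  by rewrite -[in RHS]mulrC.
have := @is_derive1_comp _ cos (fun s : R => s * Z c + th) t _ _ (is_derive_cos _) H1.
by rewrite mulNr mulrC.
Qed.

(** In each summand the sine is expanded around its argument without the contribution of bit e. The
    first error term measures the fluctuation of the quadratic variation, the second is of Lyapunov
    type. The factor [b] is 1 for the linear form and 1/2 for the quadratic one, where every product
    occurs under both of its edges. *)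
Lemma stein_quasi_linear (Z : {ffun E -> bool} -> R) (K : E -> {ffun E -> bool} -> R)
    (b t th : R) : 0 <= b ->
  (forall e, ignores e (K e)) ->
  (forall e, ignores e (fun c => Z c - cen pr e c * K e c)) ->
  (forall c, Z c = b * \sum_e cen pr e c * K e c) ->
  `|Ex pr (fun c => Z c * sin (t * Z c + th)) - t * Ex pr (fun c => cos (t * Z c + th))| <=
  `|t| * Ex pr (fun c => `|b * (\sum_e vr pr e * K e c ^+ 2) - 1|) +
  2 * t ^+ 2 * b * \sum_e vr pr e * Ex pr (fun c => `|K e c| ^+ 3).
Proof.
move=> b0 Ki Zi ZE.
have term e : `|Ex pr (fun c => cen pr e c * K e c * sin (t * Z c + th)) -
    t * Ex pr (fun c => vr pr e * K e c ^+ 2 * cos (t * Z c + th))| <=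
    2 * t ^+ 2 * (vr pr e * Ex pr (fun c => `|K e c| ^+ 3)).
  pose Y c := t * (Z c - cen pr e c * K e c) + th.
  have Yi : ignores e Y by move=> c b'; rewrite /Y Zi.
  have YE c : t * Z c + th = Y c + t * (cen pr e c * K e c) by rewrite /Y; ring.
  have v0 : 0 <= vr pr e by exact: vr_ge0.
  (* Order zero vanishes because the bit is centred; order one yields its variance. *)
  have sE : Ex pr (fun c => cen pr e c * K e c * sin (t * Z c + th)) =
     t * (vr pr e * Ex pr (fun c => K e c ^+ 2 * cos (Y c))) +
     Ex pr (fun c => cen pr e c * K e c *
       (sin (Y c + t * (cen pr e c * K e c)) - sin (Y c) - t * (cen pr e c * K e c) * cos (Y c))).
    rewrite -cenM2; last by move=> c b'; rewrite Ki Yi.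
    rewrite -ExZ -ExD.
    rewrite -[RHS]add0r -(@cenM _ _ pr e (fun c => K e c * sin (Y c))); last first.
      by move=> c b'; rewrite Ki Yi.
    by rewrite -ExD; apply: Ex_ext => c; rewrite YE; ring.
  rewrite sE; set r := Ex pr (fun c => cen pr e c * K e c * _).
  have rb : `|r| <= t ^+ 2 * (vr pr e * Ex pr (fun c => `|K e c| ^+ 3)).
    rewrite -cenM2; last by move=> c b'; rewrite Ki.
    rewrite -ExZ; apply: (le_trans (normr_Ex _ _)) => //; apply: ler_Ex => // c.
    rewrite !normrM; have := sin_taylor1 (Y c) (t * (cen pr e c * K e c)).
    set w := `|_ - _ - _| => Hw.
    apply: (@le_trans _ _ (`|cen pr e c| * `|K e c| * (t * (cen pr e c * K e c)) ^+ 2)).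
      by rewrite ler_wpM2l// mulr_ge0.
    rewrite [leLHS](_ : _ = (t ^+ 2 * (cen pr e c ^+ 2 * (K e c ^+ 2 * `|K e c|))) * `|cen pr e
      c|); last by ring.
    rewrite -(real_normK (num_real (K e c))) -exprSr.
    apply: ler_piMr; last exact: cen_le1.
    by apply: (mulr_ge0 (sqr_ge0 _)); apply: (mulr_ge0 (sqr_ge0 _)); exact: exprn_ge0.
  have db : `|t * (vr pr e * Ex pr (fun c => K e c ^+ 2 * cos (Y c))) -
      t * Ex pr (fun c => vr pr e * K e c ^+ 2 * cos (t * Z c + th))| <=
      t ^+ 2 * (vr pr e * Ex pr (fun c => `|K e c| ^+ 3)).
    rewrite -!ExZ -ExB; apply: (le_trans (normr_Ex _ _)) => //.
    apply: ler_Ex => // c; rewrite YE.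
    rewrite [X in `|X| <= _](_ : _ = t * vr pr e * K e c ^+ 2 * (cos (Y c) - cos (Y c + t * (cen
      pr e c * K e c)))); last by ring.
    rewrite 3!normrM (ger0_norm v0) (ger0_norm (sqr_ge0 _)).
    apply: (@le_trans _ _ (`|t| * vr pr e * K e c ^+ 2 * (`|t| * `|K e c|))).
      apply: ler_wpM2l; first exact: (mulr_ge0 (mulr_ge0 _ _) (sqr_ge0 _)).
      rewrite distrC (le_trans (cos_lipschitz _ _))// addrC addKr 2!normrM.
      by rewrite ler_wpM2l// ler_piMl ?cen_le1.
    rewrite -(real_normK (num_real (K e c))) -(real_normK (num_real t)).
    by rewrite le_eqVlt; apply/orP; left; apply/eqP; ring.
  rewrite addrAC (le_trans (ler_normD _ _))//; lra.
have -> : Ex pr (fun c => Z c * sin (t * Z c + th)) =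
    b * \sum_e Ex pr (fun c => cen pr e c * K e c * sin (t * Z c + th)).
  rewrite -Ex_sum -ExZ; apply: Ex_ext => c.
  by rewrite {1}ZE -mulrA mulr_suml.
set T := \sum_e Ex pr (fun c => cen pr e c * K e c * _).
set G := Ex pr (fun c => cos _).
pose V := \sum_e t * Ex pr (fun c => vr pr e * K e c ^+ 2 * cos (t * Z c + th)).
have TV : `|T - V| <= \sum_e 2 * t ^+ 2 * (vr pr e * Ex pr (fun c => `|K e c| ^+ 3)).
  rewrite /T /V -sumrB; apply: (le_trans (ler_norm_sum _ _ _)).
  by apply: ler_sum => e _; exact: term.
have VG : `|b * V - t * G| <=
    `|t| * Ex pr (fun c => `|b * (\sum_e vr pr e * K e c ^+ 2) - 1|).
  rewrite /V /G -mulr_sumr mulrCA -Ex_sum -(ExZ pr b) -mulrBr normrM ler_wpM2l// -ExB.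
  apply: (le_trans (normr_Ex _ _)) => //; apply: ler_Ex => // c.
  rewrite -mulr_suml mulrA -[X in _ - X]mul1r -mulrBl normrM.
  by rewrite ler_piMr// cos_max.
have -> : b * T - t * G = (b * V - t * G) + b * (T - V) by ring.
apply: (le_trans (ler_normD _ _)); apply: lerD => //.
rewrite normrM (ger0_norm b0) (_ : 2 * t ^+ 2 * b = b * (2 * t ^+ 2)); last by ring.
by rewrite -mulrA ler_wpM2l// mulr_sumr.
Qed.

(* Stein's identity E Z sin (t Z + th) = t E cos (t Z + th) holds approximately,
   and - E Z sin (t Z + th) is the derivative of E cos (t Z + th) in t. *)
Lemma stein_characteristic (Z : {ffun E -> bool} -> R) (K : E -> {ffun E -> bool} -> R)
    (b x th : R) : 0 <= b ->
  (forall e, ignores e (K e)) ->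
  (forall e, ignores e (fun c => Z c - cen pr e c * K e c)) ->
  (forall c, Z c = b * \sum_e cen pr e c * K e c) ->
  `|Ex pr (fun c => cos (x * Z c + th)) - expR (- (x ^+ 2 / 2)) * cos th| <=
  (`|x| * Ex pr (fun c => `|b * (\sum_e vr pr e * K e c ^+ 2) - 1|) +
   2 * x ^+ 2 * b * \sum_e vr pr e * Ex pr (fun c => `|K e c| ^+ 3)) * `|x|.
Proof.
move=> b0 Ki Zi ZE.
have H0 : cos th = Ex pr (fun c => cos (0 * Z c + th)).
  by rewrite -[LHS](Ex_cst pr); apply: Ex_ext => c; rewrite mul0r add0r.
rewrite H0; apply: (gauss_ode (is_derive_Ex_cos Z th)) => t tx.
apply: (le_trans (stein_quasi_linear t th b0 Ki Zi ZE)); apply: lerD.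
  by rewrite ler_wpM2r// Ex_ge0.
rewrite ler_wpM2r ?sumr_ge0// => [e _|].
  by rewrite mulr_ge0 ?vr_ge0// Ex_ge0// => c; exact: exprn_ge0.
rewrite ler_wpM2r// ler_wpM2l// -(real_normK (num_real t)) -(real_normK (num_real x)).
by apply: lerXn2r; rewrite ?nnegrE.
Qed.

End stein.

(** * From trigonometric functions to distribution functions *)

Section gaussian.
Context {R : realType}.
Local Notation mu := (@lebesgue_measure R).
Implicit Types x y t th : R.

(** The fundamental theorem on growing intervals, passed to the limit by dominated convergence. *)
Lemma Rintegral_derivative0 (F f : R -> R) :
  (forall x : R, is_derive x 1 F (f x)) -> continuous f ->
  mu.-integrable setT (EFin \o f) ->
  F n.+1%:R - F (- n.+1%:R) @[n --> \oo] --> (0 : R) ->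
  \int[mu]_x f x = 0.
Proof.
move=> Fd cf intf F0.
(* [n.+1] keeps the interval nondegenerate at n = 0, as the fundamental theorem requires. *)
pose D (n : nat) : set R := `[- n.+1%:R, n.+1%:R]%classic.
have mD n : measurable (D n) by exact: measurable_itv.
have mf : measurable_fun setT (EFin \o f) by have /integrableP[] := intf.
have cF : continuous F.
  by move=> x; have dx := Fd x; apply: differentiable_continuous; apply/derivable1_diffP.
have int_n n : (\int[mu]_x ((f \_ (D n)) x)%:E = (F n.+1%:R - F (- n.+1%:R))%:E)%E.
  transitivity (\int[mu]_(x in D n) (f x)%:E)%E.
    by rewrite [RHS]integral_mkcond /=; under [RHS]eq_integral do rewrite restrict_EFin.
  rewrite EFinB; apply: continuous_FTC2.
  - by rewrite -subr_gt0 opprK addr_gt0 ?ltr0n.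
  - exact: continuous_subspaceT.
  - split.
    + by move=> x _; have dx := Fd x; exact: ex_derive.
    + exact/cvg_at_right_filter/cF.
    + exact/cvg_at_left_filter/cF.
  - by move=> x _; have dx := Fd x; rewrite derive1E derive_val.
have H : (\int[mu]_x ((f \_ (D n)) x)%:E)%E @[n --> \oo] --> (\int[mu]_x (f x)%:E)%E.
  apply: (@dominated_cvg _ _ _ mu setT measurableT (fun n x => ((f \_ (D n)) x)%:E)
     (EFin \o f) (fun x => `|(f x)%:E|%E)).
  - move=> n; apply/measurable_EFinP/(measurable_restrictT _ (mD n)).
    by apply: measurable_funTS; exact/measurable_EFinP.
  - move=> x _; apply: cvg_near_cst.
    have [k /ltW xk] : exists k : nat, `|x| < k%:R by exists (Num.truncn `|x|).+1; exact:
      truncnS_gt.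
    exists k => // n /= kn; rewrite patchT// inE /D /= in_itv /= -ler_norml.
    by rewrite (le_trans xk)// ler_nat leqW.
  - by [].
  - exact: (integrable_abse intf).
  - move=> n x _; rewrite /patch; case: ifP => _ //=.
    by rewrite normr0 lee_fin.
have H' : (F n.+1%:R - F (- n.+1%:R))%:E @[n --> \oo] --> (\int[mu]_x (f x)%:E)%E.
  by move: H; under eq_fun do rewrite int_n.
rewrite /Rintegral; move/cvg_lim : H' => <-//.
have -> : limn (fun n => (F n.+1%:R - F (- n.+1%:R))%:E) = 0%:E.
  by apply/cvg_lim => //; apply: cvg_EFin => //; exact: nearW.
by [].
Qed.

Definition phi : R -> R := normal_pdf 0 1.

Lemma phiE x : phi x = normal_peak 1 * expR (- (x ^+ 2 / 2)).
Proof.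
rewrite /phi normal_pdfE ?oner_eq0// /normal_fun subr0 expr1n mulNr.
by [].
Qed.

Lemma phi_ge0 x : 0 <= phi x. Proof. exact: normal_pdf_ge0. Qed.

Lemma continuous_phi : continuous phi.
Proof. by apply: continuous_normal_pdf; exact: oner_neq0. Qed.

Lemma is_derive_phi x : is_derive x 1 phi (- (x * phi x)).
Proof.
have -> : phi = (fun x => normal_peak 1 * expR (- (x ^+ 2 / 2))).
  by apply/funext => y; exact: phiE.
have H1 : is_derive x 1 (fun t : R => - (t ^+ 2 / 2)) (- x).
  have := is_deriveZ (- 2^-1 : R) (is_deriveX 2 (is_derive_id x (1 : R))).
  rewrite (_ : - 2^-1 *: _ = - x); last by rewrite /GRing.scale /= expr1; field.
  congr is_derive; apply/funext => u /=.
  have E : - 2^-1 * u ^+ 2 = - (u ^+ 2 / 2) by ring.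
  exact: E.
have H2 := @is_derive1_comp _ expR (fun t : R => - (t ^+ 2 / 2)) x _ _ (is_derive_expR _) H1.
have := is_deriveZ (normal_peak 1 : R) H2.
by congr is_derive; rewrite /GRing.scale /=; ring.
Qed.

Lemma phi_le_inv x : 1 <= x -> phi x <= normal_peak 1 / x.
Proof.
move=> x1; rewrite phiE ler_wpM2l ?normal_peak_ge0// expRN.
rewrite lef_pV2 ?posrE ?expR_gt0//; last by lra.
apply: le_trans (expR_ge1Dx _); have := sqr_ge0 (x - 1); lra.
Qed.

Lemma phiN x : phi (- x) = phi x.
Proof. by rewrite !phiE sqrrN. Qed.

Lemma cvg_phi : phi n.+1%:R @[n --> \oo] --> (0 : R).
Proof.
apply: (@squeeze_cvgr _ _ _ _ (fun=> 0) (fun n => normal_peak 1 * harmonic n)).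
- apply: nearW => n; rewrite phi_ge0 /=.
  by apply: phi_le_inv; rewrite ler1n.
- exact: cvg_cst.
- by rewrite -(mulr0 (normal_peak 1)); apply: cvgM; [exact: cvg_cst|exact: cvg_harmonic].
Qed.

Lemma cvg_bounded_phi (h : R -> R) : (forall x, `|h x| <= 1) ->
  h n.+1%:R * phi n.+1%:R - h (- n.+1%:R) * phi (- n.+1%:R) @[n --> \oo] --> (0 : R).
Proof.
move=> h1; apply: norm_cvg0.
apply: (@squeeze_cvgr _ _ _ _ (fun=> 0) (fun n => phi n.+1%:R + phi n.+1%:R)).
- apply: nearW => n; rewrite normr_ge0 /= phiN.
  apply: (le_trans (ler_normB _ _)); apply: lerD;
    by rewrite normrM (ger0_norm (phi_ge0 _)) ler_piMl ?phi_ge0.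
- exact: cvg_cst.
- by rewrite -[X in _ --> X](addr0 (0 : R)); apply: cvgD; exact: cvg_phi.
Qed.

Lemma integrable_phi : mu.-integrable setT (EFin \o phi).
Proof. exact: integrable_normal_pdf. Qed.

Lemma Rintegral_phi : \int[mu]_x phi x = 1.
Proof. by rewrite /Rintegral integral_normal_pdf. Qed.

(** By symmetry the half-line suffices, where - phi is a primitive. *)
Lemma integrable_abs_phi : mu.-integrable setT (fun x => (`|x| * phi x)%:E).
Proof.
have cf : continuous (fun x : R => `|x| * phi x).
  by move=> x; apply: cvgM; [exact: norm_continuous|exact: continuous_phi].
have mf : measurable_fun setT (fun x : R => `|x| * phi x).
  exact: continuous_measurable_fun.
have f0 x : 0 <= `|x| * phi x by rewrite mulr_ge0 ?phi_ge0.
apply/integrableP; split; first exact/measurable_EFinP.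
under eq_integral do rewrite gee0_abs ?lee_fin//.
rewrite ge0_symfun_integralT//; last by move=> x /=; rewrite normrN phiN.
rewrite -set_itvcy.
rewrite (@ge0_continuous_FTC2y _ _ (fun x => - phi x) 0 0).
- by rewrite -EFinB -EFinM ltry.
- by [].
- exact: continuous_subspaceT.
- rewrite -oppr0; apply: cvgN.
  apply: (@squeeze_cvgr _ _ _ _ (fun=> 0) (fun x => normal_peak 1 * x^-1)).
  + near=> x; rewrite phi_ge0 /=; apply: phi_le_inv.
    by near: x; apply: nbhs_pinfty_ge; exact: num_real.
  + exact: cvg_cst.
  + rewrite -(mulr0 (normal_peak 1)); apply: cvgM; first exact: cvg_cst.
    apply/gtr0_cvgV0; last exact: cvg_id.
    by apply: nbhs_pinfty_gt; exact: num_real.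
- by move=> x _; have dx := is_derive_phi x; apply: derivableN; exact: ex_derive.
- by apply: cvg_at_right_filter; apply: cvgN; exact: continuous_phi.
- move=> x; rewrite in_itv /= andbT => x0.
  have dx := is_deriveN (is_derive_phi x).
  by rewrite derive1E derive_val opprK gtr0_norm.
Unshelve. all: by end_near. Qed.


Definition gint (f : R -> R) : R := \int[mu]_x (f x * phi x).

(** One class for all the integrands that occur: cosines, x times a sine, indicators of rays and the
    weight 1 + |x|. *)
Definition linear_growth (f : R -> R) : Prop :=
  measurable_fun setT f /\ exists C : R, forall x, `|f x| <= C * (1 + `|x|).

Lemma integrable_gint f : linear_growth f ->
  mu.-integrable setT (EFin \o (fun x => f x * phi x)).
Proof.
move=> [mf [C fC]].
have C0 : 0 <= C by have := le_trans (normr_ge0 _) (fC 0); rewrite normr0 addr0 mulr1.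
have H : mu.-integrable setT (fun x => (C%:E * ((phi x)%:E + (`|x| * phi x)%:E))%E).
  apply: integrableZl => //; apply: integrableD => //; first exact: integrable_phi.
  exact: integrable_abs_phi.
apply: (le_integrable measurableT) H.
  apply/measurable_EFinP/measurable_funM => //.
  exact: measurable_normal_pdf.
move=> x _; rewrite /comp -EFinD -EFinM !abse_EFin lee_fin.
rewrite [leLHS]normrM (ger0_norm (phi_ge0 x)).
rewrite (_ : C * _ = C * (1 + `|x|) * phi x); last by ring.
rewrite [leRHS]normrM (ger0_norm (phi_ge0 x)); apply: ler_wpM2r; first exact: phi_ge0.
exact: le_trans (ler_norm _).
Qed.

Lemma gintD f g : linear_growth f -> linear_growth g ->
  gint (fun x => f x + g x) = gint f + gint g.
Proof.
move=> Hf Hg; rewrite /gint -RintegralD//; [|exact: integrable_gint..].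
by apply: eq_Rintegral => x _; rewrite mulrDl.
Qed.

Lemma gintZ k f : linear_growth f -> gint (fun x => k * f x) = k * gint f.
Proof.
move=> Hf; rewrite /gint -RintegralZl//; last exact: integrable_gint.
by apply: eq_Rintegral => x _; rewrite mulrA.
Qed.

Lemma ler_gint f g : linear_growth f -> linear_growth g ->
  (forall x, f x <= g x) -> gint f <= gint g.
Proof.
move=> Hf Hg fg; apply: le_Rintegral => //; [exact: integrable_gint..|].
by move=> x _; rewrite ler_wpM2r ?phi_ge0.
Qed.

Lemma linear_growth_bounded (f : R -> R) (M : R) : measurable_fun setT f ->
  (forall x, `|f x| <= M) -> linear_growth f.
Proof.
move=> mf fM; split => //; exists M => x; rewrite (le_trans (fM x))//.
by rewrite ler_peMr ?lerDl// (le_trans _ (fM 0)).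
Qed.

Lemma continuous_affine t th : continuous (fun x : R => t * x + th).
Proof.
by move=> x; apply: cvgD; [apply: cvgM; [exact: cvg_cst|exact: cvg_id]|exact: cvg_cst].
Qed.

Lemma measurable_cos_affine t th : measurable_fun setT (fun x : R => cos (t * x + th)).
Proof.
apply: continuous_measurable_fun => x.
apply: (@continuous_comp _ _ _ (fun x : R => t * x + th) cos).
  exact: continuous_affine.
exact: continuous_cos.
Qed.

Lemma linear_growth_cos t th : linear_growth (fun x => cos (t * x + th)).
Proof.
apply: (@linear_growth_bounded _ 1); first exact: measurable_cos_affine.
by move=> x; exact: cos_max.
Qed.

Lemma sin_cos_shift x : sin x = cos (x - pi / 2).
Proof. by rewrite cosBpihalf. Qed.

Lemma linear_growth_xsin t th : linear_growth (fun x => x * sin (t * x + th)).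
Proof.
split.
  apply: measurable_funM => //.
  under eq_fun do rewrite sin_cos_shift -addrA.
  exact: measurable_cos_affine.
exists 1 => x; rewrite mul1r normrM.
by have := sin_max (t * x + th); have := normr_ge0 x; nra.
Qed.

Lemma is_derive_affine t th x : is_derive x 1 (fun x : R => t * x + th) t.
Proof.
have := is_deriveD (is_deriveZ t (is_derive_id x (1 : R))) (is_derive_cst th x (1 : R)).
by rewrite addr0 [_ *: 1]mulr1.
Qed.

(** Integration by parts: sin(tx + th) phi(x) vanishes at infinity, and phi' = - x phi. *)
Lemma gint_stein t th :
  gint (fun x => x * sin (t * x + th)) = t * gint (fun x => cos (t * x + th)).
Proof.
have lc := linear_growth_cos t th; have ls := linear_growth_xsin t th.
pose f x := (t * cos (t * x + th) - x * sin (t * x + th)) * phi x.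
have ltc : linear_growth (fun x => t * cos (t * x + th)).
  apply: (@linear_growth_bounded _ `|t|).
    by apply: measurable_funM => //; exact: measurable_cos_affine.
  by move=> x; rewrite normrM ler_piMr// cos_max.
have lms : linear_growth (fun x => -1 * (x * sin (t * x + th))).
  split; first by apply: measurable_funM => //; exact: ls.1.
  by have [C HC] := ls.2; exists C => x; rewrite mulN1r normrN.
have : \int[mu]_x f x = 0.
  apply: (@Rintegral_derivative0 (fun x => sin (t * x + th) * phi x)).
  - move=> x.
    have H1 := @is_derive1_comp _ sin (fun x : R => t * x + th) x _ _
      (is_derive_sin _) (is_derive_affine t th x).
    have := is_deriveM H1 (is_derive_phi x).
    rewrite (_ : _ *: _ + _ = f x)//.
    by rewrite /f /GRing.scale /=; ring.
  - move=> x; have ca : {for x, continuous (fun x : R => t * x + th)}.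
      exact: continuous_affine.
    apply: cvgM; last exact: continuous_phi.
    apply: cvgB.
      apply: cvgM; first exact: cvg_cst.
      by apply: (@continuous_comp _ _ _ _ cos _ ca); exact: continuous_cos.
    apply: cvgM; first exact: cvg_id.
    by apply: (@continuous_comp _ _ _ _ sin _ ca); exact: continuous_sin.
  - have H : linear_growth (fun x => t * cos (t * x + th) + -1 * (x * sin (t * x + th))).
      split; first by apply: measurable_funD; [exact: ltc.1|exact: lms.1].
      have [C1 H1] := ltc.2; have [C2 H2] := lms.2; exists (C1 + C2) => x.
      by rewrite (le_trans (ler_normD _ _))// mulrDl lerD.
    have := integrable_gint H; congr integrable; apply/funext => x /=.
    by rewrite /f mulN1r.
  - apply: (@cvg_bounded_phi (fun x => sin (t * x + th))) => x; exact: sin_max.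
have -> : \int[mu]_x f x = gint (fun x => t * cos (t * x + th) + -1 * (x * sin (t * x + th))).
  by apply: eq_Rintegral => x _; rewrite /f mulN1r.
rewrite gintD// gintZ// gintZ// => H; lra.
Qed.

Lemma is_derive_gint_cos t th :
  is_derive t 1 (fun t => gint (fun x => cos (t * x + th)))
    (- gint (fun x => x * sin (t * x + th))).
Proof.
pose f (s x : R) := cos (s * x + th) * phi x.
have fd (s x : R) : is_derive s 1 (f ^~ x) (- (x * sin (s * x + th)) * phi x).
  have H0 : is_derive s 1 (fun s : R => s * x + th) x.
    have := is_derive_affine x th s; congr is_derive.
    by apply/funext => u; rewrite mulrC.
  have H1 := @is_derive1_comp _ cos (fun s : R => s * x + th) s _ _ (is_derive_cos _) H0.
  have := is_deriveZ (phi x) H1; rewrite (_ : _ *: _ = - (x * sin (s * x + th)) * phi x).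
    by congr is_derive; apply/funext => u /=; rewrite [LHS]mulrC.
  by rewrite /GRing.scale /=; ring.
have d1f (s x : R) : partial1of2 f s x = - (x * sin (s * x + th)) * phi x.
  by have dx := fd s x; rewrite partial1of2E derive_val.
have It : `]t - 1, t + 1[%classic t by rewrite /= in_itv /=; apply/andP; split; lra.
have If s : mu.-integrable setT (EFin \o f s).
  exact: (integrable_gint (linear_growth_cos s th)).
have D1 (s x : R) : derivable (f ^~ x) s 1.
  by have dx := fd s x; exact: ex_derive.
have G0 (x : R) : 0 <= `|x| * phi x by rewrite mulr_ge0 ?phi_ge0.
have Gub (s x : R) : `|partial1of2 f s x| <= `|x| * phi x.
  rewrite d1f normrM normrN (ger0_norm (phi_ge0 _)) ler_wpM2r ?phi_ge0//.
  by rewrite normrM ler_piMr// sin_max.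
have A := @derivable_under_integral R _ _ mu f setT measurableT t (t - 1) (t + 1) It
   (fun s _ => If s) (fun s x _ _ => D1 s x) _ G0 integrable_abs_phi
   (fun s x _ _ => Gub s x).
have B := @differentiation_under_integral R _ _ mu f setT measurableT t (t - 1) (t + 1) It
   (fun s _ => If s) (fun s x _ _ => D1 s x) _ G0 integrable_abs_phi
   (fun s x _ _ => Gub s x).
apply: DeriveDef; first exact: A.
rewrite -derive1E; apply: (eq_trans B).
rewrite -mulN1r -gintZ; last exact: linear_growth_xsin.
by apply: eq_Rintegral => x _; rewrite d1f mulN1r.
Qed.

(** The normal law satisfies Stein's identity exactly, so [gauss_ode] applies with error 0. *)
Lemma gint_cos t th :
  gint (fun x => cos (t * x + th)) = expR (- (t ^+ 2 / 2)) * cos th.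
Proof.
have := @gauss_ode R (fun t => gint (fun x => cos (t * x + th)))
  (fun t => gint (fun x => x * sin (t * x + th))) t 0 (fun s => is_derive_gint_cos s th).
rewrite mul0r => /(_ (fun s _ => _)) H.
have {H} : `|gint (fun x => cos (t * x + th)) -
   expR (- (t ^+ 2 / 2)) * gint (fun x => cos (0 * x + th))| <= 0.
  by apply: H => s; rewrite gint_stein subrr normr0.
rewrite normr_le0 subr_eq0 => /eqP ->; congr (_ * _).
rewrite -[RHS]mulr1 -Rintegral_phi -RintegralZl//; last exact: integrable_phi.
by apply: eq_Rintegral => x _; rewrite mul0r add0r.
Qed.

End gaussian.

(** * Approximation of rays by trigonometric polynomials *)

Section trigonometric_polynomials.
Context {R : realType}.
Implicit Types (f g : R -> R) (x y a b t th : R).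

(** Generated by multiplication with a cosine rather than as a span of cosines: powers of a sine
    wave then belong to it by plain induction, and products are turned into sums only in
    [trigpoly_cvg]. *)
Inductive trigpoly : (R -> R) -> Prop :=
| TrigOne : trigpoly (fun=> 1)
| TrigComb a b f g : trigpoly f -> trigpoly g ->
    trigpoly (fun y => a * f y + b * g y)
| TrigCos a b f : trigpoly f -> trigpoly (fun y => cos (a * y + b) * f y).

Definition sine_wave k a y : R := (1 + sin (k * (y - a))) / 2.

Lemma sine_waveE k a y : sine_wave k a y =
  2^-1 * 1 + 2^-1 * cos (k * y + (- (k * a) - pi / 2)).
Proof.
by rewrite /sine_wave sin_cos_shift mulrBr addrA; field.
Qed.

Lemma trigpoly_sine_wave k a f : trigpoly f ->
  trigpoly (fun y => sine_wave k a y * f y).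
Proof.
move=> Hf; have := TrigComb 2^-1 2^-1 Hf (TrigCos k (- (k * a) - pi / 2) Hf).
congr trigpoly; apply/funext => y; rewrite sine_waveE; ring.
Qed.

Lemma trigpoly_bernoulli k a (m j : nat) :
  trigpoly (fun y => (1 - sine_wave k a y ^+ m) ^+ j).
Proof.
have pow f : trigpoly f -> trigpoly (fun y => sine_wave k a y ^+ m * f y).
  elim: m f => [|m IH] f Hf.
    by move: Hf; congr trigpoly; apply/funext => y; rewrite expr0 mul1r.
  have := IH _ (trigpoly_sine_wave k a Hf).
  by congr trigpoly; apply/funext => y; rewrite exprSr mulrA.
elim: j => [|j IH]; first by move: TrigOne; congr trigpoly.
have := TrigComb 1 (-1) IH (pow _ IH); congr trigpoly; apply/funext => y.
by rewrite exprS; ring.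
Qed.

Lemma bernoulli_ge (x : R) (n : nat) : -1 <= x -> 1 + n%:R * x <= (1 + x) ^+ n.
Proof.
move=> x1; elim: n => [|n IH]; first by rewrite mul0r addr0 expr0.
have x0 : 0 <= 1 + x by lra.
rewrite exprS (le_trans _ (ler_wpM2l x0 IH))// -natr1.
have : 0 <= n%:R * x ^+ 2 by rewrite mulr_ge0 ?sqr_ge0.
by lra.
Qed.

(** Bernoulli's inequality. The exponent 2^k puts the threshold at u = 1/2, since 2^k u^k = (2u)^k;
    such polynomials serve in the Brosowski-Deutsch proof of the Stone-Weierstrass theorem. *)
Lemma bernoulli_step_near0 (u : R) (k : nat) : 0 <= u <= 1 ->
  1 - (2 * u) ^+ k <= (1 - u ^+ k) ^+ (2 ^ k).
Proof.
move=> /andP[u0 u1]; have uk0 : 0 <= u ^+ k by exact: exprn_ge0.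
have uk1 : u ^+ k <= 1 by exact: exprn_ile1.
apply: le_trans (bernoulli_ge _ _); last by lra.
by rewrite natrX exprMn mulrN.
Qed.

(** Bernoulli's inequality bounds (2u)^k by the power 2^k of 1 + u^k, and (1 - u^k)(1 + u^k) <=
    1. *)
Lemma bernoulli_step_near1 (u : R) (k : nat) : 0 <= u <= 1 ->
  (1 - u ^+ k) ^+ (2 ^ k) * (2 * u) ^+ k <= 1.
Proof.
move=> /andP[u0 u1]; have uk0 : 0 <= u ^+ k by exact: exprn_ge0.
have uk1 : u ^+ k <= 1 by exact: exprn_ile1.
apply: (@le_trans _ _ ((1 - u ^+ k) ^+ (2 ^ k) * (1 + u ^+ k) ^+ (2 ^ k))).
  rewrite ler_wpM2l ?exprn_ge0 ?subr_ge0//.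
  apply: le_trans (bernoulli_ge _ _); last by lra.
  by rewrite natrX exprMn lerDr.
rewrite -exprMn exprn_ile1//; nra.
Qed.

Lemma exists_expr_ge (x M : R) : 0 < x -> exists k : nat, M <= (1 + x) ^+ k.
Proof.
move=> x0; exists (Num.truncn `|M / x|).+1.
apply: le_trans (bernoulli_ge _ _); last by lra.
have : M / x <= (Num.truncn `|M / x|).+1%:R.
  by rewrite (le_trans (ler_norm _))// ltW// truncnS_gt.
rewrite ler_pdivrMr//; lra.
Qed.

(* With u = sine_wave k a for a small frequency k, (1 - u ^+ j) ^+ (2 ^ j) is close
   to 1 where u < 1/2, that is left of a, and close to 0 where u > 1/2; this fails only
   beyond a half period, where the weight e * (1 + `|y|) exceeds 1. *)
Lemma approx_step a (delta e : R) : 0 < delta -> 0 < e ->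
  exists2 f, trigpoly f & forall y,
  (y <= a - delta)%R%:R <= f y + e * (1 + `|y|) /\
  f y <= (y <= a + delta)%R%:R + e * (1 + `|y|).
Proof.
move=> d0 e0.
(* At distance more than L from a the weight e (1 + |y|) is at least 1, and nothing has to be proved
   there. *)
pose L := (1 + `|a|) / e + delta.
have a0 := normr_ge0 a.
have q0 : 0 < (1 + `|a|) / e by rewrite divr_gt0//; lra.
have L0 : 0 < L by rewrite /L; lra.
have dL : delta < L by rewrite /L; lra.
(* The window of radius L around a becomes one half period, on which the sine increases. *)
pose k := pi / 2 / L.
have pi0 := pi_gt0 R.
have k0 : 0 < k by rewrite !divr_gt0.
have kL : k * L = pi / 2 by rewrite /k; field; rewrite gt_eqF.
pose eta := sin (k * delta).
have kd : k * delta < pi / 2 by rewrite -kL ltr_pM2l.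
have kd0 : 0 < k * delta by rewrite mulr_gt0.
have eta0 : 0 < eta by apply: sin_gt0_pihalf; rewrite kd0 kd.
have eta1 : eta <= 1 by exact: sin_le1.
have [j Hj] := exists_expr_ge e^-1 eta0.
have ej : ((1 + eta) ^+ j)^-1 <= e.
  by rewrite -[leRHS]invrK lef_pV2 ?posrE ?invr_gt0// exprn_gt0//; lra.
exists (fun y => (1 - sine_wave k a y ^+ j) ^+ (2 ^ j)); first exact: trigpoly_bernoulli.
move=> y; set u := sine_wave k a y.
have u01 : 0 <= u <= 1.
  have := sin_geN1 (k * (y - a)); have := sin_le1 (k * (y - a)).
  by rewrite /u /sine_wave => ? ?; apply/andP; split; lra.
have /andP[u0 u1] := u01.
have uj : 0 <= u ^+ j <= 1 by rewrite exprn_ge0// exprn_ile1.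
have /andP[uj0 uj1] := uj.
set f := _ ^+ (2 ^ j).
have f0 : 0 <= f by rewrite exprn_ge0// subr_ge0.
have f1 : f <= 1 by rewrite exprn_ile1 ?subr_ge0// lerBlDr lerDl.
have y0 := normr_ge0 y.
have eE : e <= e * (1 + `|y|) by rewrite ler_peMr// ?lerDl// ltW.
have [far|near] := ltP L `|y - a|.
  have big : 1 <= e * (1 + `|y|).
    have : `|y - a| <= `|y| + `|a| by exact: ler_normB.
    have : (1 + `|a|) <= e * L.
      by rewrite /L mulrDr mulrC divfK ?gt_eqF// lerDl mulr_ge0// ltW.
    move=> H1 H2.
    have : e * L <= e * (`|y| + `|a|) by rewrite ler_wpM2l ?(ltW e0)//; lra.
    move=> H3; have H4 : 1 + `|a| <= e * (`|y| + `|a|) by lra.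
    nra.
  have b1 (b : bool) : 0 <= (b%:R : R) <= 1 by case: b; rewrite /= ?lexx ler01.
  have /andP[? ?] := b1 (y <= a - delta); have /andP[? ?] := b1 (y <= a + delta).
  split; lra.
move: near; rewrite ler_norml => /andP[n1 n2].
have w1 : - (pi / 2) <= k * (y - a) by rewrite -kL -mulrN ler_pM2l.
have w2 : k * (y - a) <= pi / 2 by rewrite -kL ler_pM2l.
have win : k * (y - a) \in `[- (pi / 2), pi / 2] by rewrite in_itv /= w1 w2.
have din : k * delta \in `[- (pi / 2), pi / 2].
  by rewrite in_itv /=; apply/andP; split; lra.
have ndin : - (k * delta) \in `[- (pi / 2), pi / 2].
  by rewrite in_itv /=; apply/andP; split; lra.
have uE : u = (1 + sin (k * (y - a))) / 2 by [].
split.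
- have [yd|_] /= := leP y (a - delta); last by rewrite addr_ge0// mulr_ge0 ?ltW// addr_gt0.
  have kk : k * (y - a) <= - (k * delta) by rewrite -mulrN ler_pM2l//; lra.
  have : sin (k * (y - a)) <= - eta.
    by rewrite /eta -sinN leNgt ltr_sin// -leNgt.
  move=> su; have u2 : 2 * u <= 1 - eta by rewrite uE; lra.
  have := bernoulli_step_near0 j u01; rewrite -/f.
  have : (2 * u) ^+ j <= e.
    (* The choice of [j] controls the inverse power of 1 + eta; it also controls the power of 1 -
       eta because (1 - eta)(1 + eta) <= 1. *)
    apply: le_trans ej; apply: (@le_trans _ _ ((1 - eta) ^+ j)).
      by apply: lerXn2r; rewrite ?nnegrE ?mulr_ge0//; lra.
    have e1 : 0 < (1 + eta) ^+ j by rewrite exprn_gt0//; lra.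
    rewrite -[leRHS]mul1r ler_pdivlMr// -exprMn exprn_ile1//; nra.
  lra.
- have [yd|yd] /= := leP y (a + delta).
    by rewrite (le_trans f1)// lerDl mulr_ge0 ?addr_ge0// ltW.
  have kk : k * delta <= k * (y - a) by rewrite ler_pM2l//; lra.
  have su : eta <= sin (k * (y - a)) by rewrite /eta leNgt ltr_sin// -leNgt.
  have u2 : 1 + eta <= 2 * u by rewrite uE; lra.
  rewrite add0r (le_trans _ eE)// (le_trans _ ej)//.
  have e1 : 0 < (1 + eta) ^+ j by rewrite exprn_gt0//; lra.
  rewrite -[leRHS]mul1r ler_pdivlMr//.
  apply: le_trans (bernoulli_step_near1 j u01); rewrite -/f ler_wpM2l//.
  by apply: lerXn2r; rewrite ?nnegrE ?mulr_ge0//; lra.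
Qed.

End trigonometric_polynomials.

(** * Convergence of distribution functions from convergence on cosines *)

Section distribution_convergence.
Context {R : realType}.
Variable L : nat -> (R -> R) -> R.
Hypothesis L_lin : forall n a b f g,
  L n (fun y => a * f y + b * g y) = a * L n f + b * L n g.
Hypothesis L_mono : forall n f g, (forall y, f y <= g y) -> L n f <= L n g.
Hypothesis L_one : forall n, L n (fun=> 1) = 1.
Hypothesis L_cos : forall t th, L n (fun y => cos (t * y + th)) @[n --> \oo] -->
  expR (- (t ^+ 2 / 2)) * cos th.

(** The additional factor cos(ty + th) makes the induction work: a new cosine is merged with it by
    the product-to-sum formula. *)
Lemma trigpoly_cvg f : trigpoly f ->
  [/\ measurable_fun setT f, exists M, forall y, `|f y| <= M &
    forall t th, L n (fun y => f y * cos (t * y + th)) @[n --> \oo] -->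
      gint (fun y => f y * cos (t * y + th))].
Proof.
elim => [|a b {}f g Hf [mf [M fM] cf] Hg [mg [M' gM'] cg]|a b {}f Hf [mf [M fM] cf]].
- split; [exact: measurable_cst|by exists 1 => y; rewrite normr1|move=> t th].
  have E : (fun y => 1 * cos (t * y + th)) = (fun y => cos (t * y + th)).
    by apply/funext => y; rewrite mul1r.
  by rewrite E gint_cos; exact: L_cos.
- split.
  + by apply: measurable_funD; apply: measurable_funM.
  + exists (`|a| * M + `|b| * M') => y.
    rewrite (le_trans (ler_normD _ _))// !normrM lerD// ler_wpM2l//.
  + move=> t th.
    have E : (fun y => (a * f y + b * g y) * cos (t * y + th)) =
       (fun y => a * (f y * cos (t * y + th)) + b * (g y * cos (t * y + th))).
      by apply/funext => y; ring.
    have lgf (h : R -> R) (N c : R) : measurable_fun setT h -> (forall y, `|h y| <= N) ->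
        linear_growth (fun y => c * (h y * cos (t * y + th))).
      move=> mh hN; apply: (@linear_growth_bounded _ _ (`|c| * (N * 1))).
        by apply: measurable_funM => //; apply: measurable_funM => //; exact: measurable_cos_affine.
      move=> y; rewrite !normrM ler_wpM2l// ler_pM//; exact: cos_max.
    have lgf' (h : R -> R) (N : R) : measurable_fun setT h -> (forall y, `|h y| <= N) ->
        linear_growth (fun y => h y * cos (t * y + th)).
      move=> mh hN; have := lgf h N 1 mh hN.
      by congr linear_growth; apply/funext => y; rewrite mul1r.
    rewrite E gintD; [|exact: lgf fM|exact: lgf gM'].
    rewrite !gintZ; [|exact: lgf' gM'|exact: lgf' fM].
    under eq_fun do rewrite L_lin.
    by apply: cvgD; (apply: cvgM; first exact: cvg_cst); [exact: cf|exact: cg].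
- split.
  + by apply: measurable_funM => //; exact: measurable_cos_affine.
  + exists (1 * M) => y; rewrite normrM ler_pM//; exact: cos_max.
  + move=> t th.
    have E : (fun y => cos (a * y + b) * f y * cos (t * y + th)) =
       (fun y => 2^-1 * (f y * cos ((a + t) * y + (b + th))) +
                 2^-1 * (f y * cos ((a - t) * y + (b - th)))).
      apply/funext => y.
      have -> : (a + t) * y + (b + th) = (a * y + b) + (t * y + th) by ring.
      have -> : (a - t) * y + (b - th) = (a * y + b) - (t * y + th) by ring.
      by rewrite (cosD (a * y + b)) (cosB (a * y + b)); field.
    have lgf s ph (c : R) : linear_growth (fun y => c * (f y * cos (s * y + ph))).
      apply: (@linear_growth_bounded _ _ (`|c| * (M * 1))).
        by apply: measurable_funM => //; apply: measurable_funM => //; exact: measurable_cos_affine.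
      move=> y; rewrite !normrM ler_wpM2l// ler_pM//; exact: cos_max.
    have lgf' s ph : linear_growth (fun y => f y * cos (s * y + ph)).
      have := lgf s ph 1.
      by congr linear_growth; apply/funext => y; rewrite mul1r.
    rewrite E gintD// !gintZ//.
    under eq_fun do rewrite L_lin.
    by apply: cvgD; (apply: cvgM; first exact: cvg_cst); exact: cf.
Qed.

Lemma trigpoly_cvg1 f : trigpoly f -> linear_growth f /\ L n f @[n --> \oo] --> gint f.
Proof.
move=> /trigpoly_cvg[mf [M fM] cf]; split; first exact: linear_growth_bounded fM.
have := cf 0 0; have -> // : (fun y => f y * cos (0 * y + 0)) = f.
by apply/funext => y; rewrite mul0r addr0 cos0 mulr1.
Qed.

Definition Phi x : R := gint (fun y => (y <= x)%R%:R).

Lemma linear_growth_step x : linear_growth (fun y : R => (y <= x)%R%:R).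
Proof.
apply: (@linear_growth_bounded _ _ 1); last first.
  by move=> y; case: (y <= x); rewrite /= ?normr1 ?normr0 ?ler01.
have -> : (fun y : R => (y <= x)%R%:R : R) = (fun y => if y <= x then 1 else 0).
  by apply/funext => y; case: (y <= x).
apply: measurable_fun_ifT => //.
exact: measurable_fun_ler.
Qed.

Lemma linear_growth_abs : linear_growth (fun y : R => 1 + `|y|).
Proof.
split; last by exists 1 => y; rewrite mul1r ger0_norm// addr_ge0.
by apply: measurable_funD => //; exact: measurableT_comp.
Qed.

(** The indicator is squeezed between approximate steps centred at x - delta and x + delta; the
    weights that remain are controlled by the first absolute moments. *)
Lemma cvg_distribution_function (C x : R) :
  (\forall n \near \oo, L n (fun y => `|y|) <= C) ->
  {for x, continuous Phi} ->
  L n (fun y => (y <= x)%R%:R) @[n --> \oo] --> Phi x.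
Proof.
move=> LC cPhi; apply/cvgrPdist_le => eps eps0.
pose C' := gint (fun y : R => 1 + `|y|).
have C'0 : 0 <= C'.
  by apply: Rintegral_ge0 => y _; rewrite mulr_ge0 ?phi_ge0// addr_ge0.
(* Makes the weight cost at most eps / 8, both under [L n] and under the normal law. *)
pose e := eps / (8 * (1 + `|C| + C')).
have den0 : 0 < 8 * (1 + `|C| + C') by rewrite mulr_gt0// ltr_wpDr// ltr_wpDr.
have e0 : 0 < e by rewrite divr_gt0.
have eC : e * (1 + `|C|) <= eps / 8.
  rewrite /e -mulrA ler_wpM2l ?(ltW eps0)// mulrC ler_pdivrMr//; lra.
have eC' : e * C' <= eps / 8.
  rewrite /e -mulrA ler_wpM2l ?(ltW eps0)// mulrC ler_pdivrMr//.
  by have := normr_ge0 C; lra.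
have /cvgrPdist_le /(_ (eps / 4)) := cPhi.
rewrite divr_gt0// => /(_ isT) [d0 /= d00 Hd].
(* The shift of the centre and the width of the transition together move x by d0 / 2, within the
   range of continuity. *)
pose delta := d0 / 4.
have delta0 : 0 < delta by rewrite divr_gt0.
have near_x y : `|x - y| < d0 -> `|Phi x - Phi y| <= eps / 4 by move=> H; exact: Hd.
have [fp tp Hp] := approx_step (x + delta) delta0 e0.
have [fm tm Hm] := approx_step (x - delta) delta0 e0.
have [lgp cp] := trigpoly_cvg1 tp.
have [lgm cm] := trigpoly_cvg1 tm.
have lge : linear_growth (fun y : R => e * (1 + `|y|)).
  have [m [D HD]] := linear_growth_abs; split; first exact: measurable_funM.
  by exists (e * D) => y; rewrite [leLHS]normrM (gtr0_norm e0) -[leRHS]mulrA ler_wpM2l// ltW.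
have lgD (f g : R -> R) : linear_growth f -> linear_growth g ->
    linear_growth (fun y => f y + g y).
  move=> [mf [D1 H1]] [mg [D2 H2]]; split; first exact: measurable_funD.
  by exists (D1 + D2) => y; rewrite (le_trans (ler_normD _ _))// mulrDl lerD.
have gp : gint fp <= Phi (x + delta + delta) + eps / 8.
  apply: (@le_trans _ _ (gint (fun y => (y <= x + delta + delta)%R%:R + e * (1 + `|y|)))).
    apply: ler_gint => //; first by apply: lgD => //; exact: linear_growth_step.
    by move=> y; have [] := Hp y.
  rewrite gintD//; last exact: linear_growth_step.
  by rewrite gintZ ?lerD2l//; exact: linear_growth_abs.
have gm : Phi (x - delta - delta) <= gint fm + eps / 8.
  apply: (@le_trans _ _ (gint (fun y => fm y + e * (1 + `|y|)))).
    apply: ler_gint => //; [exact: linear_growth_step|exact: lgD|].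
    by move=> y; have [] := Hm y.
  by rewrite gintD// gintZ ?lerD2l//; exact: linear_growth_abs.
have P1 := near_x (x + delta + delta).
have P2 := near_x (x - delta - delta).
have {}P1 : `|Phi x - Phi (x + delta + delta)| <= eps / 4.
  apply: P1; rewrite (_ : x - _ = - (d0 / 2)); last by rewrite /delta; field.
  by rewrite normrN gtr0_norm ?divr_gt0//; lra.
have {}P2 : `|Phi x - Phi (x - delta - delta)| <= eps / 4.
  apply: P2; rewrite (_ : x - _ = d0 / 2); last by rewrite /delta; field.
  by rewrite gtr0_norm ?divr_gt0//; lra.
have e8 : 0 < eps / 8 by rewrite divr_gt0.
move/cvgrPdist_le : cp => /(_ _ e8) cp; move/cvgrPdist_le : cm => /(_ _ e8) cm.
near=> n.
have LCn : L n (fun y => `|y|) <= C by near: n.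
have cpn : `|gint fp - L n fp| <= eps / 8 by near: n.
have cmn : `|gint fm - L n fm| <= eps / 8 by near: n.
have LE : L n (fun y => 1 * 1 + 1 * `|y|) <= 1 + `|C|.
  by rewrite L_lin L_one !mul1r lerD2l (le_trans LCn)// ler_norm.
have eL : e * L n (fun y => 1 * 1 + 1 * `|y|) <= eps / 8.
  by apply: le_trans eC; rewrite ler_pM2l.
have up : L n (fun y => (y <= x)%R%:R) <= 1 * L n fp + e * L n (fun y => 1 * 1 + 1 * `|y|).
  rewrite -L_lin; apply: L_mono => y; have [+ _] := Hp y.
  by rewrite addrK !mul1r.
have down : L n fm <= 1 * L n (fun y => (y <= x)%R%:R) + e * L n (fun y => 1 * 1 + 1 * `|y|).
  rewrite -L_lin; apply: L_mono => y; have [_ +] := Hm y.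
  by rewrite subrK !mul1r.
move: P1 P2 cpn cmn; rewrite !ler_norml => /andP[? ?] /andP[? ?] /andP[? ?] /andP[? ?].
apply/andP; split; lra.
Unshelve. all: by end_near. Qed.

End distribution_convergence.

(** * The random graph as a random configuration *)

Section transfer.
Context d (T : measurableType d) (R : realType) (P : probability T R)
  (n : nat) (p : R) (A : 'I_n -> 'I_n -> {RV P >-> bool}).
Hypothesis p01 : 0 <= p <= 1.
Hypothesis erA : erdos_renyi P p A.
Local Notation config := {ffun 'I_n * 'I_n -> bool}.

(** Clearing the bits on and below the diagonal agrees with their probability 0 in [upper_prob], so
    that the law is the product weight. *)
Definition config_of (w : T) : config :=
  [ffun e : 'I_n * 'I_n => (e.1 < e.2)%N && A e.1 e.2 w].

Lemma adj_config_of w : adj (config_of w) = (fun i j => A i j w).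
Proof.
have [sA iA _ _] := erA.
apply/funext => i; apply/funext => j; rewrite /adj /edge ffunE.
have [->|ij] /= := eqVneq i j; first by rewrite iA.
case: (ltngtP i j) => [ij'|ji|/ord_inj eij] /=; first by rewrite ij'.
  by rewrite ji.
by rewrite eij eqxx in ij.
Qed.

Lemma randic_config_of (tau : R) w :
  randic tau A w = randic_index tau (adj (config_of w)).
Proof. by rewrite adj_config_of. Qed.

Lemma config_of_preimage (c : config) : (forall e : 'I_n * 'I_n, ~~ (e.1 < e.2)%N -> c e = false) ->
  config_of @^-1` [set c] =
  \bigcap_(e in [set` [set e : 'I_n * 'I_n | (e.1 < e.2)%N]%SET])
     A e.1 e.2 @^-1` [set c e].
Proof.
move=> cl; apply/seteqP; split => w /=.
  by move=> <- e /=; rewrite inE => e12; rewrite /config_of ffunE e12.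
move=> H; apply/ffunP => e; rewrite ffunE.
have [e12|e12] := boolP (e.1 < e.2)%N; last by rewrite cl.
by rewrite (H e)//= inE.
Qed.

Lemma measurable_config_of (c : config) : measurable (config_of @^-1` [set c]).
Proof.
have [cl|] := pselect (forall e : 'I_n * 'I_n, ~~ (e.1 < e.2)%N -> c e = false).
  rewrite config_of_preimage//; apply: fin_bigcap_measurable.
    exact: finite_finset.
  move=> e _; rewrite -[X in measurable X]setTI; exact: measurable_funP.
move=> /existsNP[e /not_implyP[e12 ce]].
rewrite (_ : _ @^-1` _ = set0); first exact: measurable0.
apply/seteqP; split => // w /= wc; apply: ce; rewrite -wc ffunE.
by rewrite (negbTE e12).
Qed.

Lemma P_edge (e : 'I_n * 'I_n) (b : bool) : (e.1 < e.2)%N ->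
  P (A e.1 e.2 @^-1` [set b]) = (if b then p else 1 - p)%:E.
Proof.
move=> e12; have [_ _ bA _] := erA.
apply: (eq_trans (bA _ _ e12 [set b])).
by rewrite /bernoulli_prob p01 fsbig_set1.
Qed.

(** Independence applied to all the entries above the diagonal at once. If [c] has a true bit
    elsewhere, both sides are 0. *)
Lemma P_config_of (c : config) :
  P (config_of @^-1` [set c]) = (weight (upper_prob p) c)%:E.
Proof.
have [cl|] := pselect (forall e : 'I_n * 'I_n, ~~ (e.1 < e.2)%N -> c e = false).
  have [_ _ _ iA] := erA; rewrite config_of_preimage//.
  rewrite (iA _ (fun e => [set c e])); last 2 first.
  - by move=> e; rewrite inE.
  - by [].
  rewrite (eq_bigr (fun e => (if c e then p else 1 - p)%:E)); last first.
    by move=> e; rewrite inE => e12; rewrite P_edge.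
  rewrite -(@big_morph _ _ EFin 1%E _ 1 _ (@EFinM R) erefl); congr EFin.
  rewrite /weight [RHS](bigID (fun e : 'I_n * 'I_n => (e.1 < e.2)%N)) /=.
  rewrite [X in _ = _ * X]big1 ?mulr1.
    apply: eq_big => e; first by rewrite inE.
    by rewrite inE /upper_prob => ->.
  by move=> e e12; rewrite cl// /upper_prob (negbTE e12) subr0.
move=> /existsNP[e /not_implyP[e12 ce]].
rewrite (_ : _ @^-1` _ = set0).
  rewrite measure0 /weight (bigD1 e)//=; move: ce; case: (c e) => // _.
  by rewrite /upper_prob (negbTE e12) mul0r.
apply/seteqP; split => // w /= wc; apply: ce; rewrite -wc ffunE.
by rewrite (negbTE e12).
Qed.

Lemma expectation_config_of (f : config -> R) :
  ('E_P[fun w => f (config_of w)] = (Ex (upper_prob p) f)%:E)%E.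
Proof.
rewrite unlock.
have fE w : (f (config_of w))%:E =
    (\sum_(c : config) (f c * \1_(config_of @^-1` [set c]) w)%:E)%E.
  rewrite sumEFin (bigD1 (config_of w))//= big1 ?addr0.
    by rewrite indicE mem_set ?mulr1.
  move=> c cw; rewrite indicE memNset ?mulr0//= => /eqP.
  by rewrite eq_sym (negbTE cw).
under eq_integral do rewrite fE.
rewrite integral_sum//=.
  rewrite /Ex -sumEFin; apply: eq_bigr => c _.
  under eq_integral do rewrite EFinM.
  rewrite integralZl//=; last exact: integrable_indic (measurable_config_of c).
  rewrite integral_indic//; last exact: measurable_config_of.
  rewrite setIT mulrC EFinM; congr (_ * _)%E; exact: P_config_of.
move=> c; under eq_fun do rewrite EFinM.
by apply: integrableZl => //; exact: integrable_indic (measurable_config_of c).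
Qed.

Lemma P_preimage_config_of (B : pred config) :
  P [set w | B (config_of w)] = (Ex (upper_prob p) (fun c => (B c)%:R))%:E.
Proof.
rewrite -expectation_config_of -expectation_indic.
  congr expectation; apply/funext => w; rewrite indicE; congr (_%:R).
  have [Bw|Bw] := boolP (B (config_of w)); first by rewrite mem_set.
  by rewrite memNset//; exact/negP.
rewrite (_ : [set w | _] = \bigcup_(c in [set` B]) (config_of @^-1` [set c])).
  apply: fin_bigcup_measurable => [|c _]; last exact: measurable_config_of.
  exact: finite_finpred.
apply/seteqP; split => [w Bw|w [c Bc]]; first by exists (config_of w).
by move=> /= ->.
Qed.

End transfer.

(** * Linear and quadratic forms of centred edges *)

Section quasi_linear.
Context {R : realType} {E : finType} (pr : E -> R).
Hypothesis pr01 : forall e, 0 <= pr e <= 1.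
Implicit Types (c : {ffun E -> bool}).

Lemma Ex_quasi_linear (Z : {ffun E -> bool} -> R) (K : E -> {ffun E -> bool} -> R) (b : R) :
  (forall e, ignores e (K e)) -> (forall c, Z c = b * \sum_e cen pr e c * K e c) ->
  Ex pr Z = 0.
Proof.
move=> Ki ZE; rewrite (@Ex_ext _ _ _ _ _ ZE) ExZ Ex_sum big1 ?mulr0// => e _.
exact: cenM.
Qed.

(** One factor Z is expanded, and the other is split into the contribution of bit e, which gives the
    variance, and a rest that ignores e, which gives 0. *)
Lemma Ex_quasi_linear_sqr (Z : {ffun E -> bool} -> R) (K : E -> {ffun E -> bool} -> R) (b : R) :
  (forall e, ignores e (K e)) ->
  (forall e, ignores e (fun c => Z c - cen pr e c * K e c)) ->
  (forall c, Z c = b * \sum_e cen pr e c * K e c) ->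
  Ex pr (fun c => Z c ^+ 2) = b * \sum_e vr pr e * Ex pr (fun c => K e c ^+ 2).
Proof.
move=> Ki Zi ZE.
have E1 c : Z c ^+ 2 = b * \sum_e cen pr e c * (K e c * Z c).
  rewrite expr2 {1}ZE -mulrA mulr_suml; congr (_ * _).
  by apply: eq_bigr => e _; rewrite mulrA.
rewrite (@Ex_ext _ _ _ _ _ E1) ExZ Ex_sum; congr (_ * _).
apply: eq_bigr => e _.
rewrite (@Ex_ext _ _ _ _ (fun c => cen pr e c ^+ 2 * (K e c ^+ 2) +
   cen pr e c * (K e c * (Z c - cen pr e c * K e c)))); last by move=> c; ring.
rewrite ExD cenM2; last by move=> c b'; rewrite Ki.
by rewrite cenM ?addr0// => c b'; rewrite (Zi e c b') Ki.
Qed.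

Variable w : E -> E -> R.
Hypothesis w_sym : forall e f, w e f = w f e.
Hypothesis w_diag : forall e, w e e = 0.

Definition linf e c : R := \sum_f w e f * cen pr f c.

(* linf e is the discrete derivative of quadf in the direction e. *)
Definition quadf c : R := 2^-1 * \sum_e cen pr e c * linf e c.

Lemma cen_upd c e b f :
  cen pr f (upd c e b) = cen pr f c + (f == e)%:R * (b%:R - (c e)%:R).
Proof.
rewrite /cen; have [->|fe] := eqVneq f e; first by rewrite updE mul1r; ring.
by rewrite updN// mul0r addr0.
Qed.

Lemma sum_pick e (F : E -> R) : \sum_f (f == e)%:R * F f = F e.
Proof.
rewrite (bigD1 e)//= eqxx mul1r big1 ?addr0// => f /negbTE ->.
by rewrite mul0r.
Qed.

Lemma linf_upd c e b f :
  linf f (upd c e b) = linf f c + w f e * (b%:R - (c e)%:R).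
Proof.
rewrite /linf; under eq_bigr do rewrite cen_upd mulrDr.
rewrite big_split /=; congr (_ + _).
rewrite -[RHS](@sum_pick e (fun g => w f g * (b%:R - (c e)%:R))).
by apply: eq_bigr => g _; ring.
Qed.

Lemma linf_ignores e : ignores e (linf e).
Proof. by move=> c b; rewrite linf_upd w_diag mul0r addr0. Qed.

Lemma quadf_ignores e : ignores e (fun c => quadf c - cen pr e c * linf e c).
Proof.
move=> c b; rewrite linf_ignores cen_upd eqxx mul1r /quadf.
set d := b%:R - _.
have -> : \sum_f cen pr f (upd c e b) * linf f (upd c e b) =
   \sum_f cen pr f c * linf f c + d * linf e c + d * linf e c.
  under eq_bigr do rewrite cen_upd linf_upd -/d.
  transitivity (\sum_f (cen pr f c * linf f c + (f == e)%:R * (d * linf f c) +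
     d * (w e f * cen pr f c) + (f == e)%:R * (d ^+ 2 * w f e))).
    by apply: eq_bigr => f _; rewrite (w_sym e f); ring.
  rewrite 3!big_split /= !sum_pick w_diag mulr0 addr0; congr (_ + _).
  by rewrite /linf mulr_sumr.
by field.
Qed.

Lemma Ex_linf_sqr e : Ex pr (fun c => linf e c ^+ 2) = \sum_f w e f ^+ 2 * vr pr f.
Proof.
transitivity (Ex pr (fun c => \sum_f \sum_g w e f * w e g * (cen pr f c * cen pr g c))).
  apply: Ex_ext => c; rewrite expr2 big_distrlr /=; apply: eq_bigr => f _.
  by apply: eq_bigr => g _; ring.
rewrite Ex_sum; apply: eq_bigr => f _; rewrite Ex_sum.
rewrite -[RHS](@sum_pick f (fun g => w e f * w e g * vr pr f)).
apply: eq_bigr => g _; rewrite ExZ.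
have [->|gf] := eqVneq g f.
  rewrite mul1r (@Ex_ext _ _ _ _ (fun c => cen pr f c ^+ 2 * 1)).
    by rewrite cenM2// Ex_cst mulr1.
  by move=> c; rewrite mulr1.
by rewrite cenM ?mulr0 ?mul0r//; apply: cen_ignores; rewrite eq_sym.
Qed.

(** The quadratic variation in Stein's bound concentrates, again by Efron-Stein: by symmetry of [w],
    one bit affects at most [D] of the linear forms, each by one unit. *)
Lemma Ex_sum_linf_deviation (a D : R) : (forall e f, w e f = 0 \/ w e f = 1) ->
  (forall e, vr pr e <= a) -> (forall e, \sum_f w e f <= D) -> 1 <= a * D ->
  0 <= a -> 0 <= D ->
  Ex pr (fun c => (\sum_e vr pr e * linf e c ^+ 2 -
     Ex pr (fun c => \sum_e vr pr e * linf e c ^+ 2)) ^+ 2) <=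
  (\sum_e vr pr e) * (10 * a ^+ 3 * D ^+ 3).
Proof.
move=> w01 va wD aD a0 D0; pose V c := \sum_e vr pr e * linf e c ^+ 2.
have w0 e f : 0 <= w e f by case: (w01 e f) => ->.
have w2 e f : w e f ^+ 2 = w e f by case: (w01 e f) => ->; rewrite ?expr0n ?expr1n.
have v0 e : 0 <= vr pr e by exact: vr_ge0.
have EL e : Ex pr (fun c => linf e c ^+ 2) <= a * D.
  rewrite Ex_linf_sqr; apply: (@le_trans _ _ (\sum_f w e f * a)).
    by apply: ler_sum => f _; rewrite w2 ler_wpM2l.
  by rewrite -mulr_suml mulrC ler_wpM2l.
(* (2|l| + 1)^2 <= 8 l^2 + 2, and 1 <= a * D absorbs the 2 into the 10. *)
have EM e : Ex pr (fun c => (2 * `|linf e c| + 1) ^+ 2) <= 10 * (a * D).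
  apply: (@le_trans _ _ (Ex pr (fun c => 8 * linf e c ^+ 2 + 2))).
    apply: ler_Ex => // c; rewrite -(real_normK (num_real (linf e c))).
    by have := sqr_ge0 (2 * `|linf e c| - 1); lra.
  by rewrite ExD ExZ Ex_cst; have := EL e; lra.
apply: (le_trans (efron_stein pr01 V)).
rewrite mulr_suml; apply: ler_sum => f _; rewrite ler_wpM2l//.
have dV c : `|dif f V c| <= a * \sum_e w e f * (2 * `|linf e c| + 1).
  rewrite /dif /V -sumrB (le_trans (ler_norm_sum _ _ _))// mulr_sumr.
  apply: ler_sum => e _; rewrite -mulrBr normrM (ger0_norm (v0 e)).
  apply: ler_pM => //; rewrite subr_sqr !linf_upd.
  set x := linf e c.
  rewrite (_ : _ - _ = w e f); last by rewrite /=; ring.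
  rewrite normrM (ger0_norm (w0 e f)) ler_wpM2l//.
  rewrite (_ : _ + _ = 2 * x + w e f * (1 - 2 * (c f)%:R)); last by rewrite /=; ring.
  rewrite (le_trans (ler_normD _ _))// normrM ger0_norm// lerD2l normrM (ger0_norm (w0 e f)).
  have : `|1 - 2 * (c f)%:R| <= 1 :> R.
    by case: (c f); rewrite /= ler_norml; apply/andP; split; lra.
  by case: (w01 e f) => ->; rewrite ?mul0r ?mul1r.
apply: (@le_trans _ _ (Ex pr (fun c => a ^+ 2 * (D * \sum_e w e f * (2 * `|linf e c| + 1) ^+ 2)))).
  apply: ler_Ex => // c; rewrite -(real_normK (num_real (dif f V c))).
  apply: (@le_trans _ _ ((a * \sum_e w e f * (2 * `|linf e c| + 1)) ^+ 2)).
    by apply: lerXn2r; rewrite ?nnegrE// (le_trans _ (dV c)).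
  rewrite exprMn ler_wpM2l ?sqr_ge0//.
  apply: (le_trans (@sqr_sum_le _ _ _ (fun e => w e f) _ _)) => //.
  rewrite ler_wpM2r//.
    by apply: sumr_ge0 => e _; rewrite mulr_ge0 ?sqr_ge0.
  by under eq_bigr do rewrite w_sym.
rewrite 2!ExZ Ex_sum (_ : 10 * a ^+ 3 * D ^+ 3 = a ^+ 2 * (D * (D * (10 * (a * D))))); last by ring.
rewrite ler_wpM2l ?sqr_ge0// ler_wpM2l//.
apply: (@le_trans _ _ (\sum_e w e f * (10 * (a * D)))).
  by apply: ler_sum => e _; rewrite ExZ ler_wpM2l.
rewrite -mulr_suml ler_wpM2r//; first by lra.
by under eq_bigr do rewrite w_sym.
Qed.

End quasi_linear.

(** * The adjacency relation between edges *)

Section edge_adjacency.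
Context {R : realType} {n : nat}.
Local Notation V := 'I_n.
Implicit Types (i j k : V) (e f : V * V).

Definition upper e : bool := (e.1 < e.2)%N.

(** Adjacency in the line graph of the complete graph, an edge being represented by its pair above
    the diagonal. *)
Definition nbr e f : bool :=
  [&& upper e, upper f, e != f & touches e.1 f || touches e.2 f].

Lemma nbrC e f : nbr e f = nbr f e.
Proof.
rewrite /nbr /touches [f == e]eq_sym [f.1 == e.1]eq_sym [f.2 == e.1]eq_sym
  [f.1 == e.2]eq_sym [f.2 == e.2]eq_sym.
by case: (upper e); case: (upper f); case: (e != f); case: (e.1 == f.1);
  case: (e.1 == f.2); case: (e.2 == f.1); case: (e.2 == f.2).
Qed.

Lemma nbrxx e : nbr e e = false.
Proof. by rewrite /nbr eqxx !andbF. Qed.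

Lemma upper_edgeP i j : i != j -> upper (edge i j).
Proof. exact: edge_upper. Qed.

Lemma edge_ne e : upper e -> e.1 != e.2.
Proof. by apply: contraTneq => e12; rewrite /upper e12 ltnn. Qed.

Lemma mem_row_edges i j e : i != j ->
  (e \in row_edges i j) = [&& upper e, e != edge i j & touches i e].
Proof.
move=> ij; apply/mapP/and3P => [[k + ->]|[ue eij /orP[]/eqP te]].
- rewrite mem_filter => /andP[/andP[ki kj] _]; split.
  + by rewrite upper_edgeP// eq_sym.
  + by rewrite edge_eq eqxx /= (negbTE kj) (negbTE ij).
  + by rewrite touches_edge eqxx.
- have eE := upper_edge ue; rewrite te in eE.
  exists e.2 => //; rewrite mem_filter mem_index_enum andbT.
  apply/andP; split; first by rewrite -te eq_sym edge_ne.
  by apply: contraNneq eij => <-; rewrite -eE.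
- have eE := upper_edge ue; rewrite te edgeC in eE.
  exists e.1 => //; rewrite mem_filter mem_index_enum andbT.
  apply/andP; split; first by rewrite -te edge_ne.
  by apply: contraNneq eij => <-; rewrite -eE.
Qed.

Lemma big_nbr i j (F : V * V -> R) : i != j ->
  \sum_f (nbr (edge i j) f)%:R * F f =
  \sum_(k | (k != i) && (k != j)) F (edge i k) +
  \sum_(k | (k != j) && (k != i)) F (edge j k).
Proof.
move=> ij; have ji : j != i by rewrite eq_sym.
rewrite -!big_row_edges -big_cat /=.
have us : uniq (row_edges i j ++ row_edges j i).
  rewrite cat_uniq !row_edges_uniq andbT /=; apply/hasPn => e.
  rewrite !mem_row_edges// => /and3P[ue eij tj]; apply/negP => /and3P[_ _ ti].
  move: eij; rewrite edgeC {1}(upper_edge ue) edge_eq; move: ti tj.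
  rewrite /touches => /orP[]/eqP t1 /orP[]/eqP t2; rewrite ?t1 ?t2 ?eqxx ?orbT//.
    by move: ij; rewrite -t1 t2 eqxx.
  by move: ij; rewrite -t1 t2 eqxx.
rewrite [RHS]big_uniq// [RHS]big_mkcond /=; apply: eq_bigr => f _.
have -> : (f \in row_edges i j ++ row_edges j i) = nbr (edge i j) f.
  rewrite mem_cat !mem_row_edges// /nbr upper_edgeP// [edge j i]edgeC eq_sym /=.
  have -> : touches (edge i j).1 f || touches (edge i j).2 f = touches i f || touches j f.
    by rewrite /edge; case: ltnP => //= _; rewrite orbC.
  by rewrite -andb_orr -andb_orr.
by case: (nbr _ _); rewrite ?mul1r ?mul0r.
Qed.

Definition adjw e f : R := (nbr e f)%:R.

Lemma adjwC e f : adjw e f = adjw f e. Proof. by rewrite /adjw nbrC. Qed.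

Lemma adjwxx e : adjw e e = 0. Proof. by rewrite /adjw nbrxx. Qed.

Lemma adjw01 e f : adjw e f = 0 \/ adjw e f = 1.
Proof. by rewrite /adjw; case: (nbr e f); [right|left]. Qed.

Lemma adjw_lower e f : ~~ upper e -> adjw e f = 0.
Proof. by move=> ue; rewrite /adjw /nbr (negbTE ue). Qed.

Lemma sum_adjw e : upper e -> \sum_f adjw e f = 2 * (n%:R - 2).
Proof.
move=> ue; have e12 := edge_ne ue.
under eq_bigr do rewrite -[adjw _ _]mulr1.
rewrite (upper_edge ue) (big_nbr (fun=> 1))// !sum_others//; last by rewrite eq_sym.
ring.
Qed.

Lemma sum_upper : \sum_(e | upper e) (1 : R) = n%:R * (n%:R - 1) / 2.
Proof.
rewrite (_ : \sum_(e | upper e) 1 = \sum_(i < n) \sum_(j < n | (i < j)%N) (1 : R)); last first.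
  by rewrite pair_big_dep.
set S := \sum_(i < n) _.
have S2 : S = \sum_(i < n) \sum_(j < n | (j < i)%N) (1 : R).
  by rewrite /S (exchange_big_dep predT).
have : S + S + n%:R = n%:R * n%:R.
  have -> : n%:R * n%:R = \sum_(i < n) \sum_(j < n) (1 : R).
    by under eq_bigr do rewrite sumr_const card_ord; rewrite sumr_const card_ord mulr_natl.
  have {1}-> : n%:R = \sum_(i < n) (1 : R) by rewrite sumr_const card_ord.
  rewrite {2}S2 /S -!big_split /=; apply: eq_bigr => i _.
  rewrite [RHS](bigID (fun j : V => (i < j)%N)) /= -addrA; congr (_ + _).
  rewrite [RHS](bigD1 i) ?ltnn//= addrC; congr (_ + _).
  apply: eq_bigl => j; rewrite -leqNgt ltn_neqAle andbC; congr (_ && _).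
move=> H; lra.
Qed.

End edge_adjacency.

Section variance.
Context {R : realType} (n : nat) (p : R).
Hypothesis p01 : 0 <= p <= 1.
Hypothesis n2 : (1 < n)%N.
Local Notation V := 'I_n.
Local Notation pr := (@upper_prob R n p).
Local Notation m := (mean n p).
Local Notation v := (p * (1 - p)).
Let pr01 := @upper_prob01 R n p p01.

Lemma vr_upper e : vr pr e = (upper e)%:R * v.
Proof.
by rewrite /vr /upper_prob /upper; case: (_ < _)%N; rewrite ?mul1r ?mul0r.
Qed.

Lemma vr_le e : vr pr e <= p.
Proof.
have /andP[p0 p1] := p01; rewrite vr_upper.
by case: (upper e); rewrite ?mul1r ?mul0r//; nra.
Qed.

Lemma sum_vr (F : V * V -> R) (a : R) : (forall i j, i != j -> F (edge i j) = a) ->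
  \sum_e vr pr e * F e = n%:R * (n%:R - 1) / 2 * v * a.
Proof.
move=> Fa; rewrite -sum_upper !mulr_suml [RHS]big_mkcond /=; apply: eq_bigr => e _.
rewrite vr_upper; have [ue|_] := boolP (upper e); last by rewrite !mul0r.
by rewrite (upper_edge ue) Fa// edge_ne.
Qed.

Lemma sum_vr_le (F : V * V -> R) (a : R) : (forall i j, i != j -> F (edge i j) <= a) ->
  \sum_e vr pr e * F e <= n%:R * (n%:R - 1) / 2 * v * a.
Proof.
have /andP[p0 p1] := p01; have v0 : 0 <= v by rewrite mulr_ge0//; lra.
move=> Fa; rewrite -(@sum_vr (fun=> a))//; apply: ler_sum => e _.
rewrite vr_upper; have [ue|_] := boolP (upper e); last by rewrite !mul0r.
by rewrite mul1r ler_wpM2l// (upper_edge ue) Fa// edge_ne.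
Qed.

(** The reason for the quadratic form: its derivative collects the centred bits of the edges
    adjacent to ij, which are the deviations of the two degrees. *)
Lemma linf_adjw i j c : i != j ->
  linf pr adjw (edge i j) c = m * (sdev p c i j + sdev p c j i).
Proof.
move=> ij; have ji : j != i by rewrite eq_sym.
have m0 : m != 0 by rewrite gt_eqF// (lt_le_trans ltr01)// mean_ge1.
rewrite /linf big_nbr// -!rdeg_cen// /sdev; field.
by [].
Qed.

Lemma Ex_linf_adjw_sqr i j : i != j ->
  Ex pr (fun c => linf pr adjw (edge i j) c ^+ 2) = 2 * (n%:R - 2) * v.
Proof.
move=> ij; rewrite Ex_linf_sqr// -(sum_adjw (upper_edgeP ij)) mulr_suml.
apply: eq_bigr => f _; rewrite vr_upper /adjw /nbr upper_edgeP//=.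
case: (upper f) => /=; last by rewrite expr0n /= !mul0r.
set b := _ && _; rewrite mul1r.
by case: b; rewrite /= ?expr1n ?expr0n /= ?mul1r ?mul0r.
Qed.

Lemma variance_le (G : {ffun V * V -> bool} -> R) (B : R) :
  (forall i j, i != j -> Ex pr (fun c => dif (edge i j) G c ^+ 2) <= B) ->
  Ex pr (fun c => (G c - Ex pr G) ^+ 2) <= n%:R * (n%:R - 1) / 2 * v * B.
Proof.
move=> GB; apply: (le_trans (efron_stein pr01 G)); exact: sum_vr_le.
Qed.

(** The third moment is interpolated between the second and the fourth by 2 z^3 <= r z^2 + z^4 / r,
    with r the square root of m. *)
Lemma Ex_linf_adjw_cube i j : i != j ->
  Ex pr (fun c => `|linf pr adjw (edge i j) c| ^+ 3) <=
  (1 + 8 * hgt_moment 2) * m * Num.sqrt m.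
Proof.
move=> ij; have ji : j != i by rewrite eq_sym.
have m1 : 1 <= m by exact: mean_ge1.
have m0 : 0 < m by lra.
have r0 : 0 < Num.sqrt m by rewrite sqrtr_gt0.
have rr : Num.sqrt m ^+ 2 = m by rewrite sqr_sqrtr// ltW.
set r := Num.sqrt m in r0 rr *.
have /andP[p0 p1] := p01.
pose l := linf pr adjw (edge i j).
have l4 c : l c ^+ 4 <= 8 * m ^+ 2 * (rhgt p c i j ^+ 2 + rhgt p c j i ^+ 2).
  rewrite /l linf_adjw//.
  have x2 := sdev_sqr_le p01 n2 c i j; have y2 := sdev_sqr_le p01 n2 c j i.
  move: x2 y2; rewrite !ler_pdivlMr//.
  set x := sdev p c i j; set y := sdev p c j i.
  set h := rhgt p c i j; set h' := rhgt p c j i => x2 y2.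
  have x4 : (x ^+ 2 * m) ^+ 2 <= h ^+ 2.
    by apply: lerXn2r; rewrite ?nnegrE ?rhgt_ge0// mulr_ge0 ?sqr_ge0// ltW.
  have y4 : (y ^+ 2 * m) ^+ 2 <= h' ^+ 2.
    by apply: lerXn2r; rewrite ?nnegrE ?rhgt_ge0// mulr_ge0 ?sqr_ge0// ltW.
  have xy4 : (x + y) ^+ 4 <= 8 * (x ^+ 4 + y ^+ 4).
    have A : (x + y) ^+ 2 <= 2 * (x ^+ 2 + y ^+ 2) by have := sqr_ge0 (x - y); lra.
    have B : (2 * (x ^+ 2 + y ^+ 2)) ^+ 2 <= 8 * (x ^+ 4 + y ^+ 4).
      by have := sqr_ge0 (x ^+ 2 - y ^+ 2); lra.
    apply: le_trans B; rewrite (exprM _ 2 2); apply: lerXn2r => //; rewrite nnegrE ?sqr_ge0//.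
    by rewrite mulr_ge0// addr_ge0 ?sqr_ge0.
  rewrite exprMn (_ : 8 * m ^+ 2 * _ = m ^+ 2 * (8 * (h ^+ 2 + h' ^+ 2))); last by ring.
  rewrite (_ : m ^+ 4 * _ = m ^+ 2 * (m ^+ 2 * (x + y) ^+ 4)); last by ring.
  rewrite ler_wpM2l ?sqr_ge0//.
  apply: (@le_trans _ _ (m ^+ 2 * (8 * (x ^+ 4 + y ^+ 4)))).
    by rewrite ler_wpM2l ?sqr_ge0.
  by lra.
have El4 : Ex pr (fun c => l c ^+ 4) <= 16 * m ^+ 2 * hgt_moment 2.
  apply: (@le_trans _ _ (Ex pr (fun c => 8 * m ^+ 2 * (rhgt p c i j ^+ 2 + rhgt p c j i ^+ 2)))).
    by apply: ler_Ex => // c; exact: l4.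
  rewrite ExZ ExD (_ : 16 * _ * _ = 8 * m ^+ 2 * (hgt_moment 2 + hgt_moment 2)); last by ring.
  rewrite ler_wpM2l ?mulr_ge0 ?(ltW m0)//.
  by apply: lerD; apply: Ex_rhgt.
have El2 : Ex pr (fun c => l c ^+ 2) <= 2 * m.
  rewrite Ex_linf_adjw_sqr// /mean.
  have : 0 <= (n%:R - 2) * p * p by rewrite !mulr_ge0// subr_ge0 ler_nat.
  by lra.
apply: (@le_trans _ _ (Ex pr (fun c => 2^-1 * (r * l c ^+ 2 + r^-1 * l c ^+ 4)))).
  apply: ler_Ex => // c; rewrite -/(l c).
  rewrite (_ : l c ^+ 4 = (l c ^+ 2) ^+ 2); last by ring.
  rewrite -(real_normK (num_real (l c))); set z := `|l c|.
  have z0 : 0 <= z by exact: normr_ge0.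
  have : 0 <= r^-1 * (z ^+ 2 * (z - r) ^+ 2).
    by rewrite mulr_ge0 ?invr_ge0 ?(ltW r0)// mulr_ge0 ?sqr_ge0.
  rewrite (_ : r^-1 * _ = r * z ^+ 2 + r^-1 * (z ^+ 2) ^+ 2 - 2 * z ^+ 3); last by field; rewrite
    gt_eqF.
  by lra.
rewrite ExZ ExD !ExZ.
have A := ler_wpM2l (ltW r0) El2.
have ri0 : 0 <= r^-1 by rewrite invr_ge0 ltW.
have B := ler_wpM2l ri0 El4.
apply: (@le_trans _ _ (2^-1 * (r * (2 * m) + r^-1 * (16 * m ^+ 2 * hgt_moment 2)))); first by lra.
rewrite le_eqVlt; apply/orP; left; apply/eqP.
by rewrite -rr; field; rewrite gt_eqF.
Qed.

End variance.

Lemma le_div_sqrt (R : rcfType) (x a y : R) : 0 <= a -> 0 < y ->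
  x ^+ 2 <= a ^+ 2 / y -> x <= a / Num.sqrt y.
Proof.
move=> a0 y0 H; have s0 : 0 < Num.sqrt y by rewrite sqrtr_gt0.
have [x0|x0] := leP x 0; first by rewrite (le_trans x0)// divr_ge0// ltW.
rewrite -(@ler_pXn2r _ 2) ?nnegrE ?(ltW x0) ?divr_ge0 ?(ltW s0)//.
by rewrite expr_div_n sqr_sqrtr// ltW.
Qed.

(** * Central limit theorems for the linear and the quadratic form *)

Section clt.
Context {R : realType} (n : nat) (p : R).

(** Inequalities that hold for all large n; under them every estimate has explicit constants, and
    limits are taken only at the end. *)
Definition regime : Prop := [/\ 0 < p, 2 * p <= 1, (4 <= n)%N & 1 <= n%:R * p].

Hypothesis reg : regime.
Local Notation V := 'I_n.
Local Notation pr := (@upper_prob R n p).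
Local Notation m := (mean n p).
Local Notation v := (p * (1 - p)).
Local Notation N := (n%:R : R).

Lemma regime_p01 : 0 <= p <= 1.
Proof. by have [p0 p2 _ _] := reg; apply/andP; split; lra. Qed.
Let p01 := regime_p01.
Let pr01 := @upper_prob01 R n p p01.

Lemma regime_gt1 : (1 < n)%N.
Proof. by have [_ _ n4 _] := reg; exact: leq_trans n4. Qed.
Let n2 := regime_gt1.

Lemma regime_ge4 : 4 <= N.
Proof. by have [_ _ n4 _] := reg; rewrite ler_nat. Qed.

Lemma var_ge : p / 2 <= v.
Proof. have [p0 p2 n4 np1] := reg; have N4 := regime_ge4; nra. Qed.

Lemma var_le : v <= p.
Proof. have [p0 p2 n4 np1] := reg; have N4 := regime_ge4; nra. Qed.

Lemma mean_ge : N * p / 2 <= m.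
Proof. have [p0 p2 n4 np1] := reg; have N4 := regime_ge4; rewrite /mean; nra. Qed.

Lemma mean_le : m <= 2 * (N * p).
Proof. have [p0 p2 n4 np1] := reg; have N4 := regime_ge4; rewrite /mean; nra. Qed.

Definition lin_form (c : {ffun V * V -> bool}) : R :=
  \sum_e (upper e)%:R * cen pr e c.

Definition cherry_form (c : {ffun V * V -> bool}) : R := quadf pr adjw c.

Definition lin_var : R := N * (N - 1) / 2 * v.

(** The number n (n - 1) (n - 2) / 2 of paths with two edges, times the variance of a product of two
    centred bits. *)
Definition cherry_var : R := N * (N - 1) * (N - 2) / 2 * v ^+ 2.

Lemma lin_var_ge : N ^+ 2 * p / 8 <= lin_var.
Proof.
have [p0 p2 n4 np1] := reg; have N4 := regime_ge4.
rewrite /lin_var.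
apply: (@le_trans _ _ (N * (N / 2) / 2 * (p / 2))); first by lra.
apply: ler_pM; [nra|lra| |exact: var_ge].
have := N4; nra.
Qed.

Lemma lin_var_gt0 : 0 < lin_var.
Proof.
have [p0 p2 n4 np1] := reg; have N4 := regime_ge4.
apply: lt_le_trans lin_var_ge; rewrite divr_gt0// mulr_gt0// exprn_gt0//; lra.
Qed.

Lemma lin_var_le : lin_var <= N ^+ 2 / 2 * p.
Proof.
have [p0 p2 n4 np1] := reg; have N4 := regime_ge4.
rewrite /lin_var; apply: ler_pM; [nra|nra|nra|exact: var_le].
Qed.

Lemma cherry_var_ge : N ^+ 3 * p ^+ 2 / 32 <= cherry_var.
Proof.
have [p0 p2 n4 np1] := reg; have N4 := regime_ge4.
rewrite /cherry_var.
apply: (@le_trans _ _ (N * (N / 2) * (N / 2) / 2 * (p / 2) ^+ 2)); first by lra.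
have A : (p / 2) ^+ 2 <= v ^+ 2.
  by apply: lerXn2r; rewrite ?nnegrE; have := var_ge; nra.
have B : N * (N / 2) * (N / 2) / 2 <= N * (N - 1) * (N - 2) / 2.
  have C : (N / 2) * (N / 2) <= (N - 1) * (N - 2).
    by apply: ler_pM; have := N4; have := N4; lra.
  nra.
apply: ler_pM => //; last exact: sqr_ge0.
Qed.

Lemma cherry_var_gt0 : 0 < cherry_var.
Proof.
have [p0 p2 n4 np1] := reg; have N4 := regime_ge4.
apply: lt_le_trans cherry_var_ge.
by rewrite divr_gt0// mulr_gt0// exprn_gt0//; lra.
Qed.

(** The quadratic variation is deterministic, so only the Lyapunov term of Stein's bound remains; by
    the normalisation it equals 2 x^2 |k|. *)
Lemma lin_clt (k x th : R) : k ^+ 2 * lin_var = 1 ->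
  [/\ Ex pr (fun c => k * lin_form c) = 0,
      Ex pr (fun c => (k * lin_form c) ^+ 2) = 1 &
      `|Ex pr (fun c => cos (x * (k * lin_form c) + th)) - expR (- (x ^+ 2 / 2)) * cos th|
      <= 6 * `|x| ^+ 3 / Num.sqrt (N * p)].
Proof.
have [p0 p2 n4 np1] := reg; have N4 := regime_ge4.
move=> kv.
pose K (e : V * V) (c : {ffun V * V -> bool}) : R := k * (upper e)%:R.
have Ki e : ignores e (K e) by [].
have ZE c : k * lin_form c = 1 * \sum_e cen pr e c * K e c.
  rewrite mul1r /lin_form mulr_sumr; apply: eq_bigr => e _; rewrite /K; ring.
have Zi e : ignores e (fun c => k * lin_form c - cen pr e c * K e c).
  move=> c b.
  have LE c' : lin_form c' = (upper e)%:R * cen pr e c' +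
    \sum_(f | f != e) (upper f)%:R * cen pr f c' by rewrite /lin_form (bigD1 e).
  rewrite !LE /K (eq_bigr (fun f => (upper f)%:R * cen pr f c)); last first.
    by move=> f fe; rewrite cen_ignores// eq_sym.
  by ring.
have VE : \sum_e vr pr e * k ^+ 2 = 1.
  rewrite (sum_vr p (F := fun=> k ^+ 2) (a := k ^+ 2))// -[RHS]kv /lin_var; ring.
have K2 e c : vr pr e * K e c ^+ 2 = vr pr e * k ^+ 2.
  by rewrite /K vr_upper; case: (upper e); rewrite /= ?mulr1 ?mulr0 ?mul0r.
split; first exact: Ex_quasi_linear Ki ZE.
  rewrite (Ex_quasi_linear_sqr Ki Zi ZE) mul1r -VE; apply: eq_bigr => e _.
  rewrite -(@K2 e [ffun=> false]); congr (_ * _).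
  by rewrite -[RHS](Ex_cst pr).
apply: (le_trans (stein_characteristic pr01 x th ler01 Ki Zi ZE)).
have -> : Ex pr (fun c => `|1 * \sum_e vr pr e * K e c ^+ 2 - 1|) = 0.
  rewrite -[RHS](Ex_cst pr 0); apply: Ex_ext => c.
  by under eq_bigr do rewrite K2; rewrite VE mul1r subrr normr0.
have K3 e : vr pr e * Ex pr (fun c => `|K e c| ^+ 3) = vr pr e * k ^+ 2 * `|k|.
  rewrite /K Ex_cst vr_upper; case: (upper e); rewrite /= ?mulr1 ?mul0r//.
  by rewrite -(real_normK (num_real k)); ring.
under eq_bigr do rewrite K3.
rewrite -mulr_suml VE mulr0 add0r mulr1 mul1r.
(* The true order is 1 / (n sqrt p); the weaker bound provides a rate shared with the quadratic
   form. *)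
have kb : `|k| <= 3 / Num.sqrt (N * p).
  apply: le_div_sqrt => //; first by lra.
  rewrite real_normK ?num_real// ler_pdivlMr; last by lra.
  have L := lin_var_ge; have k20 := sqr_ge0 k.
  have : k ^+ 2 * (N ^+ 2 * p / 8) <= 1 by rewrite -[leRHS]kv ler_wpM2l.
  have Np : N * p <= N ^+ 2 * p / 4 by nra.
  move=> H; have : k ^+ 2 * (N * p) <= k ^+ 2 * (N ^+ 2 * p / 4) by rewrite ler_wpM2l.
  lra.
rewrite -(real_normK (num_real x)).
rewrite (_ : 2 * `|x| ^+ 2 * `|k| * `|x| = 2 * `|x| ^+ 3 * `|k|); last by ring.
rewrite (_ : 6 * _ / _ = 2 * `|x| ^+ 3 * (3 / Num.sqrt (N * p))); last by ring.
by rewrite ler_wpM2l// mulr_ge0// exprn_ge0.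
Qed.

(** The 512 satisfies 512^2 >= 2 * 32^3, where 32 bounds k^2 n^3 p^2; the other factor comes from
    [Ex_linf_adjw_cube]. *)
Definition cherry_const : R := 512 * (1 + 8 * hgt_moment 2).

Lemma cherry_clt (k x th : R) : k ^+ 2 * cherry_var = 1 ->
  [/\ Ex pr (fun c => k * cherry_form c) = 0,
      Ex pr (fun c => (k * cherry_form c) ^+ 2) = 1 &
      `|Ex pr (fun c => cos (x * (k * cherry_form c) + th)) - expR (- (x ^+ 2 / 2)) * cos th|
      <= (102 * x ^+ 2 + cherry_const * `|x| ^+ 3) / Num.sqrt (N * p)].
Proof.
have [p0 p2 n4 np1] := reg; have N4 := regime_ge4.
move=> kv.
have kb : k ^+ 2 * (N ^+ 3 * p ^+ 2) <= 32.
  have := cherry_var_ge; have k20 := sqr_ge0 k.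
  by move=> /(ler_wpM2l k20); rewrite kv; lra.
have k20 := sqr_ge0 k.
pose K (e : V * V) (c : {ffun V * V -> bool}) : R := k * linf pr adjw e c.
have Ki e : ignores e (K e).
  by move=> c b; rewrite /K (linf_ignores pr (@adjwxx R n)).
(* The factor 1/2 appears because each pair of adjacent edges is counted under both edges, whereas
   the derivative counts it once. *)
have ZE c : k * cherry_form c = 2^-1 * \sum_e cen pr e c * K e c.
  rewrite /cherry_form /quadf mulrCA mulr_sumr; congr (_ * _).
  by apply: eq_bigr => e _; rewrite /K; ring.
have Zi e : ignores e (fun c => k * cherry_form c - cen pr e c * K e c).
  move=> c b; have := quadf_ignores pr (@adjwC R n) (@adjwxx R n) e c b.
  rewrite /K /cherry_form => H; rewrite !(mulrCA _ k) -!mulrBr; congr (_ * _).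
  exact: H.
have V0 : k ^+ 2 / 2 * \sum_e vr pr e * Ex pr (fun c => linf pr adjw e c ^+ 2) = 1.
  rewrite (sum_vr p (F := fun e => Ex pr (fun c => linf pr adjw e c ^+ 2)) (a := 2 * (N - 2) *
    v)); last by move=> i j; exact: Ex_linf_adjw_sqr.
  by rewrite -[RHS]kv /cherry_var; field.
split; first exact: Ex_quasi_linear Ki ZE.
  rewrite (Ex_quasi_linear_sqr Ki Zi ZE) -[RHS]V0 mulr_sumr mulr_sumr.
  apply: eq_bigr => e _.
  rewrite /K (@Ex_ext _ _ _ _ (fun c => k ^+ 2 * linf pr adjw e c ^+ 2)).
    by rewrite ExZ; ring.
  by move=> c; rewrite exprMn.
have h0 : (0 : R) <= 2^-1 by rewrite invr_ge0.
apply: (le_trans (stein_characteristic pr01 x th h0 Ki Zi ZE)).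
(* Jensen's inequality and [Ex_sum_linf_deviation] with a = p and D = 2n; 102^2 exceeds 10 *
   32^2. *)
have T1 : Ex pr (fun c => `|2^-1 * \sum_e vr pr e * K e c ^+ 2 - 1|) <= 102 / Num.sqrt (N * p).
  apply: le_div_sqrt => //; first by lra.
  apply: (le_trans (Ex_jensen pr01 _)).
  pose W c := \sum_e vr pr e * linf pr adjw e c ^+ 2.
  have EW : k ^+ 2 / 2 * Ex pr W = 1.
    rewrite -[RHS]V0 /W Ex_sum; congr (_ * _); apply: eq_bigr => e _; exact: ExZ.
  rewrite (@Ex_ext _ _ _ _ (fun c => (k ^+ 2 / 2) ^+ 2 * (W c - Ex pr W) ^+ 2)); last first.
    move=> c; rewrite real_normK ?num_real// -exprMn mulrBr EW; congr ((_ - _) ^+ 2).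
    rewrite /W !mulr_sumr; apply: eq_bigr => e _; rewrite /K; ring.
  rewrite ExZ.
  have D := @Ex_sum_linf_deviation R _ pr pr01 adjw (@adjwC R n)
    p (2 * N) (@adjw01 R n) (vr_le p01).
  have {}D := D _ _ (ltW p0) _.
  have D1 (e : V * V) : \sum_f adjw e f <= 2 * N.
    have [ue|ue] := boolP (upper e); first by rewrite sum_adjw//; lra.
    by rewrite big1 => [|f _]; [lra|rewrite adjw_lower].
  have D2 : 1 <= p * (2 * N) by lra.
  have D3 : 0 <= 2 * N by lra.
  have {}D := D D1 D2 D3.
  have SV : \sum_e vr pr e <= N ^+ 2 / 2 * p.
    under eq_bigr do rewrite -[vr _ _]mulr1.
    by rewrite (@sum_vr _ _ _ (fun=> 1) 1)// mulr1; exact: lin_var_le.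
  have z0 : 0 <= 10 * p ^+ 3 * (2 * N) ^+ 3 by rewrite !mulr_ge0 ?exprn_ge0 ?(ltW p0).
  apply: (@le_trans _ _ ((k ^+ 2 / 2) ^+ 2 * (N ^+ 2 / 2 * p * (10 * p ^+ 3 * (2 * N) ^+ 3)))).
    rewrite ler_wpM2l ?sqr_ge0// (le_trans D)// ler_wpM2r//.
  rewrite ler_pdivlMr; last by lra.
  rewrite (_ : _ * (N * p) = 10 * (k ^+ 2 * (N ^+ 3 * p ^+ 2)) ^+ 2 * p); last by field.
  have A0 : 0 <= k ^+ 2 * (N ^+ 3 * p ^+ 2).
    by rewrite mulr_ge0// mulr_ge0// exprn_ge0 ?(ltW p0).
  have : (k ^+ 2 * (N ^+ 3 * p ^+ 2)) ^+ 2 <= 32 ^+ 2.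
    by apply: lerXn2r; rewrite ?nnegrE.
  set A := (_ * _) ^+ 2 => HA; have A1 : 0 <= A by exact: sqr_ge0.
  nra.
have T2 : \sum_e vr pr e * Ex pr (fun c => `|K e c| ^+ 3) <= cherry_const / Num.sqrt (N * p).
  have h2 := hgt_moment_ge0 (R := R) 2.
  have hc : 0 <= 1 + 8 * hgt_moment 2 :> R by lra.
  have m1 : 1 <= m by exact: mean_ge1.
  have r0 := sqrtr_ge0 m.
  apply: (@le_trans _ _ (lin_var * (`|k| ^+ 3 * ((1 + 8 * hgt_moment 2) * m * Num.sqrt m)))).
    apply: sum_vr_le => // i j ij.
    rewrite /K (@Ex_ext _ _ _ _ (fun c => `|k| ^+ 3 * `|linf pr adjw (edge i j) c| ^+ 3)).
      by rewrite ExZ ler_wpM2l ?exprn_ge0// Ex_linf_adjw_cube.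
    by move=> c; rewrite normrM exprMn.
  apply: le_div_sqrt => //; [by rewrite /cherry_const mulr_ge0|lra|].
  rewrite ler_pdivlMr; last by lra.
  have E (L a H M s X : R) : (L * (a ^+ 3 * (H * M * s))) ^+ 2 * X =
    H ^+ 2 * (L ^+ 2 * (a ^+ 2) ^+ 3 * M ^+ 2 * s ^+ 2 * X) by ring.
  rewrite E.
  rewrite real_normK ?num_real// sqr_sqrtr; last by lra.
  rewrite /cherry_const [leRHS]exprMn [leRHS]mulrC ler_wpM2l ?sqr_ge0//.
  have L0 : 0 <= lin_var by rewrite ltW// lin_var_gt0.
  have L2 : lin_var ^+ 2 <= (N ^+ 2 / 2 * p) ^+ 2.
    apply: lerXn2r; rewrite ?nnegrE//; last exact: lin_var_le.
    by apply: le_trans lin_var_le.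
  have M3 : m ^+ 2 * m <= (2 * (N * p)) ^+ 3.
    rewrite -exprSr; apply: lerXn2r; rewrite ?nnegrE; [lra|nra|exact: mean_le].
  have k60 : 0 <= (k ^+ 2) ^+ 3 by rewrite exprn_ge0.
  have z1 : 0 <= m ^+ 2 * m by rewrite mulr_ge0 ?sqr_ge0//; lra.
  apply: (@le_trans _ _ ((N ^+ 2 / 2 * p) ^+ 2 * (k ^+ 2) ^+ 3 * (2 * (N * p)) ^+ 3 * (N * p))).
    rewrite ler_wpM2r; [by []|lra|].
    rewrite -mulrA; apply: ler_pM => //; first by rewrite mulr_ge0 ?sqr_ge0.
    by rewrite ler_wpM2r.
  rewrite (_ : _ * (N * p) = 2 * (k ^+ 2 * (N ^+ 3 * p ^+ 2)) ^+ 3 / N); last first.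
    by field; lra.
  have A0 : 0 <= k ^+ 2 * (N ^+ 3 * p ^+ 2).
    by rewrite mulr_ge0// mulr_ge0// exprn_ge0 ?(ltW p0).
  have A3 : (k ^+ 2 * (N ^+ 3 * p ^+ 2)) ^+ 3 <= 32 ^+ 3.
    by apply: lerXn2r; rewrite ?nnegrE.
  rewrite ler_pdivrMr; last by lra.
  lra.
have S1 := ler_wpM2l (normr_ge0 x) T1.
have x2 := sqr_ge0 x.
have S2 := ler_wpM2l x2 T2.
rewrite (_ : 2 * x ^+ 2 / 2 = x ^+ 2); last by field.
have S := lerD S1 S2.
apply: (le_trans (ler_wpM2r (normr_ge0 x) S)).
rewrite le_eqVlt; apply/orP; left; apply/eqP.
rewrite -(real_normK (num_real x)); ring.
Qed.

End clt.

(** * Asymptotics of the index *)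

Section gaussian_approximation.
Context {R : realType}.

Definition clt_rate (x : R) : R := 102 * x ^+ 2 + cherry_const * `|x| ^+ 3.

(** The common outcome of both cases of tau: [F] is, up to a relative error 1/(np) in variance, an
    affine function of a normalised [Z] that is nearly Gaussian. *)
Definition gaussian_approx n (p C s2 : R) (F : {ffun 'I_n * 'I_n -> bool} -> R) :=
  exists Z : {ffun 'I_n * 'I_n -> bool} -> R,
  [/\ Ex (upper_prob p) Z = 0, Ex (upper_prob p) (fun c => Z c ^+ 2) = 1,
      forall x th, `|Ex (upper_prob p) (fun c => cos (x * Z c + th)) -
        expR (- (x ^+ 2 / 2)) * cos th| <= clt_rate x / Num.sqrt (n%:R * p) &
      Ex (upper_prob p) (fun c => (F c - Ex (upper_prob p) F - Num.sqrt s2 * Z c) ^+ 2) <=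
      C * (s2 / (n%:R * p))].

Lemma gaussian_approx_form n (p C V k : R)
    (F Q : {ffun 'I_n * 'I_n -> bool} -> R) : 0 < V -> k != 0 ->
  (forall a, a ^+ 2 * V = 1 ->
    [/\ Ex (upper_prob p) (fun c => a * Q c) = 0,
        Ex (upper_prob p) (fun c => (a * Q c) ^+ 2) = 1 &
        forall x th, `|Ex (upper_prob p) (fun c => cos (x * (a * Q c) + th)) -
          expR (- (x ^+ 2 / 2)) * cos th| <= clt_rate x / Num.sqrt (n%:R * p)]) ->
  Ex (upper_prob p) (fun c => (F c - k * Q c -
    Ex (upper_prob p) (fun c => F c - k * Q c)) ^+ 2) <= C * (k ^+ 2 * V / (n%:R * p)) ->
  gaussian_approx p C (k ^+ 2 * V) F.
Proof.
move=> V0 k0 clt H; set s := Num.sqrt (k ^+ 2 * V).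
have k20 : 0 < k ^+ 2 by rewrite exprn_even_gt0.
have kV : 0 < k ^+ 2 * V by rewrite mulr_gt0.
have s0 : 0 < s by rewrite sqrtr_gt0.
have ss : s ^+ 2 = k ^+ 2 * V by rewrite sqr_sqrtr// ltW.
(* [Z] keeps the sign of [k], which is negative when tau = - 1/2. *)
have [|Z0 Z1 Z2] := clt (k / s).
  by rewrite expr_div_n ss; field; rewrite gt_eqF//= k0.
exists (fun c => k / s * Q c); split=> //.
apply: le_trans H; rewrite le_eqVlt; apply/orP; left; apply/eqP.
have sZ c : s * (k / s * Q c) = k * Q c by field; rewrite gt_eqF.
apply: Ex_ext => c; rewrite -/s sZ ExB.
rewrite (_ : Ex _ (fun c => k * Q c) = 0); last first.
  by rewrite -(@Ex_ext _ _ _ _ _ sZ) ExZ Z0 mulr0.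
by congr (_ ^+ 2); ring.
Qed.

End gaussian_approximation.

Section decomposition.
Context {R : realType} (n : nat) (p : R).
Hypothesis reg : regime n p.
Local Notation V := 'I_n.
Local Notation pr := (@upper_prob R n p).
Local Notation m := (mean n p).
Local Notation v := (p * (1 - p)).
Local Notation N := (n%:R : R).
Let p01 := regime_p01 reg.
Let n2 := regime_gt1 reg.
Let pr01 := @upper_prob01 R n p p01.
Implicit Types (i j : V) (c : {ffun V * V -> bool}).

Lemma dif_lin_form i j c : i != j -> dif (edge i j) (lin_form p) c = 1.
Proof.
move=> ij; have LE c' : lin_form p c' = (upper (edge i j))%:R * cen pr (edge i j) c' +
    \sum_(f | f != edge i j) (upper f)%:R * cen pr f c'.
  by rewrite /lin_form (bigD1 (edge i j)).
rewrite /dif !LE /cen !updE upper_edgeP//.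
rewrite (eq_bigr (fun f => (upper f)%:R * ((upd c (edge i j) false f)%:R - pr f))); last first.
  by move=> f fe; rewrite !updN.
by rewrite /=; ring.
Qed.

Lemma dif_cherry_form i j c : i != j ->
  dif (edge i j) (cherry_form p) c = m * (sdev p c i j + sdev p c j i).
Proof.
move=> ij; rewrite -linf_adjw//; set e := edge i j.
have qi := quadf_ignores pr (@adjwC R n) (@adjwxx R n) e c.
have li := linf_ignores pr (@adjwxx R n) e c.
have := qi true; have := qi false; rewrite !li /cen !updE /dif /cherry_form /=.
by move=> A B; lra.
Qed.

Lemma dif_sub e (F Q : {ffun V * V -> bool} -> R) (k : R) c :
  dif e (fun c => F c - k * Q c) c = dif e F c - k * dif e Q c.
Proof. by rewrite /dif; ring. Qed.

Lemma lin_clt_rate a : a ^+ 2 * lin_var n p = 1 ->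
    [/\ Ex pr (fun c => a * lin_form p c) = 0,
        Ex pr (fun c => (a * lin_form p c) ^+ 2) = 1 &
        forall x th, `|Ex pr (fun c => cos (x * (a * lin_form p c) + th)) -
          expR (- (x ^+ 2 / 2)) * cos th| <= clt_rate x / Num.sqrt (N * p)].
Proof.
move=> aV; have [A B _] := lin_clt reg 0 0 aV; split=> // x th.
have [_ _ /le_trans] := lin_clt reg x th aV; apply.
rewrite ler_wpM2r ?invr_ge0 ?sqrtr_ge0// /clt_rate /cherry_const.
have h := hgt_moment_ge0 (R := R) 2; have x2 := sqr_ge0 x.
have x3 : 0 <= `|x| ^+ 3 by rewrite exprn_ge0.
have : 0 <= hgt_moment 2 * `|x| ^+ 3 by exact: mulr_ge0.
by lra.
Qed.

Lemma cherry_clt_rate a : a ^+ 2 * cherry_var n p = 1 ->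
    [/\ Ex pr (fun c => a * cherry_form p c) = 0,
        Ex pr (fun c => (a * cherry_form p c) ^+ 2) = 1 &
        forall x th, `|Ex pr (fun c => cos (x * (a * cherry_form p c) + th)) -
          expR (- (x ^+ 2 / 2)) * cos th| <= clt_rate x / Num.sqrt (N * p)].
Proof.
move=> aV; have [A B _] := cherry_clt reg 0 0 aV; split=> // x th.
by have [_ _] := cherry_clt reg x th aV.
Qed.

Lemma Ex_sdev_sqr i j : i != j ->
  Ex pr (fun c => sdev p c i j ^+ 2) <= hgt_moment 1 / m.
Proof.
move=> ij; apply: (@le_trans _ _ (Ex pr (fun c => rhgt p c i j ^+ 1 / m))).
  by apply: ler_Ex => // c; exact: sdev_sqr_le.
rewrite ExZr ler_wpM2r//; first by rewrite invr_ge0 (le_trans ler01)// mean_ge1.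
exact: Ex_rhgt.
Qed.

End decomposition.

Section randic_gaussian.
Context {R : realType} (tau : R).
Local Notation randic_config := (fun c => randic_index tau (adj c)).

(** The variance of the comparison form. For tau <> - 1/2 it contains a factor 1 - p, which is later
    absorbed in 1 + o(1). *)
Definition randic_var n (p : R) : R :=
  if tau == - 2^-1 then cherry_var n p / (16 * mean n p ^+ 4)
  else (1 + 2 * tau) ^+ 2 * (mean n p `^ tau) ^+ 4 * lin_var n p.

Lemma randic_gaussian_approx : exists2 C : R, 0 <= C & forall n p, regime n p ->
  gaussian_approx p C (randic_var n p) (fun c : {ffun 'I_n * 'I_n -> bool} => randic_config c).
Proof.
have [C C0 difE] := dif_randic_estimate tau.
rewrite /randic_var; have [tauE|tauN] := eqVneq.
  (* 64 is the 16 in the denominator of k^2 times the 4 in [A]. *)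
  exists (64 * C) => [|n p reg]; first by rewrite mulr_ge0.
  have p01 := regime_p01 reg; have n2 := regime_gt1 reg.
  have [p0 p2 n4 np1] := reg; have N4 := regime_ge4 reg; have V0 := cherry_var_gt0 reg.
  have := difE n p; set m := mean n p.
  have m1 : 1 <= m by exact: mean_ge1.
  have m0 : m != 0 by rewrite gt_eqF//; lra.
  rewrite (_ : (m `^ tau) ^+ 2 = m^-1); last first.
    rewrite -powR_mulrn ?powR_ge0// -powRrM tauE mulNr mulVf ?pnatr_eq0//.
    by rewrite powR_inv1//; lra.
  (* Here tau + tau^2 = - 1/4 and m^(2 tau) = 1/m, while the derivative of the quadratic form
     carries a factor m. *)
  move=> {}difE; pose k := - (4 * m ^+ 2)^-1.
  have -> : cherry_var n p / (16 * m ^+ 4) = k ^+ 2 * cherry_var n p by rewrite /k; field.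
  apply: gaussian_approx_form => //.
  - by rewrite oppr_eq0 invr_eq0 mulf_neq0 ?pnatr_eq0// expf_neq0.
  - exact: cherry_clt_rate.
  have kE (i j : 'I_n) c : i != j -> dif (edge i j) (fun c => randic_config c - k * cherry_form p
    c) c =
     dif (edge i j) randic_config c - m^-1 * (1 + 2 * tau + (tau + tau ^+ 2) * (sdev p c i j +
       sdev p c j i)).
    move=> ij; rewrite dif_sub dif_cherry_form// -/m tauE /k; field.
    by [].
  apply: (le_trans (variance_le p01 (B := C * (m^-1 / m) ^+ 2) _)).
    move=> i j ij; rewrite (@Ex_ext _ _ _ _ _ (fun c => congr1 (fun x => x ^+ 2) (kE i j c ij))).
    exact: difE.
  rewrite /cherry_var /k.
  have A : n%:R * p <= 4 * ((n%:R - 2) * (p * (1 - p))).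
    have v1 := var_ge reg.
    have : (n%:R - 2) * (p / 2) <= (n%:R - 2) * (p * (1 - p)) by rewrite ler_wpM2l//; lra.
    nra.
  set w := p * (1 - p) in A *.
  have w0 : 0 <= w by have := var_ge reg; rewrite -/w; lra.
  rewrite (_ : n%:R * (n%:R - 1) / 2 * w * _ = C * (n%:R * (n%:R - 1)) * w / m ^+ 4 / 2); last by
    field.
  rewrite [leRHS](_ : _ = (C * (n%:R * (n%:R - 1)) * w / m ^+ 4 / 2) * (4 * ((n%:R - 2) * w) /
    (n%:R * p))); last first.
    by field; rewrite m0 !gt_eqF//; lra.
  apply: ler_peMr; last by rewrite ler_pdivlMr ?mul1r//; lra.
  by rewrite divr_ge0// mulr_ge0 ?invr_ge0 ?exprn_ge0//; [rewrite !mulr_ge0//; lra|lra].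
pose t2 := (tau + tau ^+ 2) ^+ 2.
have t20 : 0 <= t2 by exact: sqr_ge0.
(* The linear form does not match the deviation terms: they enter the error through their second
   moments, of order 1/m, next to the remainder governed by [C]. *)
pose D := 2 * C + 8 * t2 * hgt_moment 1.
have h1 := hgt_moment_ge0 (R := R) 1.
have D0 : 0 <= D by apply: addr_ge0; [exact: mulr_ge0|apply: mulr_ge0 => //; exact: mulr_ge0].
have u1 : 1 + 2 * tau != 0 by apply: contraNneq tauN => H; apply/eqP; lra.
have u0 : 0 < (1 + 2 * tau) ^+ 2 by rewrite exprn_even_gt0.
exists (2 * D / (1 + 2 * tau) ^+ 2) => [|n p reg].
  by apply: divr_ge0; [exact: mulr_ge0|exact: ltW].
have p01 := regime_p01 reg; have n2 := regime_gt1 reg.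
have [p0 p2 n4 np1] := reg; have N4 := regime_ge4 reg; have V0 := lin_var_gt0 reg.
have := difE n p; set m := mean n p => {}difE.
have m1 : 1 <= m by exact: mean_ge1.
have M0 : 0 < m `^ tau by rewrite powR_gt0//; lra.
set M := m `^ tau in difE M0 *.
pose k := M ^+ 2 * (1 + 2 * tau).
have -> : (1 + 2 * tau) ^+ 2 * M ^+ 4 * lin_var n p = k ^+ 2 * lin_var n p by rewrite /k; ring.
apply: gaussian_approx_form => //.
- by apply: mulf_neq0 => //; rewrite expf_neq0// gt_eqF.
- exact: lin_clt_rate.
pose r (i j : 'I_n) c := dif (edge i j) randic_config c - M ^+ 2 * (1 + 2 * tau + (tau + tau ^+
  2) * (sdev p c i j + sdev p c j i)).
have rE (i j : 'I_n) c : i != j -> dif (edge i j) (fun c => randic_config c - k * lin_form p c) c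
  ^+ 2 <=
   2 * r i j c ^+ 2 + 4 * M ^+ 4 * t2 * (sdev p c i j ^+ 2 + sdev p c j i ^+ 2).
  move=> ij; rewrite dif_sub dif_lin_form// /t2.
  rewrite (_ : _ - k * 1 = r i j c + M ^+ 2 * (tau + tau ^+ 2) * (sdev p c i j + sdev p c j i));
    last first.
    by rewrite /r /k; ring.
  move: (r i j c) (sdev p c i j) (sdev p c j i) => a x y.
  have A1 := sqr_ge0 (a - M ^+ 2 * (tau + tau ^+ 2) * (x + y)).
  have A2 := sqr_ge0 (M ^+ 2 * (tau + tau ^+ 2) * (x - y)).
  lra.
apply: (le_trans (variance_le p01 (B := D * (M ^+ 4 / m)) _)).
  move=> i j ij; have ji : j != i by rewrite eq_sym.
  have pr01 := @upper_prob01 R n p p01.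
  apply: (@le_trans _ _ (Ex (upper_prob p) (fun c => 2 * r i j c ^+ 2 + 4 * M ^+ 4 * t2 * (sdev p
    c i j ^+ 2 + sdev p c j i ^+ 2)))).
    by apply: ler_Ex => // c; exact: rE.
  rewrite ExD !ExZ ExD.
  have B1 := difE i j p01 ij; rewrite -/(r i j) in B1.
  have B2 := Ex_sdev_sqr reg ij; have B3 := Ex_sdev_sqr reg ji.
  have z : 0 <= 4 * M ^+ 4 * t2 by apply: mulr_ge0 => //; rewrite mulr_ge0// exprn_ge0// ltW.
  have B4 := ler_wpM2l z (lerD B2 B3).
  have B5 : (M ^+ 2 / m) ^+ 2 <= M ^+ 4 / m.
    rewrite (_ : (M ^+ 2 / m) ^+ 2 = M ^+ 4 / m / m); last by field; rewrite gt_eqF//; lra.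
    rewrite ler_piMr//; last by rewrite invf_le1//; lra.
    by rewrite divr_ge0 ?exprn_ge0 ?(ltW M0)//; lra.
  have B6 := ler_wpM2l C0 B5.
  rewrite (_ : D * (M ^+ 4 / m) = 2 * (C * (M ^+ 4 / m)) + 4 * M ^+ 4 * t2 * (hgt_moment 1 / m +
    hgt_moment 1 / m)).
    by apply: lerD => //; lra.
  by rewrite /D; ring.
rewrite -/(lin_var n p).
rewrite [leRHS](_ : _ = lin_var n p * (D * (M ^+ 4 / m)) * (2 * m / (n%:R * p))); last first.
  by rewrite /k; field; rewrite u1 !gt_eqF//; lra.
apply: ler_peMr; last by rewrite ler_pdivlMr ?mul1r; have := mean_ge reg; rewrite -/m; lra.
by rewrite mulr_ge0 ?(ltW V0)// mulr_ge0// divr_ge0 ?exprn_ge0 ?(ltW M0)//; lra.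
Qed.

End randic_gaussian.

(** * The mean of the index *)

Section expectation.
Context {R : realType}.

Lemma powR_sqr (x a : R) : (x `^ a) ^+ 2 = x `^ (2 * a).
Proof. by rewrite -powR_mulrn ?powR_ge0// -powRrM mulrC. Qed.

Lemma mean_ge_np n (p : R) : regime n p -> n%:R * p <= mean n p.
Proof. by move=> [p0 p2 _ _]; rewrite /mean; lra. Qed.

Lemma mean_powR (a : R) : exists2 C : R, 0 <= C & forall n p, regime n p ->
  `|mean n p `^ a / (n%:R * p) `^ a - 1| <= C / (n%:R * p).
Proof.
have [C C0 H] := powR_taylor2 a.
exists (`|a| + C * (2 + 2 `^ a)) => [|n p reg].
  by rewrite addr_ge0// mulr_ge0// addr_ge0// powR_ge0.
have mge := mean_ge_np reg; have [p0 p2 _ np1] := reg.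
set m := mean n p in mge *; set q := n%:R * p in np1 mge *.
have q0 : 0 < q by lra.
rewrite (@powR_div _ a q m)//; last by lra.
rewrite mulrC mulKf; last by rewrite gt_eqF// powR_gt0.
set r := m / q.
(* The mean degree exceeds np by 1 - 2p, so the ratio lies in [1, 2] and within 1/(np) of 1. *)
have rE : r - 1 = (1 - 2 * p) / q.
  have mE : m = q + (1 - 2 * p) by rewrite /m /mean /q; ring.
  by rewrite /r mE; field; rewrite gt_eqF.
have d0 : 0 <= r - 1 by rewrite rE divr_ge0//; lra.
have dq : r - 1 <= q^-1 by rewrite rE ler_pdivrMr// mulVf ?gt_eqF//; lra.
have q1 : q^-1 <= 1 by rewrite invf_le1.
have ra : r `^ a <= 1 + 2 `^ a.
  rewrite [X in X + _](_ : _ = 1 `^ a); last by rewrite powR1.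
  apply: powR_between => //.
  by apply/orP; left; apply/andP; split; lra.
have r0 : 0 < r by lra.
have := H _ r0; set d := r - 1 in d0 dq *; set s := r `^ a in ra * => Hd.
have A : `|s - 1| <= `|s - 1 - a * d| + `|a| * d.
  by rewrite -[X in _ + _ * X]ger0_norm// -normrM (le_trans _ (ler_normD _ _))// subrK.
have B : C * d ^+ 2 * (1 + s) <= C * d * (2 + 2 `^ a).
  apply: ler_pM => //; [by rewrite mulr_ge0 ?sqr_ge0|by rewrite addr_ge0 ?powR_ge0| |lra].
  by rewrite ler_wpM2l// expr2 ler_piMl//; lra.
have D : (`|a| + C * (2 + 2 `^ a)) * d <= (`|a| + C * (2 + 2 `^ a)) * q^-1.
  by rewrite ler_wpM2l// addr_ge0// mulr_ge0// addr_ge0// powR_ge0.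
lra.
Qed.

Lemma Ex_adjM n (p : R) (i j : 'I_n) (g : {ffun 'I_n * 'I_n -> bool} -> R) : i != j ->
  ignores (edge i j) g ->
  Ex (upper_prob p) (fun c => (adj c i j)%:R * g c) = p * Ex (upper_prob p) g.
Proof.
move=> ij gi; apply/eqP; rewrite -subr_eq0 -ExZ -ExB -(cenM (upper_prob p) gi).
apply/eqP; apply: Ex_ext => c.
by rewrite /cen upper_prob_edge// /adj ij mulrBl.
Qed.

(** The deviations have mean 0, so only the error of the expansion remains and the relative error is
    1/m rather than its square root. *)
Lemma Ex_pair_term tau : exists2 C : R, 0 <= C & forall n (p : R) (i j : 'I_n),
  0 <= p <= 1 -> i != j ->
  `|Ex (upper_prob p) (fun c => pw tau (rdeg c i j).+1 * pw tau (rdeg c j i).+1) -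
    (mean n p `^ tau) ^+ 2| <= C * ((mean n p `^ tau) ^+ 2 / mean n p).
Proof.
have [C C0 H] := pair_term_estimate tau.
exists (Num.sqrt C) => [|n p i j p01 ij]; first exact: sqrtr_ge0.
have ji : j != i by rewrite eq_sym.
have pr01 := @upper_prob01 R n p p01; have n2 := ord2_gt1 ij.
have m1 := mean_ge1 p01 n2.
have y0 : 0 <= (mean n p `^ tau) ^+ 2 / mean n p by rewrite divr_ge0 ?sqr_ge0//; lra.
rewrite -(@ler_pXn2r _ 2) ?nnegrE//; last exact: mulr_ge0 (sqrtr_ge0 _) y0.
rewrite real_normK ?num_real// exprMn sqr_sqrtr//.
apply: le_trans (H n p i j p01 ij).
apply: le_trans (Ex_jensen pr01 _).
rewrite ExB ExZ !ExD !ExZ Ex_cst !Ex_sdev// !mulr0 !addr0 mulr1//.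
Qed.

Lemma Ex_randic_estimate tau : exists2 C : R, 0 <= C & forall n (p : R), 0 <= p <= 1 -> (1 < n)%N ->
  `|Ex (upper_prob p) (fun c : {ffun 'I_n * 'I_n -> bool} => randic_index tau (adj c)) -
    n%:R * (n%:R - 1) / 2 * p * (mean n p `^ tau) ^+ 2| <=
  n%:R * (n%:R - 1) / 2 * p * (C * ((mean n p `^ tau) ^+ 2 / mean n p)).
Proof.
have [C C0 H] := Ex_pair_term tau; exists C => // n p p01 n2.
have /andP[p0 p1] := p01.
set M := (mean n p `^ tau) ^+ 2; set B := C * _.
rewrite (@Ex_ext _ _ _ _ _ (@randic_index_adj R n tau)) ExZ Ex_sum.
have n_sum (a : R) : n%:R * (n%:R - 1) / 2 * a =
    2^-1 * \sum_(i < n) \sum_(j < n | j != i) a.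
  transitivity (2^-1 * \sum_(i < n) ((n%:R - 1) * a)).
    by rewrite sumr_const card_ord -mulr_natl; field.
  congr (_ * _); apply: eq_bigr => i _; apply: (addrI a).
  have -> : a + \sum_(j < n | j != i) a = \sum_(j < n) a by rewrite [RHS](bigD1 i).
  by rewrite sumr_const card_ord -mulr_natl; ring.
rewrite -2![_ / 2 * p * _]mulrA !n_sum -mulrBr -sumrB normrM ger0_norm// ler_wpM2l//.
rewrite (le_trans (ler_norm_sum _ _ _))//; apply: ler_sum => i _.
rewrite Ex_sum (bigD1 i)//= (_ : Ex _ _ = 0) ?add0r; last first.
  by rewrite -[RHS](Ex_cst (@upper_prob R n p)); apply: Ex_ext => c; exact: edge_termxx.
rewrite -sumrB (le_trans (ler_norm_sum _ _ _))//; apply: ler_sum => j ji.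
have ij : i != j by rewrite eq_sym.
rewrite (@Ex_ext _ _ _ _ (fun c => (adj c i j)%:R *
    (pw tau (rdeg c i j).+1 * pw tau (rdeg c j i).+1))); last first.
  move=> c; rewrite /edge_term; have [a|a] := boolP (adj c i j); last by rewrite !mul0r.
  by rewrite (degree_adj _ ij) (degree_adj _ ji) -(adjC c i j) a !add1n.
have gi : ignores (edge i j) (fun c : {ffun 'I_n * 'I_n -> bool} =>
    pw tau (rdeg c i j).+1 * pw tau (rdeg c j i).+1 : R).
  by move=> c b; rewrite rdeg_ignores_edge edgeC rdeg_ignores_edge.
rewrite (Ex_adjM p ij gi).
by rewrite -mulrBr normrM ger0_norm// ler_wpM2l// H.
Qed.

Lemma Ex_randic_asymptotics tau : exists2 C : R, 0 <= C & forall n p, regime n p ->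
  `|Ex (upper_prob p) (fun c : {ffun 'I_n * 'I_n -> bool} => randic_index tau (adj c)) /
    (n%:R * (n%:R * p) `^ (2 * tau + 1) / 2) - 1| <= C / (n%:R * p).
Proof.
have [C1 C10 H1] := Ex_randic_estimate tau; have [C2 C20 H2] := mean_powR (2 * tau).
exists (C2 + (1 + C2) * (1 + C1)) => [|n p reg].
  by rewrite addr_ge0// mulr_ge0// addr_ge0.
have p01 := regime_p01 reg; have n2 := regime_gt1 reg; have N4 := regime_ge4 reg.
have [p0 p2 _ np1] := reg.
have := H1 n p p01 n2; have := H2 n p reg; have := mean_ge_np reg.
rewrite powR_sqr; set m := mean n p; set q := n%:R * p in np1 *; set N := n%:R in N4 q np1 *.
set E := Ex _ _.
have q0 : 0 < q by lra.
have N0 : N != 0 by rewrite gt_eqF//; lra.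
have qt0 : 0 < q `^ (2 * tau) by rewrite powR_gt0.
have -> : q `^ (2 * tau + 1) = q * q `^ (2 * tau).
  by rewrite powRD ?(gt_eqF q0) ?implybT// powRr1 ?(ltW q0)// mulrC.
set r := m `^ (2 * tau) / q `^ (2 * tau) => mq Hr HE.
have m0 : m != 0 by rewrite gt_eqF//; lra.
(* Three errors: the mean degree against np, n - 1 against n, and the expectation against its
   leading term. *)
have -> : E / (N * (q * q `^ (2 * tau)) / 2) - 1 =
  (r - 1) - r / N + (E - N * (N - 1) / 2 * p * m `^ (2 * tau)) / (N * (q * q `^ (2 * tau)) / 2).
  have id1 Q X : Q != 0 -> E / (N * (N * p * Q) / 2) - 1 = (X / Q - 1) - X / Q / N +
      (E - N * (N - 1) / 2 * p * X) / (N * (N * p * Q) / 2).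
    by move=> Q0; field; rewrite Q0 N0 gt_eqF.
  by apply: id1; rewrite gt_eqF.
have r0 : 0 <= r by rewrite divr_ge0 ?powR_ge0.
have q1 : q^-1 <= 1 by rewrite invf_le1.
have iq : 0 < q^-1 by rewrite invr_gt0.
have rle : r <= 1 + C2.
  have := ler_norm (r - 1); have : C2 / q <= C2 by rewrite ler_piMr.
  lra.
have Nq : N^-1 <= q^-1 by rewrite lef_pV2 ?posrE//; [rewrite /q ler_piMr|]; lra.
have T : `|r / N| <= (1 + C2) / q.
  have N10 : 0 <= N^-1 by rewrite invr_ge0; lra.
  by rewrite ger0_norm; [exact: ler_pM|exact: mulr_ge0].
have mi : m^-1 <= q^-1 by rewrite lef_pV2 ?posrE//; lra.
have S : `|(E - N * (N - 1) / 2 * p * m `^ (2 * tau)) / (N * (q * q `^ (2 * tau)) / 2)| <= (1 +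
  C2) * C1 / q.
  have z0 : 0 < N * (q * q `^ (2 * tau)) / 2.
    by rewrite divr_gt0// !mulr_gt0//; lra.
  rewrite normrM normfV (ger0_norm (ltW z0)) ler_pdivrMr//.
  apply: (le_trans HE).
  rewrite (_ : N * (N - 1) / 2 * p * _ = (N * (q * q `^ (2 * tau)) / 2) * (C1 * (r * m^-1)) * ((N
    - 1) / N)); last first.
    have id2 Q X : Q != 0 -> N * (N - 1) / 2 * p * (C1 * (X / m)) =
        N * (N * p * Q) / 2 * (C1 * (X / Q * m^-1)) * ((N - 1) / N).
      by move=> Q0; field; rewrite Q0 N0 m0.
    by apply: id2; rewrite gt_eqF.
  rewrite [leRHS]mulrC.
  apply: (@le_trans _ _ (N * (q * q `^ (2 * tau)) / 2 * (C1 * (r / m)))).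
    rewrite ler_piMr//; last by rewrite ler_pdivrMr ?mul1r; lra.
    by rewrite mulr_ge0 ?(ltW z0)// mulr_ge0// divr_ge0//; lra.
  rewrite ler_wpM2l ?(ltW z0)//.
  rewrite (_ : (1 + C2) * C1 / q = C1 * ((1 + C2) / q)); last by ring.
  by rewrite ler_wpM2l//; apply: ler_pM => //; rewrite invr_ge0; lra.
rewrite (_ : (C2 + (1 + C2) * (1 + C1)) / q = C2 / q + (1 + C2) / q + (1 + C2) * C1 / q); last by
  ring.
apply: (le_trans (ler_normD _ _)); apply: lerD => //.
by apply: (le_trans (ler_normB _ _)); apply: lerD.
Qed.

End expectation.

(** * Standardisation by an asymptotically equivalent variance *)

Section standardized.
Context {R : realType}.

Lemma Ex_norm_le (E : finType) (pr : E -> R) (f : {ffun E -> bool} -> R) (a : R) :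
  (forall e, 0 <= pr e <= 1) -> 0 <= a ->
  Ex pr (fun c => f c ^+ 2) <= a -> Ex pr (fun c => `|f c|) <= Num.sqrt a.
Proof.
move=> pr01 a0 fa; rewrite -(@ler_pXn2r _ 2) ?nnegrE ?sqrtr_ge0//; last first.
  by apply: Ex_ge0 => // c; exact: normr_ge0.
rewrite sqr_sqrtr//; apply: le_trans fa; apply: (le_trans (Ex_jensen pr01 _)).
by rewrite (@Ex_ext _ _ _ _ (fun c => f c ^+ 2))// => c; rewrite real_normK ?num_real.
Qed.

Definition standard n (p sg : R) (F : {ffun 'I_n * 'I_n -> bool} -> R) c : R :=
  (F c - Ex (upper_prob p) F) / Num.sqrt sg.

(** Bounds the squared L^2 distance from the standardised [F] to [Z]: the first summand pays for
    dividing by [sg] in place of [s2], the second for the approximation of [F]. *)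
Definition standard_error n (p C s2 sg : R) : R :=
  2 * (Num.sqrt (s2 / sg) - 1) ^+ 2 + 2 * C * (s2 / sg * (n%:R * p)^-1).

Lemma gaussian_approx_standard n (p C s2 sg : R)
    (F : {ffun 'I_n * 'I_n -> bool} -> R) :
  0 <= p <= 1 -> 0 <= C -> 0 < s2 -> 0 < sg -> gaussian_approx p C s2 F ->
  (forall t th, `|Ex (upper_prob p) (fun c => cos (t * standard p sg F c + th)) -
     expR (- (t ^+ 2 / 2)) * cos th| <=
     `|t| * Num.sqrt (standard_error n p C s2 sg) + clt_rate t / Num.sqrt (n%:R * p)) /\
  Ex (upper_prob p) (fun c => `|standard p sg F c|) <= 1 + Num.sqrt (standard_error n p C s2 sg).
Proof.
move=> p01 C0 s20 sg0 [Z [Z0 Z1 Zcos ZF]].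
have pr01 := @upper_prob01 R n p p01; have /andP[p0 _] := p01.
set r := Num.sqrt (s2 / sg).
have q0 : 0 < Num.sqrt sg by rewrite sqrtr_gt0.
have rE : Num.sqrt s2 = r * Num.sqrt sg by rewrite -sqrtrM ?divfK ?gt_eqF// divr_ge0 ?ltW.
have rr : r ^+ 2 = s2 / sg by rewrite sqr_sqrtr// divr_ge0 ?ltW.
have e0 : 0 <= standard_error n p C s2 sg.
  apply: addr_ge0; apply: mulr_ge0; rewrite ?sqr_ge0//; first exact: mulr_ge0.
  by apply: mulr_ge0; [rewrite divr_ge0 ?ltW|rewrite invr_ge0 mulr_ge0].
pose D c := standard p sg F c - Z c.
have D2 : Ex (upper_prob p) (fun c => D c ^+ 2) <= standard_error n p C s2 sg.
  pose S c := F c - Ex (upper_prob p) F - Num.sqrt s2 * Z c.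
  apply: (@le_trans _ _ (Ex (upper_prob p) (fun c =>
      2 * (r - 1) ^+ 2 * Z c ^+ 2 + 2 * sg^-1 * S c ^+ 2))).
    apply: ler_Ex => // c; rewrite /D /standard.
    have -> : (F c - Ex (upper_prob p) F) / Num.sqrt sg - Z c =
        (r - 1) * Z c + (Num.sqrt sg)^-1 * S c.
      by rewrite /S rE; field; rewrite gt_eqF.
    have -> : sg^-1 = (Num.sqrt sg)^-1 ^+ 2 by rewrite exprVn sqr_sqrtr// ltW.
    rewrite -[2 * _ * Z c ^+ 2]mulrA -[2 * _ * S c ^+ 2]mulrA -!exprMn.
    move: ((r - 1) * Z c) (_ * S c) => x y; have := sqr_ge0 (x - y); lra.
  rewrite ExD !ExZ Z1 mulr1 /standard_error lerD2l.
  have sgi : 0 <= 2 * sg^-1 by rewrite mulr_ge0// invr_ge0 ltW.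
  apply: (le_trans (ler_wpM2l sgi ZF)).
  by rewrite le_eqVlt; apply/orP; left; apply/eqP; ring.
have D1 := Ex_norm_le pr01 e0 D2.
have WZ c : standard p sg F c = Z c + D c by rewrite /D addrC subrK.
split=> [t th|]; last first.
  apply: (@le_trans _ _ (Ex (upper_prob p) (fun c => `|Z c| + `|D c|))).
    by apply: ler_Ex => // c; rewrite WZ ler_normD.
  rewrite ExD lerD// -sqrtr1; apply: Ex_norm_le => //.
  by rewrite Z1.
rewrite (_ : _ - _ = (Ex (upper_prob p) (fun c => cos (t * standard p sg F c + th)) -
    Ex (upper_prob p) (fun c => cos (t * Z c + th))) +
    (Ex (upper_prob p) (fun c => cos (t * Z c + th)) - expR (- (t ^+ 2 / 2)) * cos th)); last by
      ring.
apply: (le_trans (ler_normD _ _)); apply: lerD; last exact: Zcos.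
rewrite -ExB; apply: (le_trans (normr_Ex pr01 _)).
apply: (@le_trans _ _ (Ex (upper_prob p) (fun c => `|t| * `|D c|))).
  apply: ler_Ex => // c; apply: (le_trans (cos_lipschitz _ _)).
  by rewrite WZ -normrM le_eqVlt; apply/orP; left; apply/eqP; congr `| _ |; ring.
by rewrite ExZ ler_wpM2l.
Qed.

End standardized.

Section central_limit.
Context {R : realType} (p : nat -> R) (C : R) (s2 sigma2 : nat -> R).
Context (F : forall n, {ffun 'I_n * 'I_n -> bool} -> R).
Hypothesis p01 : forall n, 0 <= p n <= 1.
Hypothesis C0 : 0 <= C.
Hypothesis approx : \forall n \near \oo,
  [/\ 0 < n%:R * p n, 0 < s2 n & gaussian_approx (p n) C (s2 n) (@F n)].
Hypothesis np_oo : (n%:R * p n)^-1 @[n --> \oo] --> (0 : R).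
Hypothesis ratio : s2 n / sigma2 n @[n --> \oo] --> (1 : R).

Let err n := standard_error n (p n) C (s2 n) (sigma2 n).

Let err_cvg : Num.sqrt (err n) @[n --> \oo] --> (0 : R).
Proof.
rewrite -[X in _ --> X](@sqrtr0 R); apply: continuous_cvg; first exact: sqrt_continuous.
rewrite (_ : 0 = 2 * (Num.sqrt 1 - 1) ^+ 2 + 2 * C * (1 * 0)); last first.
  by rewrite sqrtr1; ring.
apply: cvgD.
  apply: cvgMr; rewrite expr2; apply: cvgM.
    apply: cvgB; last exact: cvg_cst.
    by apply: continuous_cvg ratio; exact: sqrt_continuous.
  apply: cvgB; last exact: cvg_cst.
  by apply: continuous_cvg ratio; exact: sqrt_continuous.
by apply: cvgMr; exact: cvgM.
Qed.

(** Read off from the ratio, which tends to 1 with a positive numerator. *)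
Let sigma2_gt0 : \forall n \near \oo, 0 < sigma2 n.
Proof.
have r0 : \forall n \near \oo, 0 < s2 n / sigma2 n.
  by apply: (cvgr_gt _ ratio); exact: ltr01.
near=> n; have s0 : 0 < s2 n / sigma2 n by near: n.
have [_ s20 _] : [/\ 0 < n%:R * p n, 0 < s2 n & gaussian_approx (p n) C (s2 n) (@F n)] by near: n.
by move: s0; rewrite pmulr_rgt0// invr_gt0.
Unshelve. all: by end_near. Qed.

Lemma central_limit x : {for x, continuous (@Phi R)} ->
  Ex (upper_prob (p n)) (fun c => (standard (p n) (sigma2 n) (@F n) c <= x)%R%:R)
    @[n --> \oo] --> Phi x.
Proof.
pose L n f := Ex (upper_prob (p n)) (fun c => f (standard (p n) (sigma2 n) (@F n) c) : R).
(* 2 eventually bounds the first absolute moment: at most 1 comes from [Z], the rest from a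
   vanishing error. *)
apply: (@cvg_distribution_function _ L _ _ _ _ 2 x).
- by move=> n a b f g; rewrite /L ExD !ExZ.
- by move=> n f g fg; apply: ler_Ex => [|c]; [exact: upper_prob01|exact: fg].
- by move=> n; exact: Ex_cst.
- move=> t th; apply/cvgrPdist_le => eps eps0.
  have B : (fun n => `|t| * Num.sqrt (err n) + clt_rate t * Num.sqrt ((n%:R * p n)^-1)) @ \oo -->
    (0 : R).
    rewrite (_ : 0 = `|t| * 0 + clt_rate t * Num.sqrt 0); last by rewrite sqrtr0; ring.
    apply: cvgD; first exact: cvgMr.
    by apply: cvgMr; apply: continuous_cvg np_oo; exact: sqrt_continuous.
  move/cvgrPdist_le : B => /(_ _ eps0) B.
  near=> n.
  have [q0 s20 ga] : [/\ 0 < n%:R * p n, 0 < s2 n & gaussian_approx (p n) C (s2 n) (@F n)] by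
    near: n.
  have sg0 : 0 < sigma2 n by near: n.
  have [H _] := gaussian_approx_standard (p01 n) C0 s20 sg0 ga.
  rewrite distrC; apply: (le_trans (H t th)).
  have : `|0 - (`|t| * Num.sqrt (err n) + clt_rate t * Num.sqrt ((n%:R * p n)^-1))| <= eps.
    by near: n.
  by rewrite sub0r normrN sqrtrV ?(ltW q0)// => /(le_trans (ler_norm _)).
- near=> n.
  have [q0 s20 ga] : [/\ 0 < n%:R * p n, 0 < s2 n & gaussian_approx (p n) C (s2 n) (@F n)] by
    near: n.
  have sg0 : 0 < sigma2 n by near: n.
  have [_ H] := gaussian_approx_standard (p01 n) C0 s20 sg0 ga.
  apply: (le_trans H); rewrite (_ : 2 = 1 + 1)// lerD2l; near: n.
  by apply: (cvgr_le _ err_cvg); exact: ltr01.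
Unshelve. all: by end_near. Qed.

End central_limit.

(** * The edge probability as n grows *)

Section edge_probability.
Context {R : realType}.

Lemma cvg_powRN (a : R) : 0 < a -> n%:R `^ (- a) @[n --> \oo] --> (0 : R).
Proof.
move=> a0; apply/cvgrPdist_le => eps eps0; near=> n.
rewrite sub0r normrN ger0_norm ?powR_ge0// powRN.
have e0 : 0 < eps `^ (- a^-1) by rewrite powR_gt0.
have nK : eps `^ (- a^-1) <= n%:R by near: n; exact: nbhs_infty_ger.
have : (eps `^ (- a^-1)) `^ a <= n%:R `^ a.
  by rewrite ge0_ler_powR ?nnegrE ?(ltW a0)// ltW.
rewrite -powRrM mulNr mulVf ?gt_eqF// powR_inv1 ?(ltW eps0)// => H.
have i0 : 0 < eps^-1 by rewrite invr_gt0.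
by rewrite -[leRHS]invrK lef_pV2 ?posrE// (lt_le_trans i0).
Unshelve. all: by end_near. Qed.

Lemma eqThetaP (f g : nat -> R) (a b : R) : 0 < a -> 0 < b ->
  (\forall n \near \oo, 0 < g n /\ a <= f n / g n <= b) -> f =Theta_\oo g.
Proof.
move=> a0 b0 H; rewrite eqThetaE qualifE; apply/asboolP.
exists (a, b) => /=; first by rewrite a0.
near=> n.
have [g0 /andP[H1 H2]] : 0 < g n /\ a <= f n / g n <= b by near: n.
rewrite ler_pdivlMr// in H1; rewrite ler_pdivrMr// in H2.
have f0 : 0 <= f n by rewrite (le_trans _ H1)// mulr_ge0 ?ltW.
by rewrite !ger0_norm// ltW.
Unshelve. all: by end_near. Qed.

Variable alpha : R.
Hypothesis alpha01 : 0 < alpha < 1.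
Local Notation p := (edge_prob alpha).

Lemma edge_prob01 n : 0 <= p n <= 1.
Proof.
have /andP[a0 a1] := alpha01; rewrite /edge_prob powR_ge0/=.
case: n => [|n]; first by rewrite powR0// oppr_eq0 gt_eqF.
by rewrite -[leRHS](powRr0 (n.+1%:R : R)) ler_powR ?ler1n// oppr_le0 ltW.
Qed.

Lemma cvg_edge_prob : p n @[n --> \oo] --> (0 : R).
Proof. by have /andP[a0 a1] := alpha01; exact: cvg_powRN. Qed.

Lemma near_gt0 : \forall n \near \oo, (0 < n)%N.
Proof. exact: nbhs_infty_gt. Qed.

Lemma edge_probM n : (0 < n)%N -> n%:R * p n = n%:R `^ (1 - alpha).
Proof.
move=> n0; rewrite /edge_prob powRB; last by rewrite pnatr_eq0 -lt0n n0 implybT.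
by rewrite powRr1// powRN.
Qed.

Lemma cvg_np_inv : (n%:R * p n)^-1 @[n --> \oo] --> (0 : R).
Proof.
have /andP[a0 a1] := alpha01; have b0 : 0 < 1 - alpha by rewrite subr_gt0.
apply: cvg_trans (cvg_powRN b0); apply: near_eq_cvg; near=> n.
have n0 : (0 < n)%N by near: n; exact: near_gt0.
by rewrite edge_probM// powRN.
Unshelve. all: by end_near. Qed.

Lemma near_regime : \forall n \near \oo, regime n (p n).
Proof.
near=> n.
have n4 : (4 <= n)%N by near: n; exact: nbhs_infty_ge.
have n0 : 0 < n%:R :> R by rewrite ltr0n; exact: leq_trans n4.
have p0 : 0 < p n by rewrite powR_gt0.
split => //.
  have : p n <= 2^-1 by near: n; apply: (cvgr_le _ cvg_edge_prob); rewrite invr_gt0.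
  by lra.
have : (n%:R * p n)^-1 <= 1 by near: n; apply: (cvgr_le _ cvg_np_inv); exact: ltr01.
by rewrite invf_le1// mulr_gt0.
Unshelve. all: by end_near. Qed.

End edge_probability.

Section variance_asymptotics.
Context {R : realType} (tau : R).

Lemma randic_var_gt0 n (p : R) : regime n p -> 0 < randic_var tau n p.
Proof.
move=> reg; have [p0 p2 n4 np1] := reg.
have m1 : 1 <= mean n p := mean_ge1 (regime_p01 reg) (regime_gt1 reg).
rewrite /randic_var; have [_|tauN] := eqVneq.
  by rewrite divr_gt0 ?cherry_var_gt0// mulr_gt0// exprn_gt0//; lra.
rewrite mulr_gt0 ?lin_var_gt0// mulr_gt0//.
  by rewrite exprn_even_gt0//=; apply: contraNneq tauN => H; apply/eqP; lra.
by rewrite exprn_gt0// powR_gt0//; lra.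
Qed.

Lemma randic_var_half n (p : R) : tau = - 2^-1 -> regime n p -> randic_var tau n p =
  n%:R * (n%:R - 1) * (n%:R - 2) * p ^+ 2 * (1 - p) ^+ 2 / (32 * mean n p ^+ 4).
Proof.
move=> tauE reg; rewrite /randic_var tauE eqxx /cherry_var.
have m1 : 1 <= mean n p := mean_ge1 (regime_p01 reg) (regime_gt1 reg).
by field; rewrite gt_eqF//; lra.
Qed.

Lemma randic_var_generic n (p : R) : tau <> - 2^-1 -> randic_var tau n p =
  (1 + 2 * tau) ^+ 2 / 2 * n%:R * (n%:R - 1) * p * mean n p `^ (4 * tau) * (1 - p).
Proof.
move=> /eqP/negbTE tauN; rewrite /randic_var tauN /lin_var.
by rewrite -[(_ `^ tau) ^+ 4]powR_mulrn ?powR_ge0// -powRrM [tau * 4]mulrC; field.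
Qed.

(** 8192 = 16 * 16 * 32: the factors in n and 1 - p contribute at least 1/16, the fourth power of np
    / m at least 1/16, and 32 is the denominator. *)
Lemma variance_half_bounds n (p : R) : regime n p ->
  let s := n%:R * (n%:R - 1) * (n%:R - 2) * p ^+ 2 * (1 - p) ^+ 2 / (32 * mean n p ^+ 4) in
  8192^-1 <= s / (n%:R / (n%:R * p) ^+ 2) <= 1.
Proof.
move=> reg /=; have [p0 p2 n4 np1] := reg; have N4 := regime_ge4 reg.
have mq := mean_ge_np reg; have mle := mean_le reg.
set m := mean n p in mq mle *; set N := n%:R in N4 np1 mq mle *.
have q0 : 0 < N * p by lra.
have m4 : 0 < m ^+ 4 by rewrite exprn_gt0//; lra.
have -> : N * (N - 1) * (N - 2) * p ^+ 2 * (1 - p) ^+ 2 / (32 * m ^+ 4) / (N / (N * p) ^+ 2) =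
    ((N - 1) / N) * ((N - 2) / N) * (1 - p) ^+ 2 * (N * p) ^+ 4 / (32 * m ^+ 4).
  by field; rewrite !gt_eqF//; lra.
have A : 2^-1 <= (N - 1) / N <= 1.
  by apply/andP; split; [rewrite ler_pdivlMr|rewrite ler_pdivrMr]; lra.
have B : 2^-1 <= (N - 2) / N <= 1.
  by apply/andP; split; [rewrite ler_pdivlMr|rewrite ler_pdivrMr]; lra.
have Q : m ^+ 4 / 16 <= (N * p) ^+ 4 <= m ^+ 4.
  apply/andP; split; last by apply: lerXn2r; rewrite ?nnegrE//; lra.
  rewrite (_ : m ^+ 4 / 16 = (m / 2) ^+ 4); last by field.
  by apply: lerXn2r; rewrite ?nnegrE//; lra.
have P : 4^-1 <= (1 - p) ^+ 2 <= 1.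
  by apply/andP; split; nra.
move: A B Q P; move: ((N - 1) / N) ((N - 2) / N) ((N * p) ^+ 4) ((1 - p) ^+ 2) => a b q r.
move=> /andP[a1 a2] /andP[b1 b2] /andP[q1 q2] /andP[r1 r2].
rewrite ler_pdivlMr; last by lra.
rewrite ler_pdivrMr; last by lra.
have ab : 4^-1 <= a * b <= 1.
  apply/andP; split; last by rewrite -[leRHS]mulr1; apply: ler_pM; lra.
  by rewrite (_ : 4^-1 = 2^-1 * 2^-1); [apply: ler_pM; lra|field].
move/andP: ab => [ab1 ab2].
have abr : 16^-1 <= a * b * r <= 1.
  apply/andP; split; last by rewrite -[leRHS]mulr1; apply: ler_pM; lra.
  by rewrite (_ : 16^-1 = 4^-1 * 4^-1); [apply: ler_pM; lra|field].
move/andP: abr => [abr1 abr2].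
apply/andP; split.
  apply: (@le_trans _ _ (16^-1 * (m ^+ 4 / 16))); first by lra.
  by apply: ler_pM; lra.
apply: (@le_trans _ _ (1 * m ^+ 4)); last by lra.
by apply: ler_pM; lra.
Qed.

Lemma product_bounds (b r e : R) : 2^-1 <= b <= 1 -> 2^-1 <= r <= 2 ->
  - 2^-1 <= e <= 2^-1 -> 8^-1 <= b * r * (1 + e) <= 4.
Proof.
move=> /andP[b1 b2] /andP[r1 r2] /andP[e1 e2].
have br1 : 4^-1 <= b * r by rewrite (_ : 4^-1 = 2^-1 * 2^-1); [apply: ler_pM; lra|field].
have br2 : b * r <= 2 by rewrite -[leRHS]mul1r; apply: ler_pM; lra.
apply/andP; split.
  by rewrite (_ : 8^-1 = 4^-1 * 2^-1); [apply: ler_pM; lra|field].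
by rewrite (_ : 4 = 2 * 2); [apply: ler_pM; lra|ring].
Qed.

End variance_asymptotics.

Lemma normal_prob_ray (R : realType) (y : R) :
  (normal_prob 0 1 : set R -> \bar R) `]-oo, y]%classic = (Phi y)%:E.
Proof.
rewrite /normal_prob /Phi /gint /Rintegral fineK; last first.
  apply: integrable_fin_num => //.
  exact: (integrable_gint (linear_growth_step y)).
rewrite [LHS]integral_mkcond; apply: eq_integral => z _.
have yz : (z \in (`]-oo, y]%classic : set R)) = (z <= y)%R.
  by apply/idP/idP; rewrite inE /= in_itv.
rewrite /patch yz /phi; case: (z <= y)%R; first by rewrite mul1r.
by rewrite mul0r.
Qed.

Lemma continuous_Phi_of_normal_prob (R : realType) (x : R) :
  {for x, continuous (fun y : R => (normal_prob 0 1 : set R -> \bar R) `]-oo, y]%classic)} ->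
  {for x, continuous (@Phi R)}.
Proof.
rewrite (_ : (fun y => _) = (fun y => (Phi y)%:E)); last first.
  by apply/funext => y; exact: normal_prob_ray.
move=> H; have := fine_cvg H; exact.
Qed.

(** * Variance orders and the limit law for the given edge probabilities *)

Section asymptotics.
Context {R : realType} (tau alpha : R).
Hypothesis alpha01 : 0 < alpha < 1.
Local Notation p := (edge_prob alpha).
Local Notation F n := (fun c : {ffun 'I_n * 'I_n -> bool} => randic_index tau (adj c) : R).
Variable sigma2 : nat -> R.
Hypothesis sigma2_half : tau = - 2^-1 -> \forall n \near \oo,
  sigma2 n = n%:R * (n%:R - 1) * (n%:R - 2) * p n ^+ 2 * (1 - p n) ^+ 2
             / (32 * (1 + (n%:R - 2) * p n) ^+ 4).
Hypothesis sigma2_generic : tau <> - 2^-1 -> exists eps : nat -> R,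
  eps =o_\oo (fun=> 1 : R) /\ \forall n \near \oo,
  sigma2 n = (1 + 2 * tau) ^+ 2 / 2 * n%:R * (n%:R - 1) * p n
             * (1 + (n%:R - 2) * p n) `^ (4 * tau) * (1 + eps n).

Lemma cvg_littleo1 (eps : nat -> R) : eps =o_\oo (fun=> 1 : R) -> eps @ \oo --> (0 : R).
Proof.
move=> /eqoP H; apply/cvgrPdist_le => e e0; near=> n.
have : `|eps n| <= e * `|1 : R| by near: n; exact: H.
by rewrite normr1 mulr1 sub0r normrN.
Unshelve. all: by end_near. Qed.

(** For tau = - 1/2 the two variances eventually coincide; otherwise their ratio is (1 - p) / (1 +
    eps), and both p and eps tend to 0. *)
Lemma randic_var_ratio : randic_var tau n (p n) / sigma2 n @[n --> \oo] --> (1 : R).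
Proof.
have reg := near_regime alpha01.
have [tauE|tauN] := pselect (tau = - 2^-1).
  have H := sigma2_half tauE; apply: cvg_near_cst; near=> n.
  have rn : regime n (p n) by near: n.
  have V0 := randic_var_gt0 tau rn.
  have -> : sigma2 n = randic_var tau n (p n).
    by rewrite randic_var_half//; near: n.
  by rewrite divff// gt_eqF.
have [eps [/cvg_littleo1 e0 H]] := sigma2_generic tauN.
have : (1 - p n) / (1 + eps n) @[n --> \oo] --> ((1 - 0) / (1 + 0) : R).
  apply: cvgM; first by apply: cvgB; [exact: cvg_cst|exact: cvg_edge_prob].
  apply: cvgV; first by rewrite addr0 oner_neq0.
  by apply: cvgD => //; exact: cvg_cst.
rewrite subr0 addr0 divr1; apply: cvg_trans; apply: near_eq_cvg; near=> n.
have rn : regime n (p n) by near: n.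
have -> : sigma2 n = (1 + 2 * tau) ^+ 2 / 2 * n%:R * (n%:R - 1) * p n
             * (1 + (n%:R - 2) * p n) `^ (4 * tau) * (1 + eps n) by near: n.
have := randic_var_gt0 tau rn; rewrite randic_var_generic// /mean.
set a := _ * _ `^ _ => a0.
have [p0 p2 n4 np1] := rn.
have a1 : a != 0 by apply: contraTneq a0 => ->; rewrite mul0r ltxx.
have e1 : 1 + eps n != 0.
  have : 0 < 1 + eps n; last by move=> /gt_eqF ->.
  have : -1 < eps n by near: n; apply: (cvgr_gt _ e0); rewrite oppr_lt0.
  by lra.
by rewrite [(a * (1 + _))^-1]invfM mulrACA divff// mul1r.
Unshelve. all: by end_near. Qed.

Lemma sigma2_half_Theta : tau = - 2^-1 ->
  sigma2 =Theta_\oo (fun n => n%:R / (n%:R * p n) ^+ 2).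
Proof.
move=> tauE; have reg := near_regime alpha01; have H := sigma2_half tauE.
have c0 : 0 < 8192^-1 :> R by lra.
apply: (eqThetaP c0 ltr01); near=> n.
have rn : regime n (p n) by near: n.
have -> : sigma2 n = n%:R * (n%:R - 1) * (n%:R - 2) * p n ^+ 2 * (1 - p n) ^+ 2
             / (32 * (1 + (n%:R - 2) * p n) ^+ 4) by near: n.
split; last exact: variance_half_bounds.
have [p0 p2 n4 np1] := rn; have N4 := regime_ge4 rn.
by rewrite divr_gt0 ?exprn_gt0//; lra.
Unshelve. all: by end_near. Qed.

Lemma sigma2_generic_Theta : tau <> - 2^-1 ->
  sigma2 =Theta_\oo (fun n => n%:R * (n%:R * p n) `^ (4 * tau + 1)).
Proof.
move=> tauN; have reg := near_regime alpha01; have [eps [/cvg_littleo1 e0 H]] := sigma2_generic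
  tauN.
have [C C0 HC] := mean_powR (4 * tau).
pose k := (1 + 2 * tau) ^+ 2 / 2.
have k0 : 0 < k.
  rewrite divr_gt0// exprn_even_gt0//=; apply/eqP => h; apply: tauN; lra.
(* 1/8 and 4 are the bounds of [product_bounds] for (n - 1) / n, the ratio of the powers of m and
   np, and 1 + eps. *)
apply: (@eqThetaP _ _ _ (k / 8) (k * 4)); [by rewrite divr_gt0|by rewrite mulr_gt0|].
have Cnp : C / (n%:R * p n) @[n --> \oo] --> (0 : R).
  by rewrite -(mulr0 C); apply: cvgMr; exact: cvg_np_inv.
near=> n.
have rn : regime n (p n) by near: n.
have -> : sigma2 n = (1 + 2 * tau) ^+ 2 / 2 * n%:R * (n%:R - 1) * p n
             * (1 + (n%:R - 2) * p n) `^ (4 * tau) * (1 + eps n) by near: n.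
have [p0 p2 n4 np1] := rn; have N4 := regime_ge4 rn.
have := HC n _ rn; rewrite -/k -/(mean n (p n)).
have : C / (n%:R * p n) <= 2^-1 by near: n; apply: (cvgr_le _ Cnp); rewrite invr_gt0.
have e1 : - 2^-1 <= eps n by near: n; apply: (cvgr_ge _ e0); rewrite oppr_lt0 invr_gt0.
have e2 : eps n <= 2^-1 by near: n; apply: (cvgr_le _ e0); rewrite invr_gt0.
have q0 : 0 < n%:R * p n by lra.
have -> : (n%:R * p n) `^ (4 * tau + 1) = (n%:R * p n) * (n%:R * p n) `^ (4 * tau).
  by rewrite powRD ?(gt_eqF q0) ?implybT// powRr1 ?(ltW q0)// mulrC.
have Q0 : 0 < (n%:R * p n) `^ (4 * tau) by rewrite powR_gt0.
move: Q0; set Q := (_ * _) `^ _; set M := mean _ _ `^ _ => Q0 A B.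
have r12 : 2^-1 <= M / Q <= 2.
  by move: (le_trans B A); rewrite ler_norml => /andP[]; set r := M / Q; lra.
split; first by rewrite !mulr_gt0//; lra.
have -> : k * n%:R * (n%:R - 1) * p n * M * (1 + eps n) / (n%:R * (n%:R * p n * Q)) =
    k * ((((n%:R - 1) / n%:R) * (M / Q)) * (1 + eps n)).
  by field; rewrite !gt_eqF//; lra.
have b12 : 2^-1 <= ((n%:R : R) - 1) / n%:R <= 1.
  by apply/andP; split; [rewrite ler_pdivlMr|rewrite ler_pdivrMr]; lra.
have e12 : - 2^-1 <= eps n <= 2^-1 by rewrite e1.
by have /andP[B1 B2] := product_bounds b12 r12 e12; rewrite !ler_pM2l ?B1.
Unshelve. all: by end_near. Qed.

Lemma randic_standard_cvg x : {for x, continuous (@Phi R)} ->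
  Ex (upper_prob (p n)) (fun c => (standard (p n) (sigma2 n) (F n) c <= x)%R%:R)
    @[n --> \oo] --> Phi x.
Proof.
have [C C0 HC] := randic_gaussian_approx tau.
apply: (@central_limit _ p C (fun n => randic_var tau n (p n)) sigma2 (fun n => F n)) => //.
- exact: edge_prob01.
- have reg := near_regime alpha01; near=> n.
  have rn : regime n (p n) by near: n.
  split; [by have [p0 p2 n4 np1] := rn; lra|exact: randic_var_gt0|exact: HC].
- exact: cvg_np_inv.
- exact: randic_var_ratio.
Unshelve. all: by end_near. Qed.

End asymptotics.

Lemma randic_expectation d (T : measurableType d) (R : realType) (P : probability T R)
    (tau q : R) n (A : 'I_n -> 'I_n -> {RV P >-> bool}) :
  0 <= q <= 1 -> erdos_renyi P q A ->
  'E_P[randic tau A]%E = (Ex (upper_prob q)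
    (fun c : {ffun 'I_n * 'I_n -> bool} => randic_index tau (adj c)))%:E.
Proof.
move=> q01 erA; rewrite -(expectation_config_of q01 erA); congr expectation.
by apply/funext => w; rewrite (randic_config_of erA).
Qed.

Lemma cdf_standardize d (T : measurableType d) (R : realType) (P : probability T R)
    (tau q sg x : R) n (A : 'I_n -> 'I_n -> {RV P >-> bool}) :
  0 <= q <= 1 -> erdos_renyi P q A ->
  cdf (standardize (fine 'E_P[randic tau A]) (Num.sqrt sg) (randic tau A) : {RV P >-> R}) x =
  (Ex (upper_prob q) (fun c => (standard q sg
     (fun c : {ffun 'I_n * 'I_n -> bool} => randic_index tau (adj c)) c <= x)%R%:R))%:E.
Proof.
move=> q01 erA; rewrite -(P_preimage_config_of q01 erA) /cdf /distribution /pushforward.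
rewrite (randic_expectation tau q01 erA) /=; congr (P _).
apply/seteqP; split => w /=; rewrite in_itv /= /standardize /standard (randic_config_of erA)//.
Qed.

Theorem theorem2 (R : realType) (tau alpha : R)
    (d : nat -> measure_display) (T : forall n, measurableType (d n))
    (P : forall n, probability (T n) R)
    (A : forall n, 'I_n -> 'I_n -> {RV P n >-> bool}) :
  tau != 0 -> 0 < alpha < 1 ->
  (forall n, erdos_renyi (P n) (edge_prob alpha n) (A n)) ->
  let p : nat -> R := edge_prob alpha in
  (exists eps : nat -> R,
      eps =O_\oo (fun n => (n%:R * p n)^-1) /\
      \forall n \near \oo,
        'E_(P n)[randic tau (A n)]%E =
        (n%:R * (n%:R * p n) `^ (2 * tau + 1) / 2 * (1 + eps n))%:E) /\
  (forall sigma2 : nat -> R,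
      (tau = - 2^-1 ->
        \forall n \near \oo,
          sigma2 n = n%:R * (n%:R - 1) * (n%:R - 2) * p n ^+ 2
                     * (1 - p n) ^+ 2
                     / (32 * (1 + (n%:R - 2) * p n) ^+ 4)) ->
      (tau <> - 2^-1 ->
        exists eps : nat -> R,
          eps =o_\oo (fun=> 1 : R) /\
          \forall n \near \oo,
            sigma2 n = (1 + 2 * tau) ^+ 2 / 2 * n%:R * (n%:R - 1) * p n
                       * (1 + (n%:R - 2) * p n) `^ (4 * tau)
                       * (1 + eps n)) ->
      [/\ cvg_in_distribution P
            (fun n => standardize (fine 'E_(P n)[randic tau (A n)])
                        (Num.sqrt (sigma2 n)) (randic tau (A n)))
            (normal_prob 0 1),
          tau = - 2^-1 ->
            sigma2 =Theta_\oo (fun n => n%:R / (n%:R * p n) ^+ 2)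
        & tau <> - 2^-1 ->
            sigma2 =Theta_\oo (fun n => n%:R * (n%:R * p n) `^ (4 * tau + 1))]).

Proof.
move=> tau0 alpha01 er /=; have p01 := edge_prob01 alpha01.
have EF n := randic_expectation tau (p01 n) (er n).
split.
  have [C C0 HC] := Ex_randic_asymptotics tau.
  pose L n := n%:R * (n%:R * edge_prob alpha n) `^ (2 * tau + 1) / 2.
  exists (fun n => Ex (upper_prob (edge_prob alpha n))
    (fun c : {ffun 'I_n * 'I_n -> bool} => randic_index tau (adj c)) / L n - 1).
  have reg := near_regime alpha01; split.
    (* [C + 1] is positive even when [C] is 0. *)
    apply/eqO_exP; exists (C + 1); first by lra.
    near=> n; have rn : regime n (edge_prob alpha n) by near: n.
    have [p0 p2 n4 np1] := rn.
    have iq : 0 < (n%:R * edge_prob alpha n)^-1 by rewrite invr_gt0; lra.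
    rewrite (gtr0_norm iq); apply: (le_trans (HC n _ rn)).
    by rewrite ler_wpM2r ?(ltW iq)//; lra.
  near=> n; have rn : regime n (edge_prob alpha n) by near: n.
  have [p0 p2 n4 np1] := rn; have N4 := regime_ge4 rn.
  rewrite EF; congr (_%:E); rewrite [X in _ * X]addrC subrK -/(L n) [RHS]mulrC divfK// gt_eqF//.
  by rewrite /L divr_gt0// mulr_gt0 ?powR_gt0//; lra.
move=> sigma2 H1 H2; split.
- move=> x /continuous_Phi_of_normal_prob cx.
  pose G n := Ex (upper_prob (edge_prob alpha n)) (fun c => (standard (edge_prob alpha n)
    (sigma2 n) (fun c : {ffun 'I_n * 'I_n -> bool} => randic_index tau (adj c)) c <= x)%R%:R) : R.
  have : (G n)%:E @[n --> \oo] --> (Phi x)%:E.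
    by apply: cvg_EFin; [exact: nearW|exact: randic_standard_cvg].
  rewrite -normal_prob_ray (_ : (fun n => (G n)%:E) = (fun n => cdf (standardize
    (fine 'E_(P n)[randic tau (A n)]) (Num.sqrt (sigma2 n)) (randic tau (A n)) : {RV P n >-> R}) x)).
    exact.
  by apply/funext => n; rewrite (cdf_standardize _ _ _ (p01 n) (er n)).
- exact: sigma2_half_Theta.
- exact: sigma2_generic_Theta.
Unshelve. all: by end_near. Qed.
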